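(* Let $\Lambda$ be a finite dimensional cocommutative Hopf algebra over a field $k$, and let $\mathcal A=\operatorname{Mod}\Lambda$. (1) The functor $-\otimes_k ik\colon\mathbf K(\mathcal A)\to\mathbf K(\operatorname{Inj}\mathcal A)$ is a left adjoint for the inclusion $\mathbf K(\operatorname{Inj}\mathcal A)\to\mathbf K(\mathcal A)$. (2) The functor $-\otimes_k tk\colon\mathbf K(\operatorname{Inj}\mathcal A)\to\mathbf S(\mathcal A)$ is a left adjoint for the inclusion $\mathbf S(\mathcal A)\to\mathbf K(\operatorname{Inj}\mathcal A)$. (3) The functor $\mathcal A\xrightarrow{\mathrm{can}}\mathbf K(\mathcal A)\xrightarrow{-\otimes_k tk}\mathbf S(\mathcal A)$ induces an equivalence $\underline{\mathcal A}\to\mathbf S(\mathcal A)$ with quasi-inverse $Z^0\colon\mathbf S(\mathcal A)\to\underline{\mathcal A}$.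
   Context: $\operatorname{Mod}\Lambda$ is the category of all $\Lambda$-modules; projective and injective $\Lambda$-modules coincide. $\operatorname{Inj}\mathcal A$ is the full subcategory of injective modules, $\mathbf K(-)$ the homotopy category of unbounded complexes, and $\mathbf S(\mathcal A)\subseteq\mathbf K(\operatorname{Inj}\mathcal A)$ the full subcategory of acyclic complexes of injectives. The tensor product $\otimes_k$ (with $\Lambda$ acting through the comultiplication) on $\mathcal A$ extends to a (total) tensor product on $\mathbf K(\mathcal A)$, for which $\mathbf K(\operatorname{Inj}\mathcal A)$ and $\mathbf S(\mathcal A)$ are tensor ideals. View the trivial module $k$ as a complex concentrated in degree zero. $ik$ is an injective resolution and $pk$ a projective resolution of $k$ in $\mathcal A$, with canonical maps $k\to ik$ and $pk\to k\to ik$; $tk$ is the acyclic complex (Tate resolution of $k$) defined by the exact triangle $pk\to ik\to tk\to\Sigma(pk)$ in $\mathbf K(\mathcal A)$. $\underline{\mathcal A}$ is the stable category modulo injectives: same objects as $\mathcal A$, with two maps identified if their difference factors through an injective module. $Z^0X=\operatorname{Ker}(X^0\to X^1)$. The functor $\mathrm{can}$ views a module as a complex concentrated in degree zero. *)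

(* Defs.v *)
From HB Require Import structures.
From mathcomp Require Import all_boot all_order all_algebra all_field.
From mathcomp Require Import boolp.

Set Implicit Arguments.
Unset Strict Implicit.
Unset Printing Implicit Defensive.

Import GRing.Theory.
Local Open Scope ring_scope.
Local Open Scope quotient_scope.

(* Categories whose hom-types carry their equality as an equivalence relation
   [heq]: a homotopy category, or a category modulo an ideal of maps, has the
   same hom-types as the category it comes from and a coarser [heq]. *)
Record category := Category {
  obj :> Type;
  mor : obj -> obj -> Type;
  heq : forall X Y, mor X Y -> mor X Y -> Prop;
  idm : forall X, mor X X;
  mcomp : forall X Y Z, mor Y Z -> mor X Y -> mor X Z;
  heq_refl : forall X Y (f : mor X Y), heq f f;
  heq_sym : forall X Y (f g : mor X Y), heq f g -> heq g f;
  heq_trans : forall X Y (f g h : mor X Y), heq f g -> heq g h -> heq f h;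
  comp_heq : forall X Y Z (f f' : mor Y Z) (g g' : mor X Y),
    heq f f' -> heq g g' -> heq (mcomp f g) (mcomp f' g');
  comp_idl : forall X Y (f : mor X Y), heq (mcomp (idm Y) f) f;
  comp_idr : forall X Y (f : mor X Y), heq (mcomp f (idm X)) f;
  compA : forall X Y Z W (f : mor Z W) (g : mor Y Z) (h : mor X Y),
    heq (mcomp f (mcomp g h)) (mcomp (mcomp f g) h)
}.

Arguments mor {c} _ _.
Arguments heq {c X Y} _ _.
Arguments idm {c} X.
Arguments mcomp {c X Y Z} _ _.

Notation "f ~= g" := (heq f g) (at level 70, no associativity).
Notation "f \oc g" := (mcomp f g) (at level 50, left associativity).

Record functor (C D : category) := Functor {
  fobj :> C -> D;
  fmap : forall X Y : C, mor X Y -> mor (fobj X) (fobj Y);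
  fmap_heq : forall (X Y : C) (f g : mor X Y), f ~= g -> fmap f ~= fmap g;
  fmap_id : forall X : C, fmap (idm X) ~= idm (fobj X);
  fmap_comp : forall (X Y Z : C) (f : mor Y Z) (g : mor X Y),
    fmap (f \oc g) ~= fmap f \oc fmap g
}.

Arguments fmap {C D} f {X Y} _ : rename.

Definition is_iso (C : category) (X Y : C) (f : mor X Y) : Prop :=
  exists g : mor Y X, g \oc f ~= idm X /\ f \oc g ~= idm Y.

Definition id_functor (C : category) : functor C C := {|
  fobj := fun X => X;
  fmap := fun X Y f => f;
  fmap_heq := fun X Y f g fg => fg;
  fmap_id := fun X => heq_refl (idm X);
  fmap_comp := fun X Y Z f g => heq_refl (f \oc g)
|}.

Section CompFunctor.
Variables (C D E : category) (G : functor D E) (F : functor C D).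

Fact comp_functor_heq (X Y : C) (f g : mor X Y) :
  f ~= g -> fmap G (fmap F f) ~= fmap G (fmap F g).
Proof. by move=> fg; do 2!apply: fmap_heq. Qed.
Fact comp_functor_id (X : C) : fmap G (fmap F (idm X)) ~= idm (G (F X)).
Proof. by apply: heq_trans (fmap_id _ _); apply/fmap_heq/fmap_id. Qed.
Fact comp_functor_comp (X Y Z : C) (f : mor Y Z) (g : mor X Y) :
  fmap G (fmap F (f \oc g)) ~= fmap G (fmap F f) \oc fmap G (fmap F g).
Proof. by apply: heq_trans (fmap_comp _ _ _); apply/fmap_heq/fmap_comp. Qed.

Definition comp_functor : functor C E := {|
  fobj := fun X => G (F X);
  fmap := fun X Y f => fmap G (fmap F f);
  fmap_heq := comp_functor_heq;
  fmap_id := comp_functor_id;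
  fmap_comp := comp_functor_comp
|}.
End CompFunctor.

Definition naturally_isomorphic (C D : category) (F G : functor C D) : Prop :=
  exists a : forall X : C, mor (F X) (G X),
    (forall X, is_iso (a X)) /\
    (forall (X Y : C) (f : mor X Y), a Y \oc fmap F f ~= fmap G f \oc a X).

Definition left_adjoint (C D : category) (F : functor C D) (G : functor D C) :
  Prop :=
  exists phi : forall (X : C) (Y : D), mor (F X) Y -> mor X (G Y),
    [/\ (* each [phi X Y] is well defined and bijective up to [heq] *)
        forall X Y (f g : mor (F X) Y), phi X Y f ~= phi X Y g <-> f ~= g,
        forall X Y (h : mor X (G Y)), exists f : mor (F X) Y, phi X Y f ~= h,
        forall (X X' : C) (Y : D) (u : mor X' X) (f : mor (F X) Y),
          phi X' Y (f \oc fmap F u) ~= phi X Y f \oc u &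
        forall (X : C) (Y Y' : D) (v : mor Y Y') (f : mor (F X) Y),
          phi X Y' (v \oc f) ~= fmap G v \oc phi X Y f].

Definition equivalence_with_quasi_inverse (C D : category)
    (F : functor C D) (G : functor D C) : Prop :=
  naturally_isomorphic (comp_functor G F) (id_functor C) /\
  naturally_isomorphic (comp_functor F G) (id_functor D).

Definition full_subcategory (C : category) (P : C -> Prop) : category := {|
  obj := {X : C | P X};
  mor := fun X Y => mor (sval X) (sval Y);
  heq := fun X Y f g => f ~= g;
  idm := fun X => idm (sval X);
  mcomp := fun X Y Z f g => f \oc g;
  heq_refl := fun X Y f => heq_refl f;
  heq_sym := fun X Y f g => @heq_sym C _ _ f g;
  heq_trans := fun X Y f g h => @heq_trans C _ _ f g h;
  comp_heq := fun X Y Z f f' g g' => @comp_heq C _ _ _ f f' g g';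
  comp_idl := fun X Y f => comp_idl f;
  comp_idr := fun X Y f => comp_idr f;
  compA := fun X Y Z W f g h => compA f g h
|}.

Definition inclusion (C : category) (P : C -> Prop) :
  functor (full_subcategory P) C := {|
  fobj := fun X : full_subcategory P => sval X;
  fmap := fun X Y f => f;
  fmap_heq := fun X Y f g fg => fg;
  fmap_id := fun X => heq_refl (idm (sval X));
  fmap_comp := fun X Y Z f g => @heq_refl C _ _ (mcomp f g)
|}.

Definition corestriction (C D : category) (P : D -> Prop) (F : functor C D)
  (FP : forall X : C, P (F X)) : functor C (full_subcategory P) := {|
  fobj := fun X => exist P (F X) (FP X) : full_subcategory P;
  fmap := fun X Y f => fmap F f;
  fmap_heq := fun X Y f g => @fmap_heq _ _ F X Y f g;
  fmap_id := fun X => fmap_id F X;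
  fmap_comp := fun X Y Z f g => fmap_comp F f g
|}.

(* A coarser equality on the hom-types of [C], compatible with composition. *)
Record congruence (C : category) := Congruence {
  crel : forall X Y : C, mor X Y -> mor X Y -> Prop;
  crel_heq : forall (X Y : C) (f g : mor X Y), f ~= g -> crel f g;
  crel_sym : forall (X Y : C) (f g : mor X Y), crel f g -> crel g f;
  crel_trans : forall (X Y : C) (f g h : mor X Y),
    crel f g -> crel g h -> crel f h;
  crel_comp : forall (X Y Z : C) (f f' : mor Y Z) (g g' : mor X Y),
    crel f f' -> crel g g' -> crel (f \oc g) (f' \oc g')
}.

Arguments crel {C} c {X Y} _ _.

Section QuotientCategory.
Variables (C : category) (R : congruence C).

Fact quotient_refl (X Y : C) (f : mor X Y) : crel R f f.
Proof. by apply: crel_heq; exact: heq_refl. Qed.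
Fact quotient_idl (X Y : C) (f : mor X Y) : crel R (idm Y \oc f) f.
Proof. by apply: crel_heq; exact: comp_idl. Qed.
Fact quotient_idr (X Y : C) (f : mor X Y) : crel R (f \oc idm X) f.
Proof. by apply: crel_heq; exact: comp_idr. Qed.
Fact quotient_compA (X Y Z W : C) (f : mor Z W) (g : mor Y Z) (h : mor X Y) :
  crel R (f \oc (g \oc h)) (f \oc g \oc h).
Proof. by apply: crel_heq; exact: compA. Qed.

Definition quotient_category : category := {|
  obj := obj C;
  mor := fun X Y => @mor C X Y;
  heq := fun X Y f g => crel R f g;
  idm := fun X => idm X;
  mcomp := fun X Y Z f g => @mcomp C X Y Z f g;
  heq_refl := quotient_refl;
  heq_sym := fun X Y f g => @crel_sym C R X Y f g;
  heq_trans := fun X Y f g h => @crel_trans C R X Y f g h;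
  comp_heq := fun X Y Z f f' g g' => @crel_comp C R X Y Z f f' g g';
  comp_idl := quotient_idl;
  comp_idr := quotient_idr;
  compA := quotient_compA
|}.

Definition induced_functor (D : category) (F : functor C D)
  (FR : forall (X Y : C) (f g : mor X Y), crel R f g -> fmap F f ~= fmap F g) :
  functor quotient_category D := {|
  fobj := fun X : quotient_category => F (X : C);
  fmap := fun (X Y : quotient_category) f => @fmap C D F X Y f;
  fmap_heq := FR;
  fmap_id := fun X => fmap_id F X;
  fmap_comp := fun X Y Z f g => @fmap_comp C D F X Y Z f g
|}.
End QuotientCategory.

Section Tensor.
Variables (k : fieldType) (M N : lmodType k).
Implicit Types (m : M) (n : N) (s t : seq (M * N)).

(* The tensor product over [k]: formal sums of pairs (as sequences), modulo the
   congruence generated by bilinearity. *)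
Inductive tensor_rel : seq (M * N) -> seq (M * N) -> Prop :=
| TRrefl s : tensor_rel s s
| TRsym s t : tensor_rel s t -> tensor_rel t s
| TRtrans s t u : tensor_rel s t -> tensor_rel t u -> tensor_rel s u
| TRcat s s' t t' :
    tensor_rel s s' -> tensor_rel t t' -> tensor_rel (s ++ t) (s' ++ t')
| TRcomm s t : tensor_rel (s ++ t) (t ++ s)
| TR0 n : tensor_rel [:: (0, n)] [::]
| TRDl m m' n : tensor_rel [:: (m + m', n)] [:: (m, n); (m', n)]
| TRDr m n n' : tensor_rel [:: (m, n + n')] [:: (m, n); (m, n')]
| TRZ a m n : tensor_rel [:: (a *: m, n)] [:: (m, a *: n)].

Definition tensor_eq s t : bool := `[< tensor_rel s t >].

Lemma tensor_eq_refl : reflexive tensor_eq.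
Proof. by move=> s; apply/asboolP/TRrefl. Qed.

Lemma tensor_eq_sym : symmetric tensor_eq.
Proof. by move=> s t; apply/asboolP/asboolP; apply: TRsym. Qed.

Lemma tensor_eq_trans : transitive tensor_eq.
Proof.
by move=> t s u /asboolP st /asboolP tu; apply/asboolP; apply: TRtrans tu.
Qed.

Canonical tensor_equiv :=
  EquivRel tensor_eq tensor_eq_refl tensor_eq_sym tensor_eq_trans.

Definition tensor : Type := {eq_quot tensor_equiv}.
HB.instance Definition _ := Choice.on tensor.
HB.instance Definition _ := EqQuotient.on tensor.

Lemma tensorW (P : tensor -> Prop) :
  (forall s, P (\pi_tensor s)) -> forall x, P x.
Proof. by move=> Pp x; rewrite -[x]reprK. Qed.

Lemma pi_tensorP s t :
  reflect (tensor_rel s t) (\pi_tensor s == \pi_tensor t).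
Proof. by rewrite eqmodE; apply: asboolP. Qed.

Lemma repr_pi s : tensor_rel (repr (\pi_tensor s)) s.
Proof. by apply/pi_tensorP; rewrite reprK. Qed.

Definition tensor_add (x y : tensor) : tensor := \pi_tensor (repr x ++ repr y).
Definition tensor_opp (x : tensor) : tensor :=
  \pi_tensor [seq (- mn.1, mn.2) | mn <- repr x].
Definition tensor_scale (a : k) (x : tensor) : tensor :=
  \pi_tensor [seq (a *: mn.1, mn.2) | mn <- repr x].

Lemma tensor_rel_map (f : M -> M) :
    (forall m m', f (m + m') = f m + f m') ->
    (forall a m, f (a *: m) = a *: f m) ->
  forall s t, tensor_rel s t ->
  tensor_rel [seq (f mn.1, mn.2) | mn <- s] [seq (f mn.1, mn.2) | mn <- t].
Proof.
move=> fD fZ s t; elim=> {s t} /=.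
- by move=> s; apply: TRrefl.
- by move=> s t _; apply: TRsym.
- by move=> s t u _ + _; apply: TRtrans.
- by move=> s s' t t' _ + _; rewrite !map_cat; apply: TRcat.
- by move=> s t; rewrite !map_cat; apply: TRcomm.
- by move=> n; rewrite -[0](scale0r (0 : M)) fZ scale0r; apply: TR0.
- by move=> m m' n; rewrite fD; apply: TRDl.
- by move=> m n n'; apply: TRDr.
- by move=> a m n; rewrite fZ; apply: TRZ.
Qed.

Lemma pi_catE s t :
  tensor_add (\pi_tensor s) (\pi_tensor t) = \pi_tensor (s ++ t).
Proof. by apply/eqP/pi_tensorP; apply: TRcat; apply: repr_pi. Qed.

Lemma pi_scaleE a s :
  tensor_scale a (\pi_tensor s) = \pi_tensor [seq (a *: mn.1, mn.2) | mn <- s].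
Proof.
apply/eqP/pi_tensorP; apply: (@tensor_rel_map ( *:%R a)); last exact: repr_pi.
- by move=> m m'; rewrite scalerDr.
- by move=> b m; rewrite !scalerA mulrC.
Qed.

Lemma pi_oppE s :
  tensor_opp (\pi_tensor s) = \pi_tensor [seq (- mn.1, mn.2) | mn <- s].
Proof.
apply/eqP/pi_tensorP; apply: (@tensor_rel_map -%R); last exact: repr_pi.
- by move=> m m'; rewrite opprD.
- by move=> b m; rewrite scalerN.
Qed.

Lemma tensor_addA : associative tensor_add.
Proof.
move=> x y z.
elim/tensorW: x => s; elim/tensorW: y => t; elim/tensorW: z => u.
by rewrite !pi_catE catA. Qed.

Lemma tensor_addC : commutative tensor_add.
Proof.
move=> x y; elim/tensorW: x => s; elim/tensorW: y => t.
by rewrite !pi_catE; apply/eqP/pi_tensorP/TRcomm.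
Qed.

Lemma tensor_add0 : left_id (\pi_tensor [::]) tensor_add.
Proof. by elim/tensorW=> ?; rewrite pi_catE. Qed.

Lemma tensor_addN : left_inverse (\pi_tensor [::]) tensor_opp tensor_add.
Proof.
elim/tensorW; elim=> [|[m n] s IH]; first by rewrite pi_oppE /= tensor_add0.
rewrite pi_oppE /= -cat1s -pi_catE -pi_oppE -(cat1s (m, n)) -pi_catE.
rewrite -tensor_addA [tensor_add (\pi_tensor [:: (m, n)]) _]tensor_addC.
rewrite [tensor_add (tensor_opp _) _]tensor_addA IH tensor_add0 pi_catE /=.
apply/eqP/pi_tensorP; apply: TRtrans (TR0 n).
by rewrite -(addNr m); apply/TRsym/TRDl.
Qed.

HB.instance Definition _ := GRing.isZmodule.Build tensor
  tensor_addA tensor_addC tensor_add0 tensor_addN.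

Lemma pi_cat s t : \pi_tensor (s ++ t) = \pi_tensor s + \pi_tensor t :> tensor.
Proof. by rewrite -pi_catE. Qed.

Lemma tensor_scaleA a b x :
  tensor_scale a (tensor_scale b x) = tensor_scale (a * b) x.
Proof.
elim/tensorW: x => s; rewrite !pi_scaleE -map_comp; congr (\pi_tensor _).
by apply: eq_map => mn /=; rewrite scalerA.
Qed.

Lemma tensor_scale1 : left_id 1 tensor_scale.
Proof.
elim/tensorW=> s; rewrite pi_scaleE -[in RHS](map_id s); congr (\pi_tensor _).
by apply: eq_map => -[m n] /=; rewrite scale1r.
Qed.

Lemma tensor_scaleDr : right_distributive tensor_scale +%R.
Proof.
move=> a x y; elim/tensorW: x => s; elim/tensorW: y => t.
by rewrite -pi_cat !pi_scaleE map_cat pi_cat.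
Qed.

Lemma tensor_scaleDl x : {morph tensor_scale^~ x : a b / a + b}.
Proof.
move=> a b; elim/tensorW: x => s; rewrite !pi_scaleE.
elim: s => [|[m n] s IH] /=; first by rewrite -pi_cat.
rewrite -cat1s pi_cat IH -[(a *: m, n) :: _]cat1s -[(b *: m, n) :: _]cat1s.
rewrite !pi_cat addrACA; congr (_ + _).
by rewrite -pi_cat; apply/eqP/pi_tensorP; rewrite scalerDl; apply: TRDl.
Qed.

HB.instance Definition _ := GRing.Zmodule_isLmodule.Build k tensor
  tensor_scaleA tensor_scale1 tensor_scaleDr tensor_scaleDl.

Definition tpure (m : M) (n : N) : tensor := \pi_tensor [:: (m, n)].

Lemma tpureDl m m' n : tpure (m + m') n = tpure m n + tpure m' n.
Proof. by rewrite /tpure -pi_cat; apply/eqP/pi_tensorP/TRDl. Qed.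

Lemma tpureDr m n n' : tpure m (n + n') = tpure m n + tpure m n'.
Proof. by rewrite /tpure -pi_cat; apply/eqP/pi_tensorP/TRDr. Qed.

Lemma tpureZ a m n : tpure (a *: m) n = tpure m (a *: n).
Proof. by apply/eqP/pi_tensorP/TRZ. Qed.

Lemma tpureZl a m n : tpure (a *: m) n = a *: tpure m n.
Proof. by rewrite /tpure -[RHS]/(tensor_scale _ _) pi_scaleE. Qed.

Lemma tpureZr a m n : tpure m (a *: n) = a *: tpure m n.
Proof. by rewrite -tpureZ tpureZl. Qed.

Lemma tpure0l n : tpure 0 n = 0.
Proof. by apply/eqP/pi_tensorP/TR0. Qed.

Lemma tpure0r m : tpure m 0 = 0.
Proof. by rewrite -(scale0r (0 : N)) tpureZr scale0r. Qed.

Lemma pi_tensorE s : \pi_tensor s = \sum_(mn <- s) tpure mn.1 mn.2 :> tensor.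
Proof.
elim: s => [|[m n] s IH]; first by rewrite big_nil.
by rewrite big_cons -IH -cat1s pi_cat.
Qed.

Lemma tensor_ind (P : tensor -> Prop) :
    P 0 -> (forall x y, P x -> P y -> P (x + y)) ->
    (forall m n, P (tpure m n)) ->
  forall x, P x.
Proof.
move=> P0 PD Pp; elim/tensorW=> s; rewrite pi_tensorE.
by elim/big_ind: _ => // -[m n] _; apply: Pp.
Qed.

Record bilinear_map (P : lmodType k) (f : M -> N -> P) : Prop := BilinearMap {
  bilinDl : forall m m' n, f (m + m') n = f m n + f m' n;
  bilinDr : forall m n n', f m (n + n') = f m n + f m n';
  bilinZl : forall a m n, f (a *: m) n = a *: f m n;
  bilinZr : forall a m n, f m (a *: n) = a *: f m n
}.

(* The linear map on the tensor product induced by a bilinear map [f]; it does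
   not depend on the representative by [tensor_lift_pi]. *)
Definition tensor_lift (P : lmodType k) (f : M -> N -> P) (x : tensor) : P :=
  \sum_(mn <- repr x) f mn.1 mn.2.

Section Lift.
Variables (P : lmodType k) (f : M -> N -> P).
Hypothesis fB : bilinear_map f.

Lemma tensor_lift_pi s :
  tensor_lift f (\pi_tensor s) = \sum_(mn <- s) f mn.1 mn.2.
Proof.
rewrite /tensor_lift; have := repr_pi s; move: (repr _) => t.
elim=> {s t} //=.
- by move=> s t u _ -> _ ->.
- by move=> s s' t t' _ IH1 _ IH2; rewrite !big_cat /= IH1 IH2.
- by move=> s t; rewrite !big_cat /= addrC.
- move=> n; rewrite big_nil big_seq1 /=.
  by rewrite -(scale0r (0 : M)) (bilinZl fB) scale0r.
- by move=> m m' n; rewrite !big_cons !big_nil !addr0 (bilinDl fB).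
- by move=> m n n'; rewrite !big_cons !big_nil !addr0 (bilinDr fB).
- by move=> a m n; rewrite !big_seq1 (bilinZl fB) (bilinZr fB).
Qed.

Lemma tensor_lift_pure m n : tensor_lift f (tpure m n) = f m n.
Proof. by rewrite tensor_lift_pi big_seq1. Qed.

Lemma tensor_liftD x y :
  tensor_lift f (x + y) = tensor_lift f x + tensor_lift f y.
Proof.
elim/tensorW: x => s; elim/tensorW: y => t.
by rewrite -pi_cat !tensor_lift_pi big_cat.
Qed.

Lemma tensor_liftZ a x : tensor_lift f (a *: x) = a *: tensor_lift f x.
Proof.
elim/tensorW: x => s; rewrite -[_ *: _]/(tensor_scale _ _) pi_scaleE.
rewrite !tensor_lift_pi big_map scaler_sumr.
by apply: eq_bigr => mn _; rewrite (bilinZl fB).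
Qed.

Lemma tensor_lift0 : tensor_lift f 0 = 0.
Proof. by rewrite -(scale0r (0 : tensor)) tensor_liftZ scale0r. Qed.

End Lift.

End Tensor.

Section TensorMaps.
Variable k : fieldType.

Lemma bilinear_comp (M N M' N' : lmodType k) (P : lmodType k)
    (f : M -> M') (g : N -> N') (h : M' -> N' -> P) :
  linear f -> linear g -> bilinear_map h ->
  bilinear_map (fun m n => h (f m) (g n)).
Proof.
move=> fL gL hB; split=> [m m' n|m n n'|a m n|a m n].
- by have := fL 1 m m'; rewrite !scale1r => ->; rewrite (bilinDl hB).
- by have := gL 1 n n'; rewrite !scale1r => ->; rewrite (bilinDr hB).
- by rewrite (scalable_linear fL) (bilinZl hB).
- by rewrite (scalable_linear gL) (bilinZr hB).
Qed.

Lemma tpure_bilinear (M N : lmodType k) : bilinear_map (@tpure k M N).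
Proof.
by split; [exact: tpureDl | exact: tpureDr | exact: tpureZl | exact: tpureZr].
Qed.

Definition tensor_map (M N M' N' : lmodType k) (f : M -> M') (g : N -> N') :
  tensor M N -> tensor M' N' :=
  tensor_lift (fun m n => tpure (f m) (g n)).

Section Theory.
Variables (M N M' N' : lmodType k) (f : M -> M') (g : N -> N').
Hypotheses (fL : linear f) (gL : linear g).

Let fgB := bilinear_comp fL gL (tpure_bilinear M' N').

Lemma tensor_map_pure m n : tensor_map f g (tpure m n) = tpure (f m) (g n).
Proof. exact: tensor_lift_pure. Qed.

Lemma tensor_mapD x y :
  tensor_map f g (x + y) = tensor_map f g x + tensor_map f g y.
Proof. exact: tensor_liftD. Qed.

Lemma tensor_mapZ a x : tensor_map f g (a *: x) = a *: tensor_map f g x.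
Proof. exact: tensor_liftZ. Qed.

Lemma tensor_map0 : tensor_map f g 0 = 0.
Proof. exact: tensor_lift0. Qed.
End Theory.

Definition tensor_assoc (A B C : lmodType k) :
  tensor (tensor A B) C -> tensor A (tensor B C) :=
  tensor_lift (fun t c => tensor_lift (fun a b => tpure a (tpure b c)) t).

Definition tensor_swap (A B : lmodType k) : tensor A B -> tensor B A :=
  tensor_lift (fun a b => tpure b a).

End TensorMaps.

Section Hopf.
Variables (k : fieldType) (L : falgType k).

Definition tensor_mul (u v : tensor L L) : tensor L L :=
  tensor_lift (fun a b => tensor_lift (fun c d => tpure (a * c) (b * d)) v) u.

Record hopf_algebra := HopfAlgebra {
  comul : {linear L -> tensor L L};
  counit : {linear L -> k^o};
  antipode : {linear L -> L};
  comul_coassoc : forall a,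
    tensor_assoc (tensor_map comul id (comul a)) =
    tensor_map id comul (comul a);
  counit_l : forall a, tensor_lift (fun b c => counit b *: c) (comul a) = a;
  counit_r : forall a, tensor_lift (fun b c => counit c *: b) (comul a) = a;
  comul1 : comul 1 = tpure 1 1;
  comulM : forall a b, comul (a * b) = tensor_mul (comul a) (comul b);
  counit1 : counit 1 = 1;
  counitM : forall a b, counit (a * b) = counit a * counit b :> k;
  antipode_l : forall a,
    tensor_lift (fun b c => antipode b * c) (comul a) = (counit a : k)%:A;
  antipode_r : forall a,
    tensor_lift (fun b c => b * antipode c) (comul a) = (counit a : k)%:A
}.

Definition cocommutative (H : hopf_algebra) : Prop :=
  forall a, tensor_swap (comul H a) = comul H a.

(* The k-vector space underlying a module over the k-algebra [L]. *)
Definition restr (M : lmodType L) : Type := M.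

Section Restriction.
Variable M : lmodType L.
HB.instance Definition _ := GRing.Zmodule.copy (restr M) M.

Definition restr_scale (a : k) (m : restr M) : restr M := a%:A *: (m : M).

Fact restr_scaleA a b m :
  restr_scale a (restr_scale b m) = restr_scale (a * b) m.
Proof. by rewrite /restr_scale scalerA -scalerAl mul1r scalerA. Qed.
Fact restr_scale1 : left_id 1 restr_scale.
Proof. by move=> m; rewrite /restr_scale !scale1r. Qed.
Fact restr_scaleDr : right_distributive restr_scale +%R.
Proof. by move=> a m n; rewrite /restr_scale scalerDr. Qed.
Fact restr_scaleDl m : {morph restr_scale^~ m : a b / a + b}.
Proof. by move=> a b; rewrite /restr_scale !scalerDl. Qed.
HB.instance Definition _ := GRing.Zmodule_isLmodule.Build k (restr M)
  restr_scaleA restr_scale1 restr_scaleDr restr_scaleDl.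

Definition restr_act (a : L) (m : restr M) : restr M := a *: (m : M).

Lemma restr_act_linear a : linear (restr_act a).
Proof.
move=> c m n; rewrite /restr_act scalerDr; congr (_ + _).
by rewrite -[c *: m]/(c%:A *: (m : M)) -[RHS]/(c%:A *: (a *: (m : M))) !scalerA
  -scalerAr -scalerAl mulr1 mul1r.
Qed.
End Restriction.

(* M \otimes_k N, to be made an [L]-module with [L] acting through the
   comultiplication of [H] *)
Definition htensor (H : hopf_algebra) (M N : lmodType L) : Type :=
  tensor (restr M) (restr N).

Section TensorModule.
Variables (H : hopf_algebra) (M N : lmodType L).
HB.instance Definition _ := GRing.Zmodule.copy (htensor H M N)
  (tensor (restr M) (restr N)).

Definition tensor_act (u : tensor L L) (x : tensor (restr M) (restr N)) :
  tensor (restr M) (restr N) :=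
  tensor_lift (fun a b => tensor_map (restr_act a) (restr_act b) x) u.

Lemma tensor_act_bilinear x :
  bilinear_map (fun a b => tensor_map (@restr_act M a) (@restr_act N b) x).
Proof.
have E := tensor_map_pure (@restr_act_linear M _) (@restr_act_linear N _).
have D := tensor_mapD (@restr_act_linear M _) (@restr_act_linear N _).
have Z := tensor_map0 (@restr_act_linear M _) (@restr_act_linear N _).
split=> [a a' b|a b b'|c a b|c a b]; elim/tensor_ind: x.
- by rewrite !Z addr0.
- by move=> x y IHx IHy; rewrite !D IHx IHy addrACA.
- by move=> m n; rewrite !E -tpureDl /restr_act scalerDl.
- by rewrite !Z addr0.
- by move=> x y IHx IHy; rewrite !D IHx IHy addrACA.
- by move=> m n; rewrite !E -tpureDr /restr_act scalerDl.
- by rewrite !Z scaler0.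
- by move=> x y IHx IHy; rewrite !D IHx IHy scalerDr.
- move=> m n; rewrite !E -tpureZl; congr tpure.
  by rewrite /restr_act -[RHS]/(c%:A *: (a *: (m : M))) scalerA -scalerAl mul1r.
- by rewrite !Z scaler0.
- by move=> x y IHx IHy; rewrite !D IHx IHy scalerDr.
- move=> m n; rewrite !E -tpureZr; congr tpure.
  by rewrite /restr_act -[RHS]/(c%:A *: (b *: (n : N))) scalerA -scalerAl mul1r.
Qed.

Lemma tensor_act_pure a b m n :
  tensor_act (tpure a b) (tpure m n) = tpure (restr_act a m) (restr_act b n).
Proof.
rewrite /tensor_act (tensor_lift_pure (tensor_act_bilinear _)).
by rewrite (tensor_map_pure (@restr_act_linear M _) (@restr_act_linear N _)).
Qed.

Lemma tensor_actDl u v x :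
  tensor_act (u + v) x = tensor_act u x + tensor_act v x.
Proof. exact: tensor_liftD (tensor_act_bilinear x) _ _. Qed.

Lemma tensor_act0l x : tensor_act 0 x = 0.
Proof. exact: tensor_lift0 (tensor_act_bilinear x). Qed.

Lemma tensor_actDr u x y :
  tensor_act u (x + y) = tensor_act u x + tensor_act u y.
Proof.
elim/tensor_ind: u => [|u v IHu IHv|a b].
- by rewrite !tensor_act0l addr0.
- by rewrite !tensor_actDl IHu IHv addrACA.
rewrite /tensor_act !(tensor_lift_pure (tensor_act_bilinear _)).
exact: tensor_mapD (@restr_act_linear M _) (@restr_act_linear N _) _ _.
Qed.

Lemma tensor_act0r u : tensor_act u 0 = 0.
Proof. by apply: (addrI (tensor_act u 0)); rewrite -tensor_actDr !addr0. Qed.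

Lemma mulL_bilinear a b :
  bilinear_map (fun c d : L => tpure (a * c) (b * d)).
Proof.
apply: (bilinear_comp _ _ (tpure_bilinear _ _)) => c x y;
  by rewrite mulrDr scalerAr.
Qed.

Lemma tensor_mul_bilinear v :
  bilinear_map (fun a b : L =>
    tensor_lift (fun c d => tpure (a * c) (b * d)) v).
Proof.
have E a b := tensor_lift_pure (mulL_bilinear a b).
have D a b := tensor_liftD (mulL_bilinear a b).
have Z a b := tensor_lift0 (mulL_bilinear a b).
split=> [a a' b|a b b'|c a b|c a b]; elim/tensor_ind: v.
- by rewrite !Z addr0.
- by move=> x y IHx IHy; rewrite !D IHx IHy addrACA.
- by move=> m n; rewrite !E -tpureDl mulrDl.
- by rewrite !Z addr0.
- by move=> x y IHx IHy; rewrite !D IHx IHy addrACA.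
- by move=> m n; rewrite !E -tpureDr mulrDl.
- by rewrite !Z scaler0.
- by move=> x y IHx IHy; rewrite !D IHx IHy scalerDr.
- by move=> m n; rewrite !E -tpureZl scalerAl.
- by rewrite !Z scaler0.
- by move=> x y IHx IHy; rewrite !D IHx IHy scalerDr.
- by move=> m n; rewrite !E -tpureZr scalerAl.
Qed.

Lemma tensor_actM u v x :
  tensor_act (tensor_mul u v) x = tensor_act u (tensor_act v x).
Proof.
rewrite /tensor_mul; elim/tensor_ind: u => [|u u' IHu IHu'|a b].
- by rewrite (tensor_lift0 (tensor_mul_bilinear v)) !tensor_act0l.
- by rewrite (tensor_liftD (tensor_mul_bilinear v)) !tensor_actDl IHu IHu'.
rewrite (tensor_lift_pure (tensor_mul_bilinear v)).
elim/tensor_ind: v => [|v v' IHv IHv'|c d].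
- by rewrite (tensor_lift0 (mulL_bilinear a b)) !tensor_act0l tensor_act0r.
- by rewrite (tensor_liftD (mulL_bilinear a b)) !tensor_actDl tensor_actDr
    IHv IHv'.
rewrite (tensor_lift_pure (mulL_bilinear a b)).
elim/tensor_ind: x => [|x y IHx IHy|m n].
- by rewrite !tensor_act0r.
- by rewrite !tensor_actDr IHx IHy.
by rewrite !tensor_act_pure /restr_act !scalerA.
Qed.

Definition htensor_scale (a : L) (x : htensor H M N) : htensor H M N :=
  tensor_act (comul H a) x.

Fact htensor_scaleA a b x :
  htensor_scale a (htensor_scale b x) = htensor_scale (a * b) x.
Proof. by rewrite /htensor_scale comulM tensor_actM. Qed.

Fact htensor_scale1 : left_id 1 htensor_scale.
Proof.
move=> x; rewrite /htensor_scale comul1.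
elim/tensor_ind: x => [|x y IHx IHy|m n]; first exact: tensor_act0r.
- by rewrite tensor_actDr IHx IHy.
- by rewrite tensor_act_pure /restr_act !scale1r.
Qed.

Fact htensor_scaleDr : right_distributive htensor_scale +%R.
Proof. by move=> a x y; exact: tensor_actDr. Qed.

Fact htensor_scaleDl x : {morph htensor_scale^~ x : a b / a + b}.
Proof. by move=> a b; rewrite /htensor_scale linearD; exact: tensor_actDl. Qed.

HB.instance Definition _ := GRing.Zmodule_isLmodule.Build L (htensor H M N)
  htensor_scaleA htensor_scale1 htensor_scaleDr htensor_scaleDl.
End TensorModule.

(* [k], to be made an [L]-module with [L] acting through the counit of [H] *)
Definition trivial_module (H : hopf_algebra) : Type := k.

Section TrivialModule.
Variable H : hopf_algebra.
HB.instance Definition _ := GRing.Zmodule.copy (trivial_module H) k.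

Definition trivial_scale (a : L) (x : trivial_module H) : trivial_module H :=
  (counit H a : k) * (x : k).

Fact trivial_scaleA a b x :
  trivial_scale a (trivial_scale b x) = trivial_scale (a * b) x.
Proof. by rewrite /trivial_scale counitM mulrA. Qed.
Fact trivial_scale1 : left_id 1 trivial_scale.
Proof. by move=> x; rewrite /trivial_scale counit1 mul1r. Qed.
Fact trivial_scaleDr : right_distributive trivial_scale +%R.
Proof. by move=> a x y; rewrite /trivial_scale mulrDr. Qed.
Fact trivial_scaleDl x : {morph trivial_scale^~ x : a b / a + b}.
Proof. by move=> a b; rewrite /trivial_scale linearD mulrDl. Qed.
HB.instance Definition _ := GRing.Zmodule_isLmodule.Build L (trivial_module H)
  trivial_scaleA trivial_scale1 trivial_scaleDr trivial_scaleDl.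
End TrivialModule.

End Hopf.

Section HTensorMap.
Variables (k : fieldType) (L : falgType k) (H : hopf_algebra L).
Variables (M N M' N' : lmodType L).
Variables (f : {linear M -> M'}) (g : {linear N -> N'}).

Definition htensor_map : htensor H M N -> htensor H M' N' :=
  @tensor_map k (restr M) (restr N) (restr M') (restr N') f g.

Let fL : linear (f : restr M -> restr M').
Proof. by move=> a u v; exact: (linearP f). Qed.
Let gL : linear (g : restr N -> restr N').
Proof. by move=> a u v; exact: (linearP g). Qed.

Lemma htensor_map_pure (m : M) (n : N) :
  htensor_map (@tpure k (restr M) (restr N) m n) =
  @tpure k (restr M') (restr N') (f m) (g n).
Proof. exact: (tensor_map_pure fL gL). Qed.

Fact htensor_map_linear : linear htensor_map.
Proof.
move=> a x y; rewrite [LHS](tensor_mapD fL gL); congr (_ + _).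
rewrite -[a *: x]/(tensor_act (comul H a) x).
rewrite -[RHS]/(tensor_act (comul H a) (htensor_map x)).
rewrite /htensor_map; elim/tensor_ind: (comul H a) => [|u v IHu IHv|b c].
- by rewrite !tensor_act0l (tensor_map0 fL gL).
- by rewrite !tensor_actDl (tensor_mapD fL gL) IHu IHv.
elim/tensor_ind: x => [|x z IHx IHz|m n].
- by rewrite tensor_act0r (tensor_map0 fL gL) tensor_act0r.
- by rewrite tensor_actDr !(tensor_mapD fL gL) tensor_actDr IHx IHz.
rewrite tensor_act_pure !(tensor_map_pure fL gL) tensor_act_pure.
by congr tpure; rewrite /restr_act linearZ.
Qed.
HB.instance Definition _ :=
  GRing.isLinear.Build L (htensor H M N) (htensor H M' N') _ htensor_map
    htensor_map_linear.
End HTensorMap.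
Arguments htensor_map {k L} H {M N M' N'} f g _.

(* Direct sums of modules, as families of finite support. *)
Section DirectSum.
Variables (R : pzRingType) (I : choiceType) (M : I -> lmodType R).

Record dsum : Type := Dsum {
  dsum_val :> forall i, M i;
  dsum_fin : exists s : seq I, forall i, i \notin s -> dsum_val i = 0
}.

Lemma dsumP (x y : dsum) : (forall i, x i = y i) -> x = y.
Proof.
case: x y => [x x_fin] [y y_fin] /= xy.
have {}xy : x = y by apply: functional_extensionality_dep.
by case: y / xy y_fin => y_fin; congr Dsum; exact: Prop_irrelevance.
Qed.

HB.instance Definition _ := gen_eqMixin dsum.
HB.instance Definition _ := gen_choiceMixin dsum.

Fact dsum0_fin : exists s : seq I, forall i, i \notin s -> 0 = 0 :> M i.
Proof. by exists [::]. Qed.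
Definition dsum0 : dsum := Dsum dsum0_fin.

Fact dsum_opp_fin (x : dsum) :
  exists s : seq I, forall i, i \notin s -> - x i = 0.
Proof. by have [s xs] := dsum_fin x; exists s => i /xs->; rewrite oppr0. Qed.
Definition dsum_opp (x : dsum) : dsum := Dsum (dsum_opp_fin x).

Fact dsum_add_fin (x y : dsum) :
  exists s : seq I, forall i, i \notin s -> x i + y i = 0.
Proof.
have [s xs] := dsum_fin x; have [t yt] := dsum_fin y; exists (s ++ t) => i.
by rewrite mem_cat negb_or => /andP[/xs-> /yt->]; rewrite addr0.
Qed.
Definition dsum_add (x y : dsum) : dsum := Dsum (dsum_add_fin x y).

Fact dsum_addA : associative dsum_add.
Proof. by move=> x y z; apply: dsumP => i /=; rewrite addrA. Qed.
Fact dsum_addC : commutative dsum_add.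
Proof. by move=> x y; apply: dsumP => i /=; rewrite addrC. Qed.
Fact dsum_add0 : left_id dsum0 dsum_add.
Proof. by move=> x; apply: dsumP => i /=; rewrite add0r. Qed.
Fact dsum_addN : left_inverse dsum0 dsum_opp dsum_add.
Proof. by move=> x; apply: dsumP => i /=; rewrite addNr. Qed.
HB.instance Definition _ := GRing.isZmodule.Build dsum
  dsum_addA dsum_addC dsum_add0 dsum_addN.

Fact dsum_scale_fin a (x : dsum) :
  exists s : seq I, forall i, i \notin s -> a *: x i = 0.
Proof. by have [s xs] := dsum_fin x; exists s => i /xs->; rewrite scaler0. Qed.
Definition dsum_scale a (x : dsum) : dsum := Dsum (dsum_scale_fin a x).

Fact dsum_scaleA a b x : dsum_scale a (dsum_scale b x) = dsum_scale (a * b) x.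
Proof. by apply: dsumP => i /=; rewrite scalerA. Qed.
Fact dsum_scale1 : left_id 1 dsum_scale.
Proof. by move=> x; apply: dsumP => i /=; rewrite scale1r. Qed.
Fact dsum_scaleDr : right_distributive dsum_scale +%R.
Proof. by move=> a x y; apply: dsumP => i /=; rewrite scalerDr. Qed.
Fact dsum_scaleDl x : {morph dsum_scale^~ x : a b / a + b}.
Proof. by move=> a b; apply: dsumP => i /=; rewrite scalerDl. Qed.
HB.instance Definition _ := GRing.Zmodule_isLmodule.Build R dsum
  dsum_scaleA dsum_scale1 dsum_scaleDr dsum_scaleDl.

Lemma dsum_valD (x y : dsum) i : (x + y) i = x i + y i. Proof. by []. Qed.
Lemma dsum_valZ a (x : dsum) i : (a *: x) i = a *: x i. Proof. by []. Qed.
Lemma dsum_val0 i : (0 : dsum) i = 0. Proof. by []. Qed.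

Fact dsum_in_fin i (m : M i) :
  exists s : seq I, forall j, j \notin s -> dfwith (fun i => 0 : M i) m j = 0.
Proof.
exists [:: i] => j; rewrite inE => ji.
by rewrite dfwith_out // eq_sym.
Qed.
Definition dsum_in i (m : M i) : dsum := Dsum (dsum_in_fin m).

Fact dsum_in_linear i : linear (@dsum_in i).
Proof.
move=> a m n; apply: dsumP => j; rewrite dsum_valD dsum_valZ /=.
have [<-|ij] := eqVneq i j; first by rewrite !dfwith_in.
by rewrite !dfwith_out // scaler0 addr0.
Qed.
HB.instance Definition _ i :=
  GRing.isLinear.Build R (M i) dsum _ (@dsum_in i) (@dsum_in_linear i).

Lemma dsumE (x : dsum) (s : seq I) : uniq s ->
  (forall i, i \notin s -> x i = 0) -> x = \sum_(i <- s) dsum_in (x i).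
Proof.
move=> s_uniq xs; apply: dsumP => j.
have -> : (\sum_(i <- s) dsum_in (x i) : dsum) j =
    \sum_(i <- s) dsum_in (x i) j.
  by elim/big_rec2: _ => // i y z _ <-.
have [js|js] := boolP (j \in s); last first.
  rewrite xs // big_seq big1 // => i si /=.
  by rewrite dfwith_out //; apply: contraNneq js => <-.
rewrite (bigD1_seq j) //= dfwith_in big1 ?addr0 // => i ij.
by rewrite dfwith_out.
Qed.

Lemma dsum_ind (P : dsum -> Prop) :
    P 0 -> (forall x y, P x -> P y -> P (x + y)) ->
    (forall i (m : M i), P (dsum_in m)) ->
  forall x, P x.
Proof.
move=> P0 PD Pin x; have [s xs] := dsum_fin x.
rewrite (@dsumE x (undup s)) ?undup_uniq //; last first.
  by move=> i; rewrite mem_undup => /xs.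
by elim/big_ind: _.
Qed.

Section Lift.
Variables (P : lmodType R) (f : forall i, {linear M i -> P}).

Definition dsum_lift (x : dsum) : P :=
  \sum_(i <- undup (sval (cid (dsum_fin x)))) f i (x i).

Lemma dsum_liftE (x : dsum) (s : seq I) : uniq s ->
  (forall i, i \notin s -> x i = 0) -> dsum_lift x = \sum_(i <- s) f i (x i).
Proof.
rewrite /dsum_lift; case: cid => t /= xt s_uniq xs.
rewrite (bigID (mem s)) /= [X in _ + X]big1 ?addr0; last first.
  by move=> i /xs ->; rewrite linear0.
rewrite [RHS](bigID (mem t)) /= [X in _ + X]big1 ?addr0; last first.
  by move=> i /xt ->; rewrite linear0.
rewrite -[LHS]big_filter -[RHS]big_filter; apply: perm_big; apply: uniq_perm.
- by rewrite filter_uniq ?undup_uniq.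
- by rewrite filter_uniq.
- by move=> i; rewrite !mem_filter mem_undup andbC.
Qed.

Fact dsum_lift_linear : linear dsum_lift.
Proof.
move=> a x y; have [s xs] := dsum_fin x; have [t yt] := dsum_fin y.
pose u := undup (s ++ t).
have u_uniq : uniq u by apply: undup_uniq.
have xu i : i \notin u -> x i = 0.
  by rewrite mem_undup mem_cat negb_or => /andP[/xs].
have yu i : i \notin u -> y i = 0.
  by rewrite mem_undup mem_cat negb_or => /andP[_ /yt].
rewrite (@dsum_liftE x u) // (@dsum_liftE y u) //.
rewrite (@dsum_liftE _ u) //; last first.
  by move=> i iu; rewrite dsum_valD dsum_valZ xu // yu // scaler0 addr0.
rewrite scaler_sumr -big_split /=; apply: eq_bigr => i _.
exact: linearP.
Qed.
HB.instance Definition _ :=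
  GRing.isLinear.Build R dsum P _ dsum_lift dsum_lift_linear.

Lemma dsum_lift_in i (m : M i) : dsum_lift (dsum_in m) = f i m.
Proof.
rewrite (@dsum_liftE _ [:: i]) ?big_seq1 //= ?dfwith_in // => j.
by rewrite inE => ji; rewrite dfwith_out // eq_sym.
Qed.
End Lift.

End DirectSum.

Section Complexes.
Variable R : pzRingType.

Section ModuleCategory.
Implicit Types M N P Q : lmodType R.

Fact linear_heq_sym M N (f g : {linear M -> N}) : f =1 g -> g =1 f.
Proof. by move=> fg x; rewrite fg. Qed.
Fact linear_heq_trans M N (f g h : {linear M -> N}) :
  f =1 g -> g =1 h -> f =1 h.
Proof. by move=> fg gh x; rewrite fg. Qed.
Fact linear_comp_heq M N P (f f' : {linear N -> P}) (g g' : {linear M -> N}) :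
  f =1 f' -> g =1 g' -> f \o g =1 f' \o g'.
Proof. by move=> ff gg x /=; rewrite ff gg. Qed.

Definition linear_id M : {linear M -> M} := idfun.
Definition linear_comp M N P (f : {linear N -> P}) (g : {linear M -> N}) :
  {linear M -> P} := f \o g.

Definition module_category : category := {|
  obj := lmodType R;
  mor := fun M N : lmodType R => {linear M -> N};
  heq := fun (M N : lmodType R) (f g : {linear M -> N}) => f =1 g;
  idm := linear_id;
  mcomp := linear_comp;
  heq_refl := fun M N f x => erefl (f x);
  heq_sym := linear_heq_sym;
  heq_trans := linear_heq_trans;
  comp_heq := linear_comp_heq;
  comp_idl := fun M N f x => erefl (f x);
  comp_idr := fun M N f x => erefl (f x);
  compA := fun M N P Q f g h x => erefl (f (g (h x)))
|}.
End ModuleCategory.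

Definition injective_module (M : lmodType R) : Prop :=
  forall (A B : lmodType R) (i : {linear A -> B}) (f : {linear A -> M}),
    injective i -> exists g : {linear B -> M}, forall a, g (i a) = f a.

Definition projective_module (M : lmodType R) : Prop :=
  forall (A B : lmodType R) (p : {linear A -> B}) (f : {linear M -> B}),
    (forall b, exists a, p a = b) ->
  exists g : {linear M -> A}, forall m, p (g m) = f m.

Record complex := Complex {
  cobj :> int -> lmodType R;
  cd : forall n : int, {linear cobj n -> cobj (n + 1)};
  cdd : forall (n : int) (x : cobj n), cd (n + 1) (cd n x) = 0
}.

Record chain_map (X Y : complex) := ChainMap {
  cmap :> forall n : int, {linear X n -> Y n};
  cmapd : forall (n : int) (x : X n),
    cmap (n + 1) (cd X n x) = cd Y n (cmap n x)
}.

(* [h n] is the component of the homotopy in degree [n + 1], and the equation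
   is the one in degree [n + 1]; this avoids casts along [n - 1 + 1 = n].
   [acyclic] and [quasi_isomorphism] below are indexed in the same way. *)
Definition homotopic (X Y : complex) (f g : chain_map X Y) : Prop :=
  exists h : forall n : int, {linear X (n + 1) -> Y n},
  forall (n : int) (x : X (n + 1)),
    f (n + 1) x - g (n + 1) x = cd Y n (h n x) + h (n + 1) (cd X (n + 1) x).

Definition chain_id (X : complex) : chain_map X X :=
  @ChainMap X X (fun n => idfun) (fun n x => erefl (cd X n x)).

Fact chain_comp_subproof (X Y Z : complex) (f : chain_map Y Z)
    (g : chain_map X Y) n (x : X n) :
  (f (n + 1) \o g (n + 1)) (cd X n x) = cd Z n ((f n \o g n) x).
Proof. by rewrite /= !cmapd. Qed.

Definition chain_comp (X Y Z : complex) (f : chain_map Y Z)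
    (g : chain_map X Y) : chain_map X Z :=
  @ChainMap X Z (fun n => f n \o g n) (@chain_comp_subproof X Y Z f g).

Fact eq_homotopic (X Y : complex) (f g : chain_map X Y) :
  (forall n, f n =1 g n) -> homotopic f g.
Proof.
by move=> fg; exists (fun n => \0) => n x /=; rewrite fg subrr linear0 addr0.
Qed.

Fact homotopic_refl (X Y : complex) (f : chain_map X Y) : homotopic f f.
Proof. exact: eq_homotopic. Qed.

Fact homotopic_sym (X Y : complex) (f g : chain_map X Y) :
  homotopic f g -> homotopic g f.
Proof.
move=> [h hP]; exists (fun n => \- h n) => n x /=.
by rewrite linearN -opprD -hP opprB.
Qed.

Fact homotopic_trans (X Y : complex) (f g e : chain_map X Y) :
  homotopic f g -> homotopic g e -> homotopic f e.
Proof.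
move=> [h hP] [h' hP']; exists (fun n => h n \+ h' n) => n x /=.
by rewrite linearD addrACA -hP -hP' addrA subrK.
Qed.

Fact homotopic_comp (X Y Z : complex) (f f' : chain_map Y Z)
    (g g' : chain_map X Y) :
  homotopic f f' -> homotopic g g' ->
  homotopic (chain_comp f g) (chain_comp f' g').
Proof.
move=> [h hP] [h' hP'].
exists (fun n => (h n \o g (n + 1)) \+ (f' n \o h' n)) => n x /=.
rewrite linearD addrACA (cmapd g) -hP -(cmapd f') -linearD -hP' linearB.
by rewrite addrA subrK.
Qed.

Definition homotopy_category : category := {|
  obj := complex;
  mor := chain_map;
  heq := homotopic;
  idm := chain_id;
  mcomp := chain_comp;
  heq_refl := homotopic_refl;
  heq_sym := homotopic_sym;
  heq_trans := homotopic_trans;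
  comp_heq := homotopic_comp;
  comp_idl := fun X Y f =>
    @eq_homotopic X Y (chain_comp (chain_id Y) f) f (fun n x => erefl);
  comp_idr := fun X Y f =>
    @eq_homotopic X Y (chain_comp f (chain_id X)) f (fun n x => erefl);
  compA := fun X Y Z W f g h =>
    @eq_homotopic X W (chain_comp f (chain_comp g h))
      (chain_comp (chain_comp f g) h) (fun n x => erefl)
|}.

Definition termwise_injective (X : complex) : Prop :=
  forall n : int, injective_module (X n).

Definition acyclic (X : complex) : Prop :=
  forall (n : int) (x : X (n + 1)), cd X (n + 1) x = 0 ->
  exists y : X n, cd X n y = x.

(* The two conjuncts are injectivity and surjectivity on cohomology in degree
   [n + 1]. *)
Definition quasi_isomorphism (X Y : complex) (f : chain_map X Y) : Prop :=
  forall n : int,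
    (forall x : X (n + 1), cd X (n + 1) x = 0 ->
       (exists y : Y n, cd Y n y = f (n + 1) x) ->
     exists x' : X n, cd X n x' = x) /\
    (forall y : Y (n + 1), cd Y (n + 1) y = 0 ->
     exists (x : X (n + 1)) (y' : Y n),
       cd X (n + 1) x = 0 /\ y = f (n + 1) x + cd Y n y').

Definition KInj : category :=
  full_subcategory (termwise_injective : homotopy_category -> Prop).

Definition KInj_inclusion : functor KInj homotopy_category :=
  inclusion (termwise_injective : homotopy_category -> Prop).

Definition S_category : category :=
  full_subcategory (fun X : KInj => acyclic (sval X)).

Definition S_inclusion : functor S_category KInj :=
  inclusion (fun X : KInj => acyclic (sval X)).

Definition to_KInj (C : category) (F : functor C homotopy_category)
    (FI : forall X : C, termwise_injective (F X)) : functor C KInj :=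
  @corestriction _ _ (termwise_injective : homotopy_category -> Prop) F FI.

Definition to_S (C : category) (F : functor C KInj)
    (FA : forall X : C, acyclic (sval (F X))) : functor C S_category :=
  @corestriction _ _ (fun X : KInj => acyclic (sval X)) F FA.

Section Can.
(* ['rV_0] is the zero module. *)
Definition can_obj (M : lmodType R) (n : int) : lmodType R :=
  if n is Posz 0 then M else 'rV[R]_0.

Definition can_complex (M : lmodType R) : complex :=
  @Complex (can_obj M) (fun n => \0) (fun n x => erefl).

Definition can_component (M N : lmodType R) (f : {linear M -> N}) (n : int) :
  {linear can_obj M n -> can_obj N n} :=
  match n with Posz 0 => f | _ => idfun end.

Fact can_map_subproof (M N : lmodType R) (f : {linear M -> N}) n
    (x : can_complex M n) :
  can_component f (n + 1) (cd (can_complex M) n x) =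
  cd (can_complex N) n (can_component f n x).
Proof. by rewrite /= linear0. Qed.

Definition can_map (M N : lmodType R) (f : {linear M -> N}) :
    chain_map (can_complex M) (can_complex N) :=
  @ChainMap (can_complex M) (can_complex N) (can_component f)
    (@can_map_subproof M N f).

Fact can_heq (M N : lmodType R) (f g : {linear M -> N}) :
  f =1 g -> homotopic (can_map f) (can_map g).
Proof.
by move=> fg; apply: eq_homotopic => -[[|n]|n] //=; exact: fg.
Qed.
Fact can_id (M : lmodType R) :
  homotopic (can_map (linear_id M)) (chain_id (can_complex M)).
Proof. by apply: eq_homotopic => -[[|n]|n]. Qed.
Fact can_comp (M N P : lmodType R) (f : {linear N -> P}) (g : {linear M -> N}) :
  homotopic (can_map (linear_comp f g)) (chain_comp (can_map f) (can_map g)).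
Proof. by apply: eq_homotopic => -[[|n]|n]. Qed.

Definition can_functor : functor module_category homotopy_category :=
  @Functor module_category homotopy_category can_complex can_map
    can_heq can_id can_comp.
End Can.

Definition injective_resolution (M : lmodType R) (I : complex)
    (eta : chain_map (can_complex M) I) : Prop :=
  [/\ termwise_injective I,
      forall n : int, (n < 0)%R -> forall x : I n, x = 0 &
      quasi_isomorphism eta].

Definition projective_resolution (M : lmodType R) (P : complex)
    (eps : chain_map P (can_complex M)) : Prop :=
  [/\ forall n : int, projective_module (P n),
      forall n : int, (0 < n)%R -> forall x : P n, x = 0 &
      quasi_isomorphism eps].

Fact shift_subproof (X : complex) (n : int) (x : X (n + 1)) :
  (\- cd X (n + 1 + 1)) ((\- cd X (n + 1)) x) = 0.
Proof. by rewrite /= linearN opprK cdd. Qed.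

Definition shift (X : complex) : complex :=
  @Complex (fun n => X (n + 1)) (fun n => \- cd X (n + 1))
    (@shift_subproof X).

Fact shift_map_subproof (X Y : complex) (f : chain_map X Y) n
    (x : shift X n) :
  f (n + 1 + 1) (cd (shift X) n x) = cd (shift Y) n (f (n + 1) x).
Proof. by rewrite /= linearN cmapd. Qed.

Definition shift_map (X Y : complex) (f : chain_map X Y) :
    chain_map (shift X) (shift Y) :=
  @ChainMap (shift X) (shift Y) (fun n => f (n + 1)) (shift_map_subproof f).

Section Cone.
Variables (X Y : complex) (f : chain_map X Y).

Definition cone_obj (n : int) : lmodType R := (X (n + 1)%R * Y n)%type.

Definition cone_diff (n : int) (z : cone_obj n) : cone_obj (n + 1) :=
  (- cd X (n + 1) z.1, f (n + 1) z.1 + cd Y n z.2).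

Fact cone_diff_linear n : linear (@cone_diff n).
Proof.
move=> a [x y] [x' y']; rewrite /cone_diff /=; congr (_, _) => /=.
  by rewrite linearP opprD scalerN.
by rewrite !linearP scalerDr addrACA.
Qed.
HB.instance Definition _ n := GRing.isLinear.Build R
  (cone_obj n) (cone_obj (n + 1)) _ (@cone_diff n) (@cone_diff_linear n).

Fact cone_subproof n (z : cone_obj n) : cone_diff (cone_diff z) = 0.
Proof.
case: z => x y; rewrite /= /cone_diff /=; congr (_, _) => /=.
  by rewrite linearN opprK cdd.
by rewrite linearN cmapd linearD cdd addr0 addNr.
Qed.

Definition cone : complex :=
  @Complex cone_obj (fun n => @cone_diff n) cone_subproof.

Definition cone_in_component n (y : Y n) : cone_obj n := (0, y).

Fact cone_in_linear n : linear (@cone_in_component n).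
Proof.
move=> a y y'; rewrite /cone_in_component; congr (_, _) => /=.
by rewrite scaler0 addr0.
Qed.
HB.instance Definition _ n := GRing.isLinear.Build R
  (Y n) (cone_obj n) _ (@cone_in_component n) (@cone_in_linear n).

Fact cone_in_subproof n (y : Y n) :
  cone_in_component (cd Y n y) = cone_diff (cone_in_component y).
Proof.
by rewrite /cone_in_component /cone_diff /= !linear0 add0r.
Qed.

Definition cone_in : chain_map Y cone :=
  @ChainMap Y cone (fun n => @cone_in_component n) cone_in_subproof.

Definition cone_out_component n : {linear cone_obj n -> X (n + 1)} := fst.

Definition cone_out : chain_map cone (shift X) :=
  @ChainMap cone (shift X) cone_out_component (fun n x => erefl).
End Cone.

End Complexes.

Section Stable.
Variable R : pzRingType.

(* a triangle isomorphic in the homotopy category to a cone triangle *)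
Definition exact_triangle (X Y Z : complex R) (u : chain_map X Y)
    (v : chain_map Y Z) (w : chain_map Z (shift X)) : Prop :=
  exists (X' Y' : complex R) (f : chain_map X' Y') (a : chain_map X X')
    (b : chain_map Y Y') (c : chain_map Z (cone f)),
    [/\ is_iso (a : @mor (homotopy_category R) X X'),
        is_iso (b : @mor (homotopy_category R) Y Y') &
        is_iso (c : @mor (homotopy_category R) Z (cone f))] /\
    [/\ homotopic (chain_comp b u) (chain_comp f a),
        homotopic (chain_comp c v) (chain_comp (cone_in f) b) &
        homotopic (chain_comp (shift_map a) w) (chain_comp (cone_out f) c)].

Definition stably_equal (M N : lmodType R) (f g : {linear M -> N}) : Prop :=
  exists (I : lmodType R) (u : {linear M -> I}) (v : {linear I -> N}),
    injective_module I /\ forall m, f m - g m = v (u m).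

Section PairMap.
Variables (M I J : lmodType R) (u : {linear M -> I}) (v : {linear M -> J}).
Definition pair_map (m : M) : (I * J)%type := (u m, v m).
Fact pair_map_linear : linear pair_map.
Proof. by move=> a x y; rewrite /pair_map !linearP. Qed.
HB.instance Definition _ :=
  GRing.isLinear.Build R M (I * J)%type _ pair_map pair_map_linear.
End PairMap.

Lemma injective_module_prod (I J : lmodType R) :
  injective_module I -> injective_module J -> injective_module (I * J)%type.
Proof.
move=> injI injJ A B i f inj_i.
have [g gP] := injI _ _ i (fst \o f) inj_i.
have [h hP] := injJ _ _ i (snd \o f) inj_i.
by exists (pair_map g h) => a; rewrite /= /pair_map gP hP /=; case: (f a).
Qed.

Fact stably_equal_heq (M N : lmodType R) (f g : {linear M -> N}) :
  f =1 g -> stably_equal f g.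
Proof.
move=> fg; exists 'rV[R]_0, \0, \0; split; last first.
  by move=> m /=; rewrite fg subrr.
by move=> A B i f' _; exists \0 => a; apply/matrixP => ? [].
Qed.

Fact stably_equal_sym (M N : lmodType R) (f g : {linear M -> N}) :
  stably_equal f g -> stably_equal g f.
Proof.
move=> [I [u [v [injI uv]]]]; exists I, u, (\- v); split=> // m.
by rewrite /= -uv opprB.
Qed.

Fact stably_equal_trans (M N : lmodType R) (f g h : {linear M -> N}) :
  stably_equal f g -> stably_equal g h -> stably_equal f h.
Proof.
move=> [I [u [v [injI uv]]]] [J [u' [v' [injJ uv']]]].
exists (I * J)%type, (pair_map u u'), ((v \o fst) \+ (v' \o snd)); split.
  exact: injective_module_prod.
by move=> m; rewrite /= -uv -uv' addrA subrK.
Qed.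

Fact stably_equal_comp (M N P : lmodType R) (f f' : {linear N -> P})
    (g g' : {linear M -> N}) :
  stably_equal f f' -> stably_equal g g' ->
  stably_equal (linear_comp f g) (linear_comp f' g').
Proof.
move=> [I [u [v [injI uv]]]] [J [u' [v' [injJ uv']]]].
exists (I * J)%type, (pair_map (u \o g) u'),
  ((v \o fst) \+ ((f' \o v') \o snd)); split.
  exact: injective_module_prod.
by move=> m; rewrite /= -uv -uv' linearB addrA subrK.
Qed.

Definition stable_congruence : congruence (module_category R) :=
  @Congruence (module_category R) stably_equal stably_equal_heq
    stably_equal_sym stably_equal_trans stably_equal_comp.

Definition stable_category : category := quotient_category stable_congruence.

Section Z0.
Variable X : complex R.

Definition cycle_pred : {pred X 0} := [pred x | cd X 0 x == 0].

Fact cycle_submod : submod_closed cycle_pred.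
Proof.
split=> [|a x y]; rewrite !inE ?linear0 // => /eqP x0 /eqP y0.
by rewrite linearP x0 y0 scaler0 addr0.
Qed.
HB.instance Definition _ := GRing.isSubmodClosed.Build R (X 0) cycle_pred
  cycle_submod.

Definition Z0_obj : Type := {x : X 0 | x \in cycle_pred}.
HB.instance Definition _ := SubChoice.on Z0_obj.
HB.instance Definition _ := [SubChoice_isSubLmodule of Z0_obj by <:].

Lemma Z0P (z : Z0_obj) : cd X 0 (val z) = 0.
Proof. by apply/eqP; case: z. Qed.
End Z0.

Arguments cycle_pred X : clear implicits.

Section Z0Map.
Variables (X Y : complex R) (f : chain_map X Y).

Fact Z0_map_subproof (z : Z0_obj X) : f 0 (val z) \in cycle_pred Y.
Proof. by rewrite inE -cmapd Z0P linear0. Qed.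

Definition Z0_map (z : Z0_obj X) : Z0_obj Y :=
  Sub (f 0 (val z)) (Z0_map_subproof z).

Fact Z0_map_linear : linear Z0_map.
Proof.
by move=> a x y; apply: val_inj; rewrite /= linearP.
Qed.
HB.instance Definition _ := GRing.isLinear.Build R (Z0_obj X) (Z0_obj Y) _
  Z0_map Z0_map_linear.
End Z0Map.

Definition Z0_module (X : complex R) : lmodType R := Z0_obj X.

Definition Z0_linear (X Y : complex R) (f : chain_map X Y) :
  {linear Z0_module X -> Z0_module Y} := Z0_map f.

Section Z0Boundary.
Variable Y : complex R.

Fact Z0_boundary_subproof (y : Y (-1)) : cd Y (-1) y \in cycle_pred Y.
Proof. by rewrite inE; apply/eqP; exact: (cdd y). Qed.

Definition Z0_boundary (y : Y (-1)) : Z0_obj Y :=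
  Sub (cd Y (-1) y) (Z0_boundary_subproof y).

Fact Z0_boundary_linear : linear Z0_boundary.
Proof. by move=> a x y; apply: val_inj; rewrite /= linearP. Qed.
HB.instance Definition _ := GRing.isLinear.Build R (Y (-1)) (Z0_obj Y) _
  Z0_boundary Z0_boundary_linear.
End Z0Boundary.

Fact Z0_heq (X Y : complex R) (f g : chain_map X Y) :
  termwise_injective Y -> homotopic f g ->
  stably_equal (Z0_linear f) (Z0_linear g).
Proof.
move=> injY [h fg].
pose h0 : {linear X 0 -> Y (-1)} := h (-1).
exists (Y (-1)), (h0 \o val), (@Z0_boundary Y); split; first exact: injY.
move=> z; apply: val_inj; rewrite /= -[RHS]addr0.
by have := fg (-1) (val z); rewrite [cd X _ _](Z0P z) linear0.
Qed.

Definition Z0_fobj (X : S_category R) : stable_category :=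
  Z0_module (sval (sval X)).

Definition Z0_fmap (X Y : S_category R) (f : mor X Y) :
  mor (Z0_fobj X) (Z0_fobj Y) := Z0_linear f.

Fact Z0_fmap_heq (X Y : S_category R) (f g : mor X Y) :
  f ~= g -> Z0_fmap f ~= Z0_fmap g.
Proof. exact: Z0_heq (svalP (sval Y)). Qed.

Fact Z0_linear_id (X : complex R) :
  Z0_linear (chain_id X) =1 linear_id (Z0_module X).
Proof. by move=> z; apply: val_inj. Qed.

Fact Z0_linear_comp (X Y Z : complex R) (f : chain_map Y Z)
    (g : chain_map X Y) :
  Z0_linear (chain_comp f g) =1 linear_comp (Z0_linear f) (Z0_linear g).
Proof. by move=> z; apply: val_inj. Qed.

Fact Z0_fmap_id (X : S_category R) : Z0_fmap (idm X) ~= idm (Z0_fobj X).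
Proof. exact: stably_equal_heq (@Z0_linear_id _). Qed.

Fact Z0_fmap_comp (X Y Z : S_category R) (f : mor Y Z) (g : mor X Y) :
  Z0_fmap (f \oc g) ~= Z0_fmap f \oc Z0_fmap g.
Proof. exact: stably_equal_heq (@Z0_linear_comp _ _ _ f g). Qed.

Definition Z0 : functor (S_category R) stable_category :=
  @Functor _ _ Z0_fobj Z0_fmap Z0_fmap_heq Z0_fmap_id Z0_fmap_comp.
End Stable.

Section TensorComplex.
Variables (k : fieldType) (L : falgType k) (H : hopf_algebra L).

Definition bidegree (n : int) : Type :=
  {pq : int * int | pq.1 + pq.2 == n}.
HB.instance Definition _ n := Choice.on (bidegree n).

Fact incr_left_subproof n (i : bidegree n) :
  (val i).1 + 1 + (val i).2 == n + 1.
Proof. by rewrite addrAC (eqP (valP i)). Qed.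

Definition incr_left n (i : bidegree n) : bidegree (n + 1) :=
  exist _ ((val i).1 + 1, (val i).2) (incr_left_subproof i).

Fact incr_right_subproof n (i : bidegree n) :
  (val i).1 + ((val i).2 + 1) == n + 1.
Proof. by rewrite addrA (eqP (valP i)). Qed.

Definition incr_right n (i : bidegree n) : bidegree (n + 1) :=
  exist _ ((val i).1, (val i).2 + 1) (incr_right_subproof i).

Definition tensor_summand (X Y : complex L) n (i : bidegree n) : lmodType L :=
  htensor H (X (val i).1) (Y (val i).2).

Definition tensor_obj (X Y : complex L) (n : int) : lmodType L :=
  dsum (@tensor_summand X Y n).

(* x \otimes y of bidegree (p, q) is sent to
   d x \otimes y + (-1)^p x \otimes d y *)
Definition tensor_diff_summand (X Y : complex L) n (i : bidegree n)
    (t : tensor_summand X Y i) : tensor_obj X Y (n + 1) :=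
  @dsum_in _ _ (@tensor_summand X Y (n + 1)) (incr_left i)
    (htensor_map H (cd X (val i).1) idfun t) +
  @dsum_in _ _ (@tensor_summand X Y (n + 1)) (incr_right i)
    (htensor_map H idfun (cd Y (val i).2) t) *~ (-1) ^ (val i).1.

Fact tensor_diff_summand_linear X Y n i :
  linear (@tensor_diff_summand X Y n i).
Proof.
move=> a x y; rewrite /tensor_diff_summand !linearP /= mulrzDl addrACA.
by rewrite scalerDr scalerMzr.
Qed.
HB.instance Definition _ X Y n i := GRing.isLinear.Build L
  (@tensor_summand X Y n i) (tensor_obj X Y (n + 1)) _
  (@tensor_diff_summand X Y n i) (@tensor_diff_summand_linear X Y n i).

Definition tensor_diff (X Y : complex L) n :
  {linear tensor_obj X Y n -> tensor_obj X Y (n + 1)} :=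
  @dsum_lift _ _ (@tensor_summand X Y n) _
    (fun i => @tensor_diff_summand X Y n i).

Definition tensor_gen (X Y : complex L) n (i : bidegree n)
    (x : X (val i).1) (y : Y (val i).2) : tensor_obj X Y n :=
  @dsum_in _ _ (@tensor_summand X Y n) i
    (@tpure k (restr (X (val i).1)) (restr (Y (val i).2)) x y).

Lemma tensor_obj_ext (X Y : complex L) n (P : lmodType L)
    (f g : {linear tensor_obj X Y n -> P}) :
  (forall i x y, f (@tensor_gen X Y n i x y) = g (tensor_gen x y)) -> f =1 g.
Proof.
move=> fg x; elim/dsum_ind: x => [|x y fx fy|i t]; first by rewrite !linear0.
- by rewrite !linearD fx fy.
elim/tensor_ind: t => [|t t' ft ft'|m m']; last exact: fg.
- by rewrite !linear0.
- by rewrite !linearD ft ft'.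
Qed.

Lemma tensor_gen0l X Y n i y : @tensor_gen X Y n i 0 y = 0.
Proof. by rewrite /tensor_gen tpure0l linear0. Qed.
Lemma tensor_gen0r X Y n i x : @tensor_gen X Y n i x 0 = 0.
Proof. by rewrite /tensor_gen tpure0r linear0. Qed.
Lemma tensor_genDl X Y n i x x' y : @tensor_gen X Y n i (x + x') y =
  @tensor_gen X Y n i x y + tensor_gen x' y.
Proof. by rewrite /tensor_gen -linearD -tpureDl. Qed.
Lemma tensor_genDr X Y n i x y y' : @tensor_gen X Y n i x (y + y') =
  @tensor_gen X Y n i x y + tensor_gen x y'.
Proof. by rewrite /tensor_gen -linearD -tpureDr. Qed.

Lemma tensor_gen_irr X Y n p q (e e' : p + q == n) x y :
  @tensor_gen X Y n (exist _ (p, q) e) x y =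
  @tensor_gen X Y n (exist _ (p, q) e') x y.
Proof. by rewrite (bool_irrelevance e e'). Qed.

Lemma tensor_diff_gen X Y n (i : bidegree n) x y :
  tensor_diff X Y n (@tensor_gen X Y n i x y) =
  @tensor_gen X Y (n + 1) (incr_left i) (cd X _ x) y +
  @tensor_gen X Y (n + 1) (incr_right i) x (cd Y _ y) *~ (-1) ^ (val i).1.
Proof.
apply: etrans (dsum_lift_in _ _) _.
rewrite -[LHS]/(tensor_diff_summand _) /tensor_diff_summand.
by rewrite !htensor_map_pure.
Qed.

Lemma tensor_diffMz X Y n (x : tensor_obj X Y n) (m : int) :
  tensor_diff X Y n (x *~ m) = tensor_diff X Y n x *~ m.
Proof. exact: raddfMz. Qed.

Lemma signS (p : int) : (-1) ^ (p + 1) = - (-1) ^ p :> int.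
Proof. by rewrite exprzDr ?unitrN1 // expr1z mulrN1. Qed.

Fact tensor_diff_sqr (X Y : complex L) n (x : tensor_obj X Y n) :
  tensor_diff X Y (n + 1) (tensor_diff X Y n x) = 0.
Proof.
move: x; apply: (@tensor_obj_ext X Y n _ 
  (tensor_diff X Y (n + 1) \o tensor_diff X Y n) \0).
move=> [[p q] e] x y /=.
rewrite tensor_diff_gen /= linearD tensor_diffMz !tensor_diff_gen /= !cdd.
rewrite tensor_gen0l add0r. rewrite tensor_gen0r mul0rz addr0 signS.
rewrite mulrNz; apply: etrans (addNr _); congr (_ + _ *~ _).
exact: tensor_gen_irr.
Qed.

(* the total complex: (X \otimes_k Y)^n is the direct sum over p + q = n *)
Definition tensor_complex (X Y : complex L) : complex L :=
  @Complex L (tensor_obj X Y) (tensor_diff X Y) (@tensor_diff_sqr X Y).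

Section TensorMap.
Variables (T X Y : complex L) (f : chain_map X Y).

Definition tensor_cmap (n : int) :
  {linear tensor_complex X T n -> tensor_complex Y T n} :=
  @dsum_lift _ _ (@tensor_summand X T n) _
    (fun i => @dsum_in _ _ (@tensor_summand Y T n) i \o
              htensor_map H (f (val i).1) idfun).

Lemma tensor_cmap_gen n i x t :
  tensor_cmap n (@tensor_gen X T n i x t) = tensor_gen (f _ x) t.
Proof.
by apply: etrans (dsum_lift_in _ _) _; rewrite /= htensor_map_pure.
Qed.

Lemma tensor_cmapMz n (x : tensor_obj X T n) (m : int) :
  tensor_cmap n (x *~ m) = tensor_cmap n x *~ m.
Proof. exact: raddfMz. Qed.

Fact tensor_cmap_subproof n (x : tensor_complex X T n) :
  tensor_cmap (n + 1) (cd (tensor_complex X T) n x) =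
  cd (tensor_complex Y T) n (tensor_cmap n x).
Proof.
move: x; apply: (@tensor_obj_ext X T n _
  (tensor_cmap (n + 1) \o tensor_diff X T n)
  (tensor_diff Y T n \o tensor_cmap n)) => i x t.
rewrite /= tensor_diff_gen tensor_cmap_gen tensor_diff_gen.
by rewrite linearD tensor_cmapMz !tensor_cmap_gen cmapd.
Qed.

Definition tensor_map_right :
    chain_map (tensor_complex X T) (tensor_complex Y T) :=
  @ChainMap L (tensor_complex X T) (tensor_complex Y T) tensor_cmap
    tensor_cmap_subproof.
End TensorMap.

Section TensorHomotopy.
Variables (T X Y : complex L) (f g : chain_map X Y).
Variable h : forall n : int, {linear X (n + 1) -> Y n}.
Hypothesis fg : forall (n : int) (x : X (n + 1)),
  f (n + 1) x - g (n + 1) x = cd Y n (h n x) + h (n + 1) (cd X (n + 1) x).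

Definition h_cast (p r : int) (e : r + 1 = p) : {linear X p -> Y r} :=
  match e in _ = p return {linear X p -> Y r} with erefl => h r end.

Fact decr_left_subproof n (i : bidegree (n + 1)) :
  (val i).1 - 1 + (val i).2 == n.
Proof. by rewrite addrAC (eqP (valP i)) addrK. Qed.

Definition decr_left n (i : bidegree (n + 1)) : bidegree n :=
  exist _ ((val i).1 - 1, (val i).2) (decr_left_subproof i).

Definition tensor_htpy n :
    {linear tensor_obj X T (n + 1) -> tensor_obj Y T n} :=
  @dsum_lift _ _ (@tensor_summand X T (n + 1)) _
    (fun i => @dsum_in _ _ (@tensor_summand Y T n) (decr_left i) \o
              htensor_map H (h_cast (subrK 1 (val i).1)) idfun).

Lemma tensor_htpyMz n x m : tensor_htpy n (x *~ m) = tensor_htpy n x *~ m.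
Proof. exact: raddfMz. Qed.

Lemma tensor_htpy_gen n r q (e : r + 1 + q == n + 1) (e' : r + q == n) x t :
  tensor_htpy n (@tensor_gen X T _ (exist _ (r + 1, q) e) x t) =
  @tensor_gen Y T n (exist _ (r, q) e') (h r x) t.
Proof.
apply: etrans (dsum_lift_in _ _) _; rewrite [LHS]/= htensor_map_pure.
rewrite -[LHS]/(@tensor_gen Y T n (decr_left _) _ t) /decr_left /=.
move: (decr_left_subproof _) => /=; move: (subrK _ _) => /=.
move: (r + 1 - 1) => r' E.
have Er : r = r' by apply: (@addIr _ (1 : int)); rewrite E.
case: r' / Er E => E e''; rewrite (eq_axiomK E) /=.
exact: tensor_gen_irr.
Qed.

Lemma tensor_map_homotopic :
  homotopic (tensor_map_right T f) (tensor_map_right T g).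
Proof.
exists tensor_htpy => n x.
have xE : tensor_cmap T f (n + 1) x + - tensor_cmap T g (n + 1) x =
          tensor_diff Y T n (tensor_htpy n x) +
          tensor_htpy (n + 1) (tensor_diff X T (n + 1) x);
  last exact: xE.
move: x; apply: (@tensor_obj_ext X T (n + 1) _
  (tensor_cmap T f (n + 1) \+ \- tensor_cmap T g (n + 1))
  ((tensor_diff Y T n \o tensor_htpy n) \+
   (tensor_htpy (n + 1) \o tensor_diff X T (n + 1)))).
move=> [[p q] e]; rewrite /=; move: e.
have [r ->] : exists r : int, p = r + 1 by exists (p - 1); rewrite subrK.
move=> /= e x t; rewrite !tensor_cmap_gen /=.
have e' : r + q == n.
  by rewrite -(inj_eq (addIr 1)) addrAC.
rewrite (@tensor_htpy_gen n r q e e') !tensor_diff_gen linearD tensor_htpyMz.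
rewrite (@tensor_htpy_gen (n + 1) (r + 1) q _ e).
have e1 : r + (q + 1) == n + 1 by rewrite addrA (eqP e').
rewrite (@tensor_htpy_gen (n + 1) r (q + 1) _ e1) /= signS mulrNz.
have -> : @tensor_gen Y T (n + 1) (exist _ (r, q + 1) e1) (h r x) (cd T q t) =
    @tensor_gen Y T (n + 1) (incr_right (exist _ (r, q) e')) (h r x) (cd T q t).
  exact: tensor_gen_irr.
have -> : @tensor_gen Y T (n + 1) (incr_left (exist _ (r, q) e'))
      (cd Y r (h r x)) t =
    @tensor_gen Y T (n + 1) (exist _ (r + 1, q) e) (cd Y r (h r x)) t.
  exact: tensor_gen_irr.
rewrite [in RHS]addrACA subrr addr0 -tensor_genDl -fg tensor_genDl.
congr (_ + _); apply/eqP; rewrite eq_sym -subr_eq0 opprK -tensor_genDl addNr.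
by rewrite tensor_gen0l.
Qed.
End TensorHomotopy.

Section TensorFunctor.
Variable T : complex L.

Fact tensor_functor_heq (X Y : complex L) (f g : chain_map X Y) :
  homotopic f g -> homotopic (tensor_map_right T f) (tensor_map_right T g).
Proof. by case=> h; exact: tensor_map_homotopic. Qed.

Fact tensor_functor_id (X : complex L) :
  homotopic (tensor_map_right T (chain_id X)) (chain_id (tensor_complex X T)).
Proof.
apply: eq_homotopic => n.
apply: (@tensor_obj_ext X T n _ (tensor_cmap T (chain_id X) n) idfun) => i x t.
exact: tensor_cmap_gen.
Qed.

Fact tensor_functor_comp (X Y Z : complex L) (f : chain_map Y Z)
    (g : chain_map X Y) :
  homotopic (tensor_map_right T (chain_comp f g))
    (chain_comp (tensor_map_right T f) (tensor_map_right T g)).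
Proof.
apply: eq_homotopic => n.
apply: (@tensor_obj_ext X T n _ (tensor_cmap T (chain_comp f g) n)
  (tensor_cmap T f n \o tensor_cmap T g n)) => i x t.
rewrite tensor_cmap_gen -[RHS]/(tensor_cmap T f n (tensor_cmap T g n _)).
by rewrite !tensor_cmap_gen.
Qed.

Definition tensor_functor :
    functor (homotopy_category L) (homotopy_category L) :=
  @Functor (homotopy_category L) (homotopy_category L)
    (fun X => tensor_complex X T) (fun X Y f => tensor_map_right T f)
    tensor_functor_heq tensor_functor_id tensor_functor_comp.
End TensorFunctor.

End TensorComplex.

(* Main.v *)
Require Import Defs.
From mathcomp Require Import all_boot all_order all_algebra all_field.
From HB Require Import structures.
From mathcomp Require Import boolp classical_sets zify.

(** The three statements follow from the universal properties of the maps
    eta : k -> ik and v : ik -> tk in the homotopy category.  Composition with eta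
    is bijective on homotopy classes of maps to a complex of injectives
    ([orth_resolution]), because the cone of eta is acyclic and bounded below.
    Composition with v is bijective on homotopy classes of maps to an acyclic
    complex ([orth_tate]), because pk, being bounded above with projective terms,
    has no maps to an acyclic complex up to homotopy.

    To tensor these properties with a complex X, write Hom_k(X, Y) for the complex
    of k-linear maps with the diagonal action of L.  Cocommutativity gives the
    adjunction between X (x) - and Hom_k(X, -), first for modules ([curry] and
    [uncurry]) and then for complexes ([hat_homotopic] and [hat_surjective]), so a
    universal property of f : k -> T with respect to Hom_k(X, Y) becomes one of
    X = X (x) k -> X (x) T with respect to Y ([orth_unit_of]).  If the terms of Y are
    injective, so are those of Hom_k(X, Y); if Y is acyclic, it is contractible
    over the field k, and Hom_k(X, Y) is acyclic ([ihom_termwise_injective],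
    [ihom_acyclic]).  This shows that - (x) ik and - (x) tk are left adjoint to the
    inclusions, and that X (x) tk represents Hom(X, -) on acyclic complexes of
    injectives for every complex X.

    That projective and injective modules coincide is proved without integrals.
    By the adjunction, N (x) P is projective for P projective, and Hom_k(P, N) is
    injective.  As L has finite dimension, N (x) Hom_k(L, I) is Hom_k(L, N (x) I), so
    N (x) I is injective for I injective ([tensor_injective]).  An injective module M
    is then a direct summand of L (x) M, because the kernel of the map L (x) M -> M
    given by the counit is injective ([injective_projective]); dually, a
    projective module P is a direct summand of Hom_k(L, k) (x) P
    ([projective_injective]).  Hence direct sums of injectives are injective, and
    the terms of X (x) ik and X (x) tk are injective.

    For the third statement let Y be an acyclic complex of injectives.  Maps from
    a module M, seen as a complex, to Y are maps M -> Z^0 Y, and homotopy becomes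
    equality modulo maps through injectives, since a map from an injective, hence
    projective, module to Z^0 Y lifts to Y^(-1) ([homotopic_of_cycle]).  So M |->
    M (x) tk is left adjoint to Z^0 on the stable category.  Composition with the
    inclusion of Z^0 Y into Y is bijective on homotopy classes of maps to acyclic
    complexes of injectives ([orth_cycle_in]), which says that Z^0 is fully
    faithful.  It is essentially surjective, since M is the module of
    cycles of M (x) C, where C is the cone of pk -> ik
    ([stable_object_of_cycles]).  A fully faithful and essentially surjective
    right adjoint is an equivalence with its left adjoint as quasi-inverse
    ([equivalence_of_units]). *)

Set Implicit Arguments.
Unset Strict Implicit.
Unset Printing Implicit Defensive.

Import Order.TTheory GRing.Theory Num.Theory.
Local Open Scope ring_scope.

(** * Splittings of modules and vector spaces *)

(** A choice of values that satisfy a linear specification determined up to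
    equality is a linear map; this is how inverses, lifts along injections and
    factorisations through surjections are produced below. *)
Lemma linear_choice (R : pzRingType) (M N : lmodType R) (P : M -> N -> Prop) :
  (forall m, exists n, P m n) ->
  (forall m n n', P m n -> P m n' -> n = n') ->
  (forall a m m' n n', P m n -> P m' n' -> P (a *: m + m') (a *: n + n')) ->
  exists f : {linear M -> N}, forall m, P m (f m).
Proof.
move=> exP uniqP linP; have [f fP] := choice exP.
have fL : linear f by move=> a x y; apply: uniqP (fP _) (linP _ _ _ _ _ _ _).
pose l := GRing.isLinear.Build R M N _ f fL.
pose g : {linear M -> N} := HB.pack f l.
by exists g.
Qed.

Section Modules.
Variable R : pzRingType.
Implicit Types A B E M N : lmodType R.

Lemma factor_surjective A B M (p : {linear A -> B}) (f : {linear A -> M}) :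
  (forall b, exists a, p a = b) -> (forall a, p a = 0 -> f a = 0) ->
  exists g : {linear B -> M}, forall a, g (p a) = f a.
Proof.
move=> p_surj kerf.
have [|b n n'|c b b' n n'|g gP] :=
  @linear_choice R B M (fun b n => exists2 a, p a = b & f a = n).
- by move=> b; have [a <-] := p_surj b; exists (f a), a.
- move=> [a <- <-] [a' aa' <-]; apply/eqP.
  by rewrite -subr_eq0 -linearB kerf // linearB aa' subrr.
- by move=> [a <- <-] [a' <- <-]; exists (c *: a + a'); rewrite linearP.
exists g => a; have [a' aa' <-] := gP (p a); apply/eqP.
by rewrite -subr_eq0 -linearB kerf // linearB aa' subrr.
Qed.

Lemma lift_injective A B M (i : {linear A -> B}) (f : {linear M -> B}) :
  injective i -> (forall m, exists a, i a = f m) ->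
  exists g : {linear M -> A}, forall m, i (g m) = f m.
Proof.
move=> i_inj imf.
have [//|m n n' <- /i_inj //|c m m' n n' iE iE'|g gP] :=
  @linear_choice R M A (fun m a => i a = f m).
  by rewrite !linearP iE iE'.
by exists g.
Qed.

Lemma linear_inverse A B (f : {linear A -> B}) :
  injective f -> (forall b, exists a, f a = b) ->
  exists2 g : {linear B -> A}, cancel f g & cancel g f.
Proof.
move=> f_inj f_surj.
have [g gP] := @lift_injective _ _ _ f (linear_id B) f_inj f_surj.
by exists g => // a; apply: f_inj; rewrite gP.
Qed.

Definition image_pred A B (f : {linear A -> B}) : {pred B} :=
  [pred b | `[< exists a, f a = b >]].

Fact image_submod A B (f : {linear A -> B}) : submod_closed (image_pred f).
Proof.
split=> [|c x y]; first by apply/asboolP; exists 0; rewrite linear0.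
move=> /asboolP[a <-] /asboolP[b <-]; apply/asboolP.
by exists (c *: a + b); rewrite linearP.
Qed.
HB.instance Definition _ A B (f : {linear A -> B}) :=
  GRing.isSubmodClosed.Build R B (image_pred f) (image_submod f).

Section Image.
Variables (A B : lmodType R) (f : {linear A -> B}).
Definition image_of : Type := {b : B | b \in image_pred f}.
HB.instance Definition _ := SubChoice.on image_of.
HB.instance Definition _ := [SubChoice_isSubLmodule of image_of by <:].
Definition image_in : {linear image_of -> B} := val.
Lemma image_in_inj : injective image_in. Proof. exact: val_inj. Qed.

Lemma image_corestr : exists f' : {linear A -> image_of},
  (forall b, exists a, f' a = b) /\ forall a, image_in (f' a) = f a.
Proof.
have im a : f a \in image_pred f by apply/asboolP; exists a.
have [|f' fE] := @lift_injective _ _ _ image_in f image_in_inj.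
  by move=> a; exists (Sub (f a) (im a)).
exists f'; split=> // b; have /asboolP[a ab] := valP b.
by exists a; apply: image_in_inj; rewrite fE.
Qed.
End Image.

Definition ker_pred A B (f : {linear A -> B}) : {pred A} :=
  [pred a | f a == 0].

Fact ker_submod A B (f : {linear A -> B}) : submod_closed (ker_pred f).
Proof.
split=> [|c x y]; rewrite !inE ?linear0 // linearP => /eqP-> /eqP->.
by rewrite scaler0 addr0.
Qed.
HB.instance Definition _ A B (f : {linear A -> B}) :=
  GRing.isSubmodClosed.Build R A (ker_pred f) (ker_submod f).

Section Kernel.
Variables (A B : lmodType R) (f : {linear A -> B}).
Definition ker_of : Type := {a : A | a \in ker_pred f}.
HB.instance Definition _ := SubChoice.on ker_of.
HB.instance Definition _ := [SubChoice_isSubLmodule of ker_of by <:].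
Definition ker_in : {linear ker_of -> A} := val.
Lemma ker_in_inj : injective ker_in. Proof. exact: val_inj. Qed.
Lemma ker_inP a : f a = 0 <-> exists z, ker_in z = a.
Proof.
split=> [fa|[z <-]]; last by apply/eqP; case: z.
have fa' : a \in ker_pred f by rewrite inE fa.
by exists (Sub a fa').
Qed.
End Kernel.

(** Factor through the image, then extend from the image to the target. *)
Lemma injective_factor A B M (d : {linear A -> B}) (f : {linear A -> M}) :
  injective_module M -> (forall a, d a = 0 -> f a = 0) ->
  exists g : {linear B -> M}, forall a, g (d a) = f a.
Proof.
move=> injM kerf; have [d' [d'_surj d'E]] := image_corestr d.
have [|g gE] := factor_surjective (f := f) d'_surj.
  by move=> a d'a; apply: kerf; rewrite -d'E d'a linear0.
have [h hE] := injM _ _ (image_in d) g (@image_in_inj _ _ d).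
by exists h => a; rewrite -d'E hE.
Qed.

(** Dually, [A] maps onto the image of [d], and [f] lands in that image. *)
Lemma projective_factor A B M (d : {linear A -> B}) (f : {linear M -> B}) :
  projective_module M -> (forall m, exists a, d a = f m) ->
  exists g : {linear M -> A}, forall m, d (g m) = f m.
Proof.
move=> projM imf; have [d' [d'_surj d'E]] := image_corestr d.
have [|f' f'E] := lift_injective (f := f) (@image_in_inj _ _ d).
  by move=> m; have [a <-] := imf m; exists (d' a).
have [g gE] := projM _ _ d' f' d'_surj.
by exists g => m; rewrite -d'E gE.
Qed.

Lemma retract_injective M N (i : {linear M -> N}) (r : {linear N -> M}) :
  cancel i r -> injective_module N -> injective_module M.
Proof.
move=> iK injN A B j f /(injN _ _ j (i \o f))[g gE].
by exists (r \o g) => a; rewrite /= gE /= iK.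
Qed.

Lemma retract_projective M N (i : {linear M -> N}) (r : {linear N -> M}) :
  cancel i r -> projective_module N -> projective_module M.
Proof.
move=> iK projN A B p f /(projN _ _ p (f \o r))[g gE].
by exists (g \o i) => a; rewrite /= gE /= iK.
Qed.

Section ShortExact.
Variables (A E B : lmodType R) (i : {linear A -> E}) (q : {linear E -> B}).
Hypotheses (i_inj : injective i) (q_surj : forall b, exists e, q e = b).
Hypothesis exact_iq : forall e, q e = 0 <-> exists a, i a = e.

Let qi a : q (i a) = 0. Proof. by apply/exact_iq; exists a. Qed.

Lemma injective_kernel_section : injective_module A ->
  exists s : {linear B -> E}, cancel s q.
Proof.
move=> injA; have [r rE] := injA _ _ i (linear_id A) i_inj.
(* 1 - i r kills the kernel of q, so it factors through q *)
have [|s sE] := @factor_surjective _ _ _ q (linear_id E \- (i \o r)) q_surj.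
  by move=> e /exact_iq[a <-] /=; rewrite rE subrr.
exists s => b; have [e <-] := q_surj b.
by rewrite sE /= linearB qi subr0.
Qed.

Lemma projective_quotient_retraction : projective_module B ->
  exists r : {linear E -> A}, cancel i r.
Proof.
move=> projB; have [s sE] := projB _ _ q (linear_id B) q_surj.
(* 1 - s q takes its values in the kernel of q *)
have [|r rE] := lift_injective (f := linear_id E \- (s \o q)) i_inj.
  by move=> e; apply/exact_iq; rewrite /= linearB sE subrr.
by exists r => a; apply: i_inj; rewrite rE /= qi linear0 subr0.
Qed.
End ShortExact.

End Modules.

Section VectorSpaces.
Variable k : fieldType.
Implicit Types U V W : lmodType k.

Section Extension.
Local Open Scope classical_set_scope.
Variables (U V W : lmodType k) (i : {linear U -> V}) (f : {linear U -> W}).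
Hypothesis i_inj : injective i.

(* graphs of linear maps on subspaces of V that extend f along i *)
Let partial_ext (G : set (V * W)) :=
  [/\ forall u, G (i u, f u),
      forall a v w v' w', G (v, w) -> G (v', w') ->
        G (a *: v + v', a *: w + w')
    & forall w, G (0, w) -> w = 0].

Let T := {G | partial_ext G}.
Let R (G G' : T) := `[< sval G `<=` sval G' >].

Let graph_f : partial_ext [set vw | exists u, vw = (i u, f u)].
Proof.
split=> [u|a v w v' w' [u [-> ->]] [u' [-> ->]]|w [u []]]; first by exists u.
- by exists (a *: u + u'); rewrite !linearP.
- by rewrite -(linear0 i) => /i_inj <- ->; rewrite linear0.
Qed.

Let partial_ext_total (G : set (V * W)) : partial_ext G ->
  (forall G', partial_ext G' -> G `<=` G' -> G' `<=` G) ->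
  forall v, exists w, G (v, w).
Proof.
move=> [Gf GL G0] maxG v; apply: contrapT => nGv.
have G00 : G (0, 0) by have := Gf 0; rewrite !linear0.
have GZ a x y : G (x, y) -> G (a *: x, a *: y).
  by move=> /(GL a _ _ _ _)/(_ G00); rewrite !addr0.
(* if G had no value at v, the value 0 at v would extend it properly *)
pose G' : set (V * W) := [set xy | exists a, G (xy.1 - a *: v, xy.2)].
have extG' : partial_ext G'.
  split=> [u|a x y x' y' [b /= Gb] [b' /= Gb']|w [a /= Ga]].
  - by exists 0; rewrite /= scale0r subr0; apply: Gf.
  - exists (a * b + b') => /=.
    rewrite scalerDl -scalerA opprD addrACA -scalerBr; exact: GL.
  - have [a0|a_neq0] := eqVneq a 0.
      by apply: G0; move: Ga; rewrite a0 scale0r subr0.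
    case: nGv; exists (- a^-1 *: w); have := GZ (- a^-1) _ _ Ga.
    by rewrite sub0r scalerN scaleNr opprK scalerA mulVf // scale1r.
have GG' : G `<=` G' by move=> [x y] Gxy; exists 0; rewrite /= scale0r subr0.
case: nGv; exists 0; apply: (maxG _ extG' GG').
by exists 1; rewrite /= scale1r subrr.
Qed.

(** Zorn's lemma, applied to the graphs of the partial extensions. *)
Lemma linear_extension : exists g : {linear V -> W}, forall u, g (i u) = f u.
Proof.
have Rrefl (G : T) : R G G by apply/asboolP.
have Rtrans (G G' G'' : T) : R G G' -> R G' G'' -> R G G''.
  by rewrite /R => /asboolP GG' /asboolP G'G''; apply/asboolP/(subset_trans GG').
have [|G maxG] := ZL_preorder (exist _ _ graph_f : T) Rrefl Rtrans.
  move=> A Atot; have [[G0 AG0]|A0] := pselect (exists G, A G); last first.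
    by exists (exist _ _ graph_f) => G AG; case: A0; exists G.
  have UP : partial_ext (\bigcup_(G in A) sval G).
    split=> [u|a v w v' w' [G AG Gvw] [G' AG' Gvw']|w [G AG Gw]].
    - by exists G0 => //; have [+ _ _] := svalP G0; apply.
    - have := Atot _ _ AG AG'; rewrite /R => -[/asboolP GG'|/asboolP G'G].
        by exists G' => //; have [_ + _] := svalP G'; apply=> //; apply: GG'.
      by exists G => //; have [_ + _] := svalP G; apply=> //; apply: G'G.
    - by have [_ _] := svalP G; apply.
  by exists (exist _ _ UP) => G AG; apply/asboolP => x Gx; exists G.
case: G maxG => G extG maxG; have [Gf GL G0] := extG.
have [|v w w' Gw Gw'||g gP] := @linear_choice k V W (fun v w => G (v, w)).
- apply: partial_ext_total => // G' extG' GG'.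
  by have := maxG (exist _ G' extG') (introT (asboolP _) GG');
    rewrite /R => /asboolP.
- by apply/eqP; rewrite -subr_eq0; apply/eqP/G0;
    have := GL (-1) _ _ _ _ Gw' Gw; rewrite !scaleN1r addNr addrC.
- by move=> a v v' w w'; apply: GL.
exists g => u; apply/eqP; rewrite -subr_eq0; apply/eqP/G0.
by have := GL (-1) _ _ _ _ (Gf u) (gP (i u)); rewrite !scaleN1r addNr addrC.
Qed.
End Extension.

Lemma vector_space_injective W : injective_module W.
Proof. by move=> U V i f /linear_extension; apply. Qed.

Lemma linear_retraction U V (i : {linear U -> V}) :
  injective i -> exists r : {linear V -> U}, cancel i r.
Proof. by move=> /(linear_extension (linear_id U))[r rE]; exists r. Qed.

(** Choose a complement of the kernel of [d], then extend from the image. *)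
Lemma linear_pseudoinverse U V (d : {linear U -> V}) :
  exists t : {linear V -> U}, forall u, d (t (d u)) = d u.
Proof.
have [d' [d'_surj d'E]] := image_corestr d.
have [s sK] := injective_kernel_section (@ker_in_inj _ _ _ d') d'_surj
  (@ker_inP _ _ _ d') (@vector_space_injective _).
have [t tE] := linear_extension s (@image_in_inj _ _ _ d).
by exists t => u; rewrite -{1}(d'E u) tE -d'E sK d'E.
Qed.

End VectorSpaces.

(** * Linear maps over the base field between modules *)

Section KLinear.
Variables (k : fieldType) (L : falgType k).
Implicit Types M N P : lmodType L.

(** Linearity over k for the action of k through the unit of L.  It is stated on
    L-modules themselves, since most maps below are compared with L-linear
    ones. *)
Definition klinear M N (f : M -> N) : Prop :=
  forall (a : k) x y, f (a%:A *: x + y) = a%:A *: f x + f y.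

Lemma klinear_restr M N (f : M -> N) :
  klinear f <-> linear (f : restr M -> restr N).
Proof. by []. Qed.

Section KLinearTheory.
Variables (M N : lmodType L) (f : M -> N).
Hypothesis fL : klinear f.

Lemma klinearD x y : f (x + y) = f x + f y.
Proof. by have := fL 1 x y; rewrite !scale1r. Qed.
Lemma klinear0 : f 0 = 0.
Proof. by apply: (addrI (f 0)); rewrite -klinearD !addr0. Qed.
Lemma klinearZ a x : f (a%:A *: x) = a%:A *: f x.
Proof. by have := fL a x 0; rewrite klinear0 !addr0. Qed.
Lemma klinearN x : f (- x) = - f x.
Proof. by apply: (addrI (f x)); rewrite -klinearD !subrr klinear0. Qed.
Lemma klinearB x y : f (x - y) = f x - f y.
Proof. by rewrite klinearD klinearN. Qed.
Lemma klinear_sum I (r : seq I) (F : I -> M) :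
  f (\sum_(i <- r) F i) = \sum_(i <- r) f (F i).
Proof. by elim/big_rec2: _ => [|i x y _ <-]; rewrite ?klinear0 ?klinearD. Qed.
Lemma klinearMz x (m : int) : f (x *~ m) = f x *~ m.
Proof.
have fMn j : f (x *+ j) = f x *+ j.
  by elim: j => [|j IH]; rewrite ?klinear0 // !mulrS klinearD IH.
by case: m => m; rewrite ?NegzE ?mulrNz -?pmulrn ?klinearN fMn.
Qed.
End KLinearTheory.

Lemma scaler_algC M (a : k) (u : L) (x : M) :
  u *: (a%:A *: x) = a%:A *: (u *: x).
Proof. by rewrite !scalerA -scalerAr -scalerAl mulr1 mul1r. Qed.

Lemma klinear_id M : klinear (fun x : M => x). Proof. by []. Qed.
Lemma klinear_linear M N (f : {linear M -> N}) : klinear f.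
Proof. by move=> a x y; rewrite linearP. Qed.
Lemma klinear_comp M N P (g : N -> P) (f : M -> N) :
  klinear g -> klinear f -> klinear (fun x => g (f x)).
Proof. by move=> gL fL a x y; rewrite fL gL. Qed.
Lemma klinear_add M N (f g : M -> N) :
  klinear f -> klinear g -> klinear (fun x => f x + g x).
Proof. by move=> fL gL a x y; rewrite fL gL scalerDr addrACA. Qed.
Lemma klinear_scale M N (u : L) (f : M -> N) :
  klinear f -> klinear (fun x => u *: f x).
Proof. by move=> fL a x y; rewrite fL scalerDr scaler_algC. Qed.
Lemma klinear_scalel M N (f : M -> L) (n : N) :
  klinear (f : M -> L^o) -> klinear (fun x => f x *: n).
Proof. by move=> fL a x y; rewrite fL scalerDl scalerA. Qed.
Lemma klinear_mulr M (u : L) (f : M -> L) :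
  klinear (f : M -> L^o) -> klinear ((fun x => u * f x) : M -> L^o).
Proof. exact: klinear_scale. Qed.
Lemma klinear_mull M (u : L) (f : M -> L) :
  klinear (f : M -> L^o) -> klinear ((fun x => f x * u) : M -> L^o).
Proof. exact: (@klinear_scalel _ L^o). Qed.
Lemma klinear_big M N I (r : seq I) (F : I -> M -> N) :
  (forall i, klinear (F i)) -> klinear (fun x => \sum_(i <- r) F i x).
Proof.
move=> FL a x y; rewrite scaler_sumr -big_split.
by apply: eq_bigr => i _; rewrite FL.
Qed.
Lemma regular_algZ (b : k) (z : L) : b%:A *: (z : L^o) = b *: z :> L.
Proof. by rewrite -[LHS]/(b%:A * z) mulr_algl. Qed.
Lemma klinear_lfun (f : {linear L -> L}) M (g : M -> L) :
  klinear (g : M -> L^o) -> klinear ((fun x => f (g x)) : M -> L^o).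
Proof.
by move=> gL a x y; rewrite gL !regular_algZ linearP.
Qed.
Lemma klinear_alg M (f : M -> k) : linear (f : restr M -> k^o) ->
  klinear ((fun x => (f x)%:A) : M -> L^o).
Proof.
by move=> fL a x y; rewrite [f _]fL scalerDl -scalerA regular_algZ.
Qed.
Lemma klinear_opp M N (f : M -> N) : klinear f -> klinear (fun x => - f x).
Proof. by move=> fL a x y; rewrite fL opprD scalerN. Qed.
Lemma klinear_0 M N : klinear (fun x : M => 0 : N).
Proof. by move=> a x y; rewrite scaler0 addr0. Qed.
Lemma klinear_Mz M N (f : M -> N) (m : int) :
  klinear f -> klinear (fun x => f x *~ m).
Proof. by move=> fL a x y; rewrite fL mulrzDl scalerMzr. Qed.

Lemma klinear_retraction M N (i : M -> N) : klinear i -> injective i ->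
  exists2 r : N -> M, klinear r & cancel i r.
Proof.
move=> /klinear_restr iL i_inj.
pose l := GRing.isLinear.Build k (restr M) (restr N) _ i iL.
pose i' : {linear restr M -> restr N} := HB.pack i l.
have [r rK] := @linear_retraction k (restr M) (restr N) i' i_inj.
by exists r => //; apply/klinear_restr; apply: linearP.
Qed.

Lemma klinear_pseudoinverse M N (d : M -> N) : klinear d ->
  exists2 t : N -> M, klinear t & forall x, d (t (d x)) = d x.
Proof.
move=> /klinear_restr dL.
pose l := GRing.isLinear.Build k (restr M) (restr N) _ d dL.
pose d' : {linear restr M -> restr N} := HB.pack d l.
have [t tP] := @linear_pseudoinverse k (restr M) (restr N) d'.
by exists t => //; apply/klinear_restr; apply: linearP.
Qed.
End KLinear.

(** * Sums over the comultiplication *)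

Section Sweedler.
Variables (k : fieldType) (L : falgType k) (H : hopf_algebra L).
Implicit Types M N P : lmodType L.

(** Sweedler's notation: [csum g b] is the sum of the g (b_1, b_2).  It is a sum
    over a representative, so that it commutes with additive maps whatever [g]
    is; bilinearity of [g] makes it independent of the representative. *)
Definition csum (P : zmodType) (g : L -> L -> P) (b : L) : P :=
  \sum_(uv <- repr (comul H b)) g uv.1 uv.2.

Lemma eq_csum (P : zmodType) (g g' : L -> L -> P) b :
  (forall u v, g u v = g' u v) -> csum g b = csum g' b.
Proof. by move=> gg'; apply: eq_bigr => uv _; apply: gg'. Qed.

Lemma csum_exchange (P : zmodType) (g : L -> L -> L -> L -> P) a b :
  csum (fun u v => csum (g u v) b) a =
  csum (fun x y => csum (fun u v => g u v x y) a) b.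
Proof. exact: exchange_big. Qed.

Definition klinear2 M N P (g : M -> N -> P) : Prop :=
  (forall m, klinear (g m)) /\ (forall n, klinear (g^~ n)).

Lemma klinear2_bilinear P (g : L -> L -> P) :
  @klinear2 L^o L^o P g -> @bilinear_map k L L (restr P) g.
Proof.
move=> [gr gl].
have scE (a : k) (x : L) : a *: x = a%:A *: (x : L^o).
  by rewrite regular_algZ.
split=> [m m' n|m n n'|a m n|a m n].
- exact: (klinearD (gl n)).
- exact: (klinearD (gr m)).
- by rewrite scE; apply: (klinearZ (gl n)).
- by rewrite scE; apply: (klinearZ (gr m)).
Qed.

Section Bilinear.
Variables (P : lmodType L) (g : L -> L -> P).
Hypothesis gL : @klinear2 L^o L^o P g.
Let gB := klinear2_bilinear gL.

Lemma csumE b : csum g b = @tensor_lift k L L (restr P) g (comul H b).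
Proof. by []. Qed.

Lemma csum_klinear : klinear (csum g : L^o -> P).
Proof.
move=> a x y; rewrite !csumE.
rewrite regular_algZ linearP (tensor_liftD gB) (tensor_liftZ gB).
by [].
Qed.

Lemma csum1 : csum g 1 = g 1 1.
Proof. by rewrite csumE comul1 (tensor_lift_pure gB). Qed.

End Bilinear.

Lemma tensor_lift_sum (U V W : lmodType k) (g : U -> V -> W) I (r : seq I) F G :
  bilinear_map g ->
  tensor_lift g (\sum_(i <- r) tpure (F i) (G i)) = \sum_(i <- r) g (F i) (G i).
Proof.
move=> gB; elim/big_rec2: _ => [|i x y _ IH]; first exact: tensor_lift0.
by rewrite (tensor_liftD gB) (tensor_lift_pure gB) IH.
Qed.

Lemma csumC P (g : L -> L -> P) b : @klinear2 L^o L^o P g -> cocommutative H ->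
  csum g b = csum (fun u v => g v u) b.
Proof.
move=> /klinear2_bilinear gB /(_ b) cocomH.
rewrite csumE -cocomH {1}/tensor_swap {2}/tensor_lift.
by rewrite (tensor_lift_sum _ _ _ gB).
Qed.

Definition klinear3 P (g : L -> L -> L -> P) : Prop :=
  [/\ forall u v, klinear (g u v : L^o -> P),
      forall u w, klinear ((fun v => g u v w) : L^o -> P) &
      forall v w, klinear ((fun u => g u v w) : L^o -> P)].

(** The map on the threefold tensor product that is induced by [g] takes the same
    value on the two sides of coassociativity. *)
Lemma csumA P (g : L -> L -> L -> P) b : klinear3 g ->
  csum (fun u w => csum (fun x y => g x y w) u) b =
  csum (fun u w => csum (g u) w) b.
Proof.
move=> [g3 g2 g1].
have gB u : @bilinear_map k L L (restr P) (g u).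
  by apply: klinear2_bilinear; split.
have pB (c : L) : bilinear_map (fun x y : L => tpure x (tpure y c)).
  split=> *; rewrite ?(tpureDl, tpureDr, tpureZl, tpureZr) //.
have aB : bilinear_map (fun (t : tensor L L) (c : L) =>
    tensor_lift (fun x y => tpure x (tpure y c)) t).
  split=> [t t' c|t c c'|a t c|a t c]; [exact: tensor_liftD| |exact: tensor_liftZ|].
    rewrite /tensor_lift -big_split; apply: eq_bigr => xy _ /=.
    by rewrite -!tpureDr.
  by rewrite /tensor_lift scaler_sumr; apply: eq_bigr => xy _; rewrite !tpureZr.
have GB : bilinear_map (fun (x : L) (t : tensor L L) =>
    tensor_lift (g x : L -> L -> restr P) t).
  split=> [x x' t|x t t'|a x t|a x t]; [|exact: tensor_liftD| |exact: tensor_liftZ].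
    rewrite /tensor_lift -big_split; apply: eq_bigr => xy _ /=.
    exact: (klinearD (g1 _ _)).
  rewrite /tensor_lift scaler_sumr; apply: eq_bigr => xy _.
  rewrite -[a *: x]regular_algZ; exact: (klinearZ (g1 _ _)).
pose G := tensor_lift (fun x t => tensor_lift (g x : L -> L -> restr P) t).
have -> : csum (fun u w => csum (g u) w) b =
    G (tensor_map id (comul H) (comul H b)).
  by rewrite /tensor_map {1}/tensor_lift /G (tensor_lift_sum _ _ _ GB).
rewrite -(comul_coassoc H b) /tensor_map {1}/tensor_lift /tensor_assoc.
rewrite (tensor_lift_sum _ _ _ aB) /G.
have -> : \sum_(i <- repr (comul H b))
    tensor_lift (fun x y => tpure x (tpure y (id i.2))) (comul H i.1) =
  \sum_(i <- [seq (xy.1, (xy.2, i.2)) | i <- repr (comul H b),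
      xy <- repr (comul H i.1)]) tpure i.1 (tpure i.2.1 i.2.2).
  by rewrite big_allpairs_dep.
rewrite (tensor_lift_sum _ _ _ GB) big_allpairs_dep /=.
apply: eq_bigr => uw _; apply: eq_bigr => xy _.
by rewrite (tensor_lift_pure (gB _)).
Qed.

Lemma csumM P (g : L -> L -> P) a b : @klinear2 L^o L^o P g ->
  csum g (a * b) = csum (fun u v => csum (fun x y => g (u * x) (v * y)) b) a.
Proof.
move=> /klinear2_bilinear gB; rewrite csumE comulM.
have -> : tensor_mul (comul H a) (comul H b) =
    \sum_(p <- [seq (uv.1 * xy.1, uv.2 * xy.2) | uv <- repr (comul H a),
      xy <- repr (comul H b)]) tpure p.1 p.2.
  by rewrite /tensor_mul /tensor_lift big_allpairs_dep.
by rewrite (tensor_lift_sum _ _ _ gB) big_allpairs_dep.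
Qed.

(** The counit axioms, with the remaining factor inside a linear map. *)
Lemma csum_counitl P (g : L -> P) b : klinear (g : L^o -> P) ->
  csum (fun u v => (counit H u : k)%:A *: g v) b = g b.
Proof.
move=> gL; rewrite -[in RHS](counit_l H b) /tensor_lift.
rewrite (klinear_sum gL); apply: eq_bigr => uv _.
by rewrite -[in RHS]regular_algZ (klinearZ gL).
Qed.

Lemma csum_counitr P (g : L -> P) b : klinear (g : L^o -> P) ->
  csum (fun u v => (counit H v : k)%:A *: g u) b = g b.
Proof.
move=> gL; rewrite -[in RHS](counit_r H b) /tensor_lift.
rewrite (klinear_sum gL); apply: eq_bigr => uv _.
by rewrite -[in RHS]regular_algZ (klinearZ gL).
Qed.

Lemma csum_antipodel b :
  csum (fun u v => antipode H u * v) b = (counit H b : k)%:A.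
Proof. exact: antipode_l. Qed.

Lemma csum_antipoder b :
  csum (fun u v => u * antipode H v) b = (counit H b : k)%:A.
Proof. exact: antipode_r. Qed.

Lemma antipode1 : antipode H 1 = 1.
Proof.
have := csum_antipodel 1; rewrite (@csum1 L^o) ?mulr1 ?counit1 ?scale1r //.
split=> [u|v]; first by apply: klinear_mulr; apply: klinear_id.
by apply: klinear_mull; apply: klinear_lfun; apply: klinear_id.
Qed.

Lemma klinear_csum M P (g : M -> L -> L -> P) b :
  (forall u v, klinear (fun x => g x u v)) -> klinear (fun x => csum (g x) b).
Proof. by move=> gL; apply: klinear_big => uv; apply: gL. Qed.

Lemma csum_scaler M (g : L -> L -> M) u b :
  csum (fun x y => u *: g x y) b = u *: csum g b.
Proof. by rewrite /csum scaler_sumr. Qed.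
Lemma csum_mulr (g : L -> L -> L) u b :
  csum (fun x y => u * g x y) b = u * csum g b.
Proof. by rewrite /csum mulr_sumr. Qed.
Lemma csum_mull (g : L -> L -> L) u b :
  csum (fun x y => g x y * u) b = csum g b * u.
Proof. by rewrite /csum mulr_suml. Qed.
End Sweedler.

Ltac klin := repeat first
  [ assumption | exact: klinear_id | exact: klinear_0 | exact: klinear_linear
  | apply: klinear_mulr | apply: klinear_mull | apply: klinear_lfun
  | apply: klinear_scale | apply: klinear_scalel | apply: klinear_add
  | apply: klinear_opp | (apply: klinear_csum => ? ?) ].

Section Antipode.
Variables (k : fieldType) (L : falgType k) (H : hopf_algebra L).
Local Notation S := (antipode H).
Local Notation csum := (csum H).
Let e (u : L) : L := (counit H u : k)%:A.

(** Both sides are the sum of the S(b_1) S(a_1) a_2 b_2 S(a_3 b_3). *)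
Lemma antipodeM a b : S (a * b) = S b * S a.
Proof.
pose F (x x' y y' w w' : L) : L := S x' * (S x * (y * (y' * S (w * w')))).
transitivity (csum (fun u w => csum (fun u' w' =>
    csum (fun x' y' => csum (fun x y => F x x' y y' w w') u) u') b) a).
  transitivity (csum (fun u w => e u * S (w * b)) a).
    by apply/esym/(@csum_counitl _ _ H L^o (fun w => S (w * b))); klin.
  apply: eq_csum => u w.
  rewrite -(@csum_counitl _ _ H L^o (fun b => S (w * b))); last by klin.
  rewrite -csum_mulr; apply: eq_csum => u' w'.
  transitivity (csum (fun x' y' => S x' * (e u * (y' * S (w * w')))) u').
    rewrite -[LHS]/(e u * (e u' * S (w * w'))) -[e u']csum_antipodel.
    rewrite -csum_mull -csum_mulr; apply: eq_csum => x' y'.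
    by rewrite /e -!scalerAl !mul1r -!scalerAr !mulrA.
  apply: eq_csum => x' y'; rewrite /F csum_mulr; congr (_ * _).
  rewrite -[e u]csum_antipodel -csum_mull.
  by apply: eq_csum => x y; rewrite -mulrA.
transitivity (csum (fun x' t' => csum (fun y' w' => csum (fun x t =>
    csum (fun y w => F x x' y y' w w') t) a) t') b).
  transitivity (csum (fun u w => csum (fun x' t' => csum (fun y' w' =>
      csum (fun x y => F x x' y y' w w') u) t') b) a).
    apply: eq_csum => u w; apply: (@csumA _ _ _ L^o
      (fun x' y' w' => csum (fun x y => F x x' y y' w w') u)).
    by split=> *; rewrite /F; klin.
  rewrite csum_exchange; apply: eq_csum => x' t'.
  rewrite csum_exchange; apply: eq_csum => y' w'.
  apply: (@csumA _ _ _ L^o (fun x y w => F x x' y y' w w')).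
  by split=> *; rewrite /F; klin.
transitivity (csum (fun x' t' => csum (fun x t =>
    S x' * (S x * (e t * e t'))) a) b).
  apply: eq_csum => x' t'; rewrite csum_exchange; apply: eq_csum => x t.
  have -> : e t * e t' = csum (fun p q => p * S q) (t * t').
    by rewrite csum_antipoder counitM /e -scalerAl mul1r scalerA.
  rewrite (@csumM _ _ _ L^o (fun p q => p * S q)).
    rewrite csum_exchange -!csum_mulr; apply: eq_csum => y w.
    rewrite -!csum_mulr; apply: eq_csum => y' w'; rewrite /F !mulrA //.
  by split=> *; klin.
have Sr c u : csum (fun x t => u * (S x * e t)) c = u * S c.
  rewrite csum_mulr -[in RHS](@csum_counitr _ _ H L^o S c); last by klin.
  by congr (_ * _); apply: eq_csum => x t; rewrite /e -scalerAr mulr1 regular_algZ.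
rewrite -Sr csum_exchange; apply: eq_csum => x t.
rewrite -[S b]mul1r -Sr -csum_mull; apply: eq_csum => x' t'.
have eC z : e t' * z = z * e t' by rewrite /e -scalerAl -scalerAr mul1r mulr1.
by rewrite mul1r -mulrA eC !mulrA.
Qed.
End Antipode.

(** * Tensor products and linear maps as modules *)

Section TensorModules.
Variables (k : fieldType) (L : falgType k) (H : hopf_algebra L).
Implicit Types M N P : lmodType L.
Local Notation csum := (csum H).

Definition tp M N (m : M) (n : N) : htensor H M N :=
  @tpure k (restr M) (restr N) m n.

Lemma htensor_ind M N (Q : htensor H M N -> Prop) :
  Q 0 -> (forall x y, Q x -> Q y -> Q (x + y)) -> (forall m n, Q (tp m n)) ->
  forall x, Q x.
Proof. exact: tensor_ind. Qed.

(** The action through the comultiplication restricts to the action of k on the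
    tensor product, because the comultiplication is unital. *)
Lemma htensor_algZ M N (a : k) (x : htensor H M N) :
  a%:A *: x = (a *: (x : tensor (restr M) (restr N))).
Proof.
rewrite -[LHS]/(tensor_act (comul H a%:A) x) linearZ /= comul1 -tpureZl.
elim/htensor_ind: x => [|x y IHx IHy|m n].
- by rewrite tensor_act0r scaler0.
- by rewrite tensor_actDr IHx IHy scalerDr.
rewrite tensor_act_pure -tpureZl; congr tpure.
by rewrite /restr_act scale1r.
Qed.

Lemma tp_klinear2 M N : klinear2 (@tp M N).
Proof.
split=> [m|n] a x y; rewrite htensor_algZ /tp.
  by rewrite tpureDr -tpureZr.
by rewrite tpureDl -tpureZl.
Qed.
Lemma klinear_tpr M N P (m : M) (f : P -> N) :
  klinear f -> klinear (fun x => tp m (f x)).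
Proof. exact: klinear_comp ((tp_klinear2 M N).1 m). Qed.
Lemma klinear_tpl M N P (n : N) (f : P -> M) :
  klinear f -> klinear (fun x => tp (f x) n).
Proof. exact: klinear_comp ((tp_klinear2 M N).2 n). Qed.

Lemma htensor_scale_tp M N b (m : M) (n : N) :
  b *: tp m n = csum (fun u v => tp (u *: m) (v *: n)) b.
Proof.
apply: eq_bigr => uv _.
exact: (tensor_map_pure (@restr_act_linear _ _ M _) (@restr_act_linear _ _ N _)).
Qed.

Lemma klinear_ext_tp M N P (f g : htensor H M N -> P) :
  klinear f -> klinear g -> (forall m n, f (tp m n) = g (tp m n)) -> f =1 g.
Proof.
move=> fL gL fg; elim/htensor_ind => [|x y IHx IHy|//].
  by rewrite (klinear0 fL) (klinear0 gL).
by rewrite (klinearD fL) (klinearD gL) IHx IHy.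
Qed.

Lemma klinear2_restr_bilinear M N P (g : M -> N -> P) : klinear2 g ->
  @bilinear_map k (restr M) (restr N) (restr P) g.
Proof.
move=> [gr gl]; split=> [m m' n|m n n'|a m n|a m n].
- exact: (klinearD (gl n)).
- exact: (klinearD (gr m)).
- exact: (klinearZ (gl n)).
- exact: (klinearZ (gr m)).
Qed.

Lemma klinear_lift M N P (g : M -> N -> P) : klinear2 g ->
  exists2 f : htensor H M N -> P, klinear f & forall m n, f (tp m n) = g m n.
Proof.
move=> /klinear2_restr_bilinear gB.
exists (@tensor_lift k (restr M) (restr N) (restr P) g).
  move=> a x y; rewrite htensor_algZ.
  by rewrite (tensor_liftD gB) (tensor_liftZ gB).
by move=> m n; apply: (tensor_lift_pure gB).
Qed.

(** By bilinearity it is enough to check equivariance on the generators. *)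
Lemma linear_lift M N P (g : M -> N -> P) : klinear2 g ->
  (forall b m n, csum (fun u v => g (u *: m) (v *: n)) b = b *: g m n) ->
  exists f : {linear htensor H M N -> P}, forall m n, f (tp m n) = g m n.
Proof.
move=> gL gE; have [f fL fE] := klinear_lift gL.
have fZ b x : f (b *: x) = b *: f x.
  move: x; apply: (@klinear_ext_tp M N P (fun x => f (b *: x))
    (fun x => b *: f x)) => [||m n].
  - by move=> a x y; rewrite scalerDr scaler_algC fL.
  - by klin.
  rewrite htensor_scale_tp (klinear_sum fL) fE -gE.
  by apply: eq_bigr => uv _; apply: fE.
have fL' : linear f by move=> b x y; rewrite (klinearD fL) fZ.
pose l := GRing.isLinear.Build L (htensor H M N) P _ f fL'.
pose f' : {linear htensor H M N -> P} := HB.pack f l.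
by exists f'.
Qed.

Lemma klinear_map M N M' N' (f : M -> M') (g : N -> N') :
  klinear f -> klinear g ->
  exists2 h : htensor H M N -> htensor H M' N',
    klinear h & forall m n, h (tp m n) = tp (f m) (g n).
Proof.
move=> fL gL; apply: klinear_lift; split=> [m|n].
  exact: klinear_tpr.
exact: klinear_tpl.
Qed.

Lemma htensor_map_tp M N M' N' (f : {linear M -> M'}) (g : {linear N -> N'})
  m n : htensor_map H f g (tp m n) = tp (f m) (g n).
Proof. exact: htensor_map_pure. Qed.

Lemma linear_ext_tp M N P (f g : {linear htensor H M N -> P}) :
  (forall m n, f (tp m n) = g (tp m n)) -> f =1 g.
Proof. by apply: klinear_ext_tp; apply: klinear_linear. Qed.

(** ** The module of maps over the base field *)

(** The parameter [H'] selects the diagonal action defined below. *)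
Record hhom (H' : hopf_algebra L) (N Y : lmodType L) := Hhom {
  hfun :> N -> Y;
  hfun_klinear : klinear hfun
}.

Section HhomModule.
Variables N Y : lmodType L.
Implicit Types f g : hhom H N Y.

Lemma hhomP f g : (forall x, f x = g x) -> f = g.
Proof.
case: f g => [f fL] [g gL] /= fg.
have {}fg : f = g by apply: funext.
by case: g / fg gL => gL; congr Hhom; apply: Prop_irrelevance.
Qed.

HB.instance Definition _ := gen_eqMixin (hhom H N Y).
HB.instance Definition _ := gen_choiceMixin (hhom H N Y).

Definition hhom0 : hhom H N Y := @Hhom H N Y _ (@klinear_0 k L N Y).
Definition hhom_opp f : hhom H N Y := @Hhom H N Y _ (klinear_opp (hfun_klinear f)).
Definition hhom_add f g : hhom H N Y :=
  @Hhom H N Y _ (klinear_add (hfun_klinear f) (hfun_klinear g)).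

Fact hhom_addA : associative hhom_add.
Proof. by move=> f g h; apply: hhomP => x /=; rewrite addrA. Qed.
Fact hhom_addC : commutative hhom_add.
Proof. by move=> f g; apply: hhomP => x /=; rewrite addrC. Qed.
Fact hhom_add0 : left_id hhom0 hhom_add.
Proof. by move=> f; apply: hhomP => x /=; rewrite add0r. Qed.
Fact hhom_addN : left_inverse hhom0 hhom_opp hhom_add.
Proof. by move=> f; apply: hhomP => x /=; rewrite addNr. Qed.
HB.instance Definition _ := GRing.isZmodule.Build (hhom H N Y)
  hhom_addA hhom_addC hhom_add0 hhom_addN.

Fact hhom_scale_klinear b f :
  klinear (fun x => csum (fun u v => u *: f (antipode H v *: x)) b).
Proof.
apply: klinear_csum => u v; apply: klinear_scale.
by apply: klinear_comp (hfun_klinear f) _; klin.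
Qed.
(** The diagonal action: b f sends x to the sum of the b_1 f (S(b_2) x). *)
Definition hhom_scale b f : hhom H N Y := @Hhom H N Y _ (hhom_scale_klinear b f).

Fact hhom_scale_klinear2 f x :
  @klinear2 k L L^o L^o Y (fun u v => u *: f (antipode H v *: x)).
Proof.
split=> [u|v]; last by klin.
apply: klinear_scale; apply: klinear_comp (hfun_klinear f) _; klin.
Qed.

Fact hhom_scaleA a b f : hhom_scale a (hhom_scale b f) = hhom_scale (a * b) f.
Proof.
apply: hhomP => x /=; rewrite (csumM _ _ _ (hhom_scale_klinear2 f x)).
apply: eq_csum => u v; rewrite -csum_scaler; apply: eq_csum => u' v'.
by rewrite antipodeM !scalerA.
Qed.
Fact hhom_scale1 : left_id 1 hhom_scale.
Proof.
move=> f; apply: hhomP => x /=; rewrite (csum1 _ (hhom_scale_klinear2 f x)).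
by rewrite antipode1 !scale1r.
Qed.
Fact hhom_scaleDr : right_distributive hhom_scale +%R.
Proof.
move=> b f g; apply: hhomP => x /=; rewrite /csum -big_split.
by apply: eq_bigr => uv _ /=; rewrite scalerDr.
Qed.
Fact hhom_scaleDl f : {morph hhom_scale^~ f : a b / a + b}.
Proof.
move=> a b; apply: hhomP => x /=.
by have /klinearD D := csum_klinear H (hhom_scale_klinear2 f x); rewrite D.
Qed.
HB.instance Definition _ := GRing.Zmodule_isLmodule.Build L (hhom H N Y)
  hhom_scaleA hhom_scale1 hhom_scaleDr hhom_scaleDl.

Lemma hhomD f g x : (f + g) x = f x + g x. Proof. by []. Qed.
Lemma hhomN f x : (- f) x = - f x. Proof. by []. Qed.
Lemma hhomZ b f x :
  (b *: f) x = csum (fun u v => u *: f (antipode H v *: x)) b.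
Proof. by []. Qed.
End HhomModule.

Lemma hhom_algZ N Y (a : k) (f : hhom H N Y) x : (a%:A *: f) x = a%:A *: f x.
Proof.
rewrite hhomZ; have gL := hhom_scale_klinear2 f x.
have := klinearZ (csum_klinear H gL) a 1.
rewrite (csum1 H gL) antipode1 !scale1r => <-.
by rewrite regular_algZ.
Qed.

Lemma klinear_hhom M N Y (f : M -> hhom H N Y) :
  (forall x, klinear (fun m => f m x)) -> klinear f.
Proof.
by move=> fL a m m'; apply: hhomP => x; rewrite (fL x) hhomD hhom_algZ.
Qed.

Lemma klinear_eval M N Y (f : M -> hhom H N Y) x :
  klinear f -> klinear (fun m => f m x).
Proof. by move=> fL a m m'; rewrite fL hhomD hhom_algZ. Qed.

Lemma hhom_sumE N Y I (r : seq I) (F : I -> hhom H N Y) x :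
  (\sum_(i <- r) F i) x = \sum_(i <- r) F i x.
Proof. by elim/big_rec2: _ => [//|i f y _ <-]; rewrite hhomD. Qed.

Definition hhom_pre M N P (f : {linear M -> N}) (g : hhom H N P) :
  hhom H M P := @Hhom H M P _ (klinear_comp (hfun_klinear g) (klinear_linear f)).

Fact hhom_pre_linear M N P (f : {linear M -> N}) : linear (@hhom_pre M N P f).
Proof.
move=> a g g'; apply: hhomP => x; rewrite [RHS]hhomD; congr (_ + _).
by rewrite !hhomZ; apply: eq_csum => u v; rewrite /= linearZ.
Qed.
HB.instance Definition _ M N P (f : {linear M -> N}) :=
  GRing.isLinear.Build L (hhom H N P) (hhom H M P) _ (@hhom_pre M N P f)
    (@hhom_pre_linear M N P f).

Definition hhom_post M N P (f : {linear N -> P}) (g : hhom H M N) :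
  hhom H M P := @Hhom H M P _ (klinear_comp (klinear_linear f) (hfun_klinear g)).

Fact hhom_post_linear M N P (f : {linear N -> P}) : linear (@hhom_post M N P f).
Proof.
move=> a g g'; apply: hhomP => x; rewrite [RHS]hhomD.
rewrite -[LHS]/(f (_ + _)) linearD; congr (_ + _); rewrite !hhomZ linear_sum.
by apply: eq_bigr => uv _; rewrite /= linearZ.
Qed.
HB.instance Definition _ M N P (f : {linear N -> P}) :=
  GRing.isLinear.Build L (hhom H M N) (hhom H M P) _ (@hhom_post M N P f)
    (@hhom_post_linear M N P f).

(** ** The tensor-hom adjunction *)

Section Adjunction.
Hypothesis cocomH : cocommutative H.
Local Notation S := (antipode H).

(** In L (x) L the sum of the b_1 S(b_3) (x) b_2 is 1 (x) b.  Cocommutativity is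
    used to bring b_3 next to b_1. *)
Lemma csum_mul_antipode P (g : L -> L -> P) b : @klinear2 k L L^o L^o P g ->
  csum (fun u v => csum (fun p q => g (p * S v) q) u) b = g 1 b.
Proof.
move=> gL; have [gr gl] := gL.
rewrite (@csumA _ _ H P (fun p q v => g (p * S v) q)); last first.
  split=> [p q|p v|q v]; [| exact: gr | ].
    by apply: klinear_comp (gl q) _; klin.
  by apply: klinear_comp (gl q) _; klin.
transitivity (csum (fun p w => csum (fun q v => g (p * S q) v) w) b).
  apply: eq_csum => p w; rewrite csumC //; split=> [q|v]; last by apply: gr.
  by apply: klinear_comp (gl q) _; klin.
rewrite -(@csumA _ _ H P (fun p q v => g (p * S q) v)); last first.
  split=> [p q|p v|q v]; [exact: gr | | ].
    by apply: klinear_comp (gl v) _; klin.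
  by apply: klinear_comp (gl v) _; klin.
rewrite -[RHS](@csum_counitl _ _ H P (g 1)); last exact: gr.
apply: eq_csum => u v; have glv := gl v.
by rewrite -(klinearZ glv) regular_algZ -csum_antipoder (klinear_sum glv).
Qed.

(** In L (x) L the sum of the b_2 (x) S(b_3) b_1 is b (x) 1. *)
Lemma csum_antipode_mul P (g : L -> L -> P) b : @klinear2 k L L^o L^o P g ->
  csum (fun u v => csum (fun p q => g p (S q * u)) v) b = g b 1.
Proof.
move=> gL; have [gr gl] := gL.
rewrite -(@csumA _ _ H P (fun u p q => g p (S q * u))); last first.
  split=> [u p|u q|p q]; [| exact: gl | ].
    by apply: klinear_comp (gr p) _; klin.
  by apply: klinear_comp (gr p) _; klin.
transitivity (csum (fun w q => csum (fun u p => g u (S q * p)) w) b).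
  apply: eq_csum => w q; rewrite csumC //; split=> [u|p]; first by apply: gl.
  by apply: klinear_comp (gr p) _; klin.
rewrite (@csumA _ _ H P (fun u p q => g u (S q * p))); last first.
  split=> [u p|u q|p q]; [| | exact: gl].
    by apply: klinear_comp (gr u) _; klin.
  by apply: klinear_comp (gr u) _; klin.
rewrite -[RHS](@csum_counitr _ _ H P (g^~ 1)); last exact: gl.
apply: eq_csum => u w; have gru := gr u.
rewrite -(klinearZ gru) regular_algZ -csum_antipodel (klinear_sum gru).
rewrite -[LHS]/(csum _ _) csumC //; split=> *.
  by apply: klinear_comp gru _; klin.
by apply: klinear_comp gru _; klin.
Qed.

Section Curry.
Variables (X T Y : lmodType L).

Fact curry_klinear (F : {linear htensor H X T -> Y}) t :
  klinear (fun x => F (tp x t)).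
Proof. by apply: klinear_comp (klinear_linear F) _; apply: klinear_tpl. Qed.

Definition curry_fun (F : {linear htensor H X T -> Y}) (t : T) : hhom H X Y :=
  @Hhom H X Y _ (curry_klinear F t).

(** The value of b (F (- (x) t)) at x is the sum of the b_1 F (S(b_2) x (x) t),
    which the linearity of F turns into a sum of the shape that
    [csum_mul_antipode] evaluates. *)
Fact curry_linear (F : {linear htensor H X T -> Y}) : linear (curry_fun F).
Proof.
move=> a t t'; apply: hhomP => x; rewrite hhomD hhomZ /=.
rewrite (klinearD ((tp_klinear2 X T).1 x)) linearD; congr (_ + _).
have gL : @klinear2 k L L^o L^o Y (fun u v => F (tp (u *: x) (v *: t))).
  split=> *; apply: klinear_comp (klinear_linear F) _.
    by apply: klinear_tpr; klin.
  by apply: klinear_tpl; klin.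
have := csum_mul_antipode a gL; rewrite scale1r => <-.
apply: eq_csum => u v; rewrite -linearZ htensor_scale_tp linear_sum.
by apply: eq_bigr => pq _; rewrite /= scalerA.
Qed.

Definition curry (F : {linear htensor H X T -> Y}) : {linear T -> hhom H X Y} :=
  HB.pack (curry_fun F)
    (GRing.isLinear.Build L T (hhom H X Y) _ (curry_fun F) (@curry_linear F)).

(** Equivariance of the map x (x) t |-> G t x is [csum_antipode_mul]. *)
Lemma uncurry (G : {linear T -> hhom H X Y}) :
  exists F : {linear htensor H X T -> Y}, forall x t, F (tp x t) = G t x.
Proof.
apply: linear_lift => [|b x t].
  split=> [x a t t'|t]; last exact: hfun_klinear.
  by rewrite linearD hhomD linearZ hhom_algZ.
have gL : @klinear2 k L L^o L^o Y (fun p q => p *: G t (q *: x)).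
  split=> [p|q]; last by klin.
  by apply: klinear_scale; apply: klinear_comp (hfun_klinear _) _; klin.
have := csum_antipode_mul b gL; rewrite scale1r => <-.
apply: eq_csum => u v; rewrite linearZ hhomZ.
by apply: eq_csum => p q; rewrite scalerA.
Qed.
End Curry.
End Adjunction.
End TensorModules.

(** * Projective and injective modules *)

Section ProjectiveInjective.
Variables (k : fieldType) (L : falgType k) (H : hopf_algebra L).
Hypothesis cocomH : cocommutative H.
Implicit Types A B I M N P X Y : lmodType L.
Local Notation csum := (csum H).

Lemma trivial_algZ (a : k) (x : trivial_module H) : a%:A *: x = a * x :> k.
Proof.
rewrite -[LHS]/(counit H _ * x) linearZ /= counit1.
by rewrite -[_ *: 1]/(_ * 1) mulr1.
Qed.

Lemma klinear_trivial M (f : M -> trivial_module H) :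
  klinear f -> klinear ((fun x => (f x : k)%:A) : M -> L^o).
Proof.
move=> fL; apply: klinear_alg => a x y; apply: etrans (fL a x y) _.
by congr (_ + _); apply: trivial_algZ.
Qed.

Lemma trivial_invariant b (x : trivial_module H) :
  b *: x = (counit H b : k)%:A *: x.
Proof. by rewrite trivial_algZ. Qed.

Lemma klinear_counit : klinear ((fun a => (counit H a : k)%:A) : L^o -> L^o).
Proof.
apply: klinear_alg => c u v.
by rewrite -[c *: u]/(c%:A *: (u : L^o)) regular_algZ linearP.
Qed.

Lemma tensor_comm M N : exists2 s : {linear htensor H M N -> htensor H N M},
  (forall m n, s (tp H m n) = tp H n m) &
  exists t : {linear htensor H N M -> htensor H M N}, cancel s t /\ cancel t s.
Proof.
have swap A B : exists s : {linear htensor H A B -> htensor H B A},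
    forall m n, s (tp H m n) = tp H n m.
  apply: linear_lift => [|b m n].
    split=> [m|n]; first by apply: klinear_tpl; klin.
    by apply: klinear_tpr; klin.
  rewrite htensor_scale_tp csumC //; split=> *.
    by apply: klinear_tpl; klin.
  by apply: klinear_tpr; klin.
have [s sE] := swap M N; have [t tE] := swap N M; exists s => //; exists t.
split; first by apply: (@linear_ext_tp _ _ H _ _ _ (t \o s) idfun) => m n /=;
  rewrite sE tE.
by apply: (@linear_ext_tp _ _ H _ _ _ (s \o t) idfun) => m n /=; rewrite tE sE.
Qed.

Lemma klinear_section A B (p : {linear A -> B}) :
  (forall b, exists a, p a = b) -> exists2 t : B -> A, klinear t & cancel t p.
Proof.
move=> p_surj; have [t tL tE] := klinear_pseudoinverse (klinear_linear p).
by exists t => // b; have [a <-] := p_surj b.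
Qed.

Lemma htensor_map_inj N A B (i : {linear A -> B}) :
  injective i -> injective (htensor_map H (linear_id N) i).
Proof.
move=> /(klinear_retraction (klinear_linear i))[r rL iK].
have [h hL hE] := klinear_map H (@klinear_id k L N) rL.
apply: (can_inj (g := h)).
apply: (@klinear_ext_tp _ _ H _ _ _ (fun x => h (htensor_map H (linear_id N) i x)) (fun x => x)) => [||m n].
- by apply: klinear_comp hL (klinear_linear _).
- exact: klinear_id.
by rewrite htensor_map_tp hE iK.
Qed.

(** Maps A -> Hom_k(N, I) are maps N (x) A -> I, and N (x) - preserves
    injections because k is a field. *)
Lemma hhom_injective N I : injective_module I -> injective_module (hhom H N I).
Proof.
move=> injI A B i f /(@htensor_map_inj N _ _ i)/injI extI.
have [F FE] := uncurry cocomH f; have [G GE] := extI F.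
exists (curry cocomH G) => a; apply: hhomP => x.
by rewrite -FE -GE /= htensor_map_tp.
Qed.

(** Maps N (x) P -> A are maps P -> Hom_k(N, A), and Hom_k(N, -) preserves
    surjections because k is a field. *)
Lemma tensor_projective N P : projective_module P -> projective_module (htensor H N P).
Proof.
move=> projP A B p f p_surj; have [t tL tE] := klinear_section p_surj.
have [|g gE] := projP _ _ (@hhom_post k L H N A B p) (curry cocomH f).
  move=> h; exists (@Hhom k L H N A _ (klinear_comp tL (hfun_klinear h))).
  by apply: hhomP => x; apply: tE.
have [G GE] := uncurry cocomH g; exists G.
apply: (linear_ext_tp (f := p \o G)) => n x.
by rewrite /= GE; have /(congr1 (fun h : hhom H N B => h n)) := gE x.
Qed.

(** Maps A -> Hom_k(P, N) are maps P -> Hom_k(A, N), which can be lifted along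
    the surjection from Hom_k(B, N) when A is a submodule of B. *)
Lemma hhom_projective_injective P N :
  projective_module P -> injective_module (hhom H P N).
Proof.
move=> projP A B i f i_inj.
have [r rL iK] := klinear_retraction (klinear_linear i) i_inj.
have [F FE] := uncurry cocomH f; have [s sE _] := tensor_comm A P.
have [|g gE] := projP _ _ (@hhom_pre k L H A B N i) (curry cocomH (linear_comp F s)).
  move=> h; exists (@Hhom k L H B N _ (klinear_comp (hfun_klinear h) rL)).
  by apply: hhomP => x /=; rewrite iK.
have [G GE] := uncurry cocomH g; have [t tE _] := tensor_comm P B.
exists (curry cocomH (linear_comp G t)) => a; apply: hhomP => x.
rewrite /= tE GE -FE; have /(congr1 (fun h : hhom H A N => h a)) /= -> := gE x.
by rewrite sE.
Qed.

Lemma regular_projective : projective_module L^o.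
Proof.
move=> A B p f p_surj; have [x xE] := p_surj (f 1).
have gL : linear (fun a : L^o => a *: x).
  by move=> a u v; rewrite scalerDl scalerA.
pose l := GRing.isLinear.Build L L^o A _ (fun a : L^o => a *: x) gL.
pose g : {linear L^o -> A} := HB.pack (fun a : L^o => a *: x) l.
exists g => a; rewrite -[g a]/(a *: x) linearZ xE -linearZ /=.
by rewrite -[a *: 1]/(a * 1) mulr1.
Qed.

Lemma finite_coordinates : exists (n : nat) (e : 'I_n -> L)
  (c : 'I_n -> L -> k), (forall i a x y, c i (a *: x + y) = a * c i x + c i y) /\
  forall a, a = \sum_i c i a *: e i.
Proof.
exists (\dim {:L}), (fun i => (vbasis {:L})`_i), (fun i => coord (vbasis {:L}) i).
by split=> [i a x y|a]; [rewrite linearP | apply: coord_vbasis; rewrite memvf].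
Qed.

(** The map n (x) f |-> (a |-> n (x) f a) is bijective: its inverse is a finite sum
    over a basis of L. *)
Lemma tensor_hhom N I : exists K : {linear htensor H N (hhom H L^o I) -> hhom H L^o (htensor H N I)},
  injective K /\ forall g, exists z, K z = g.
Proof.
have KL (n : N) (f : hhom H L^o I) : klinear (fun a : L^o => tp H n (f a)).
  by apply: klinear_tpr; apply: hfun_klinear.
have [|b n f|K KE] := @linear_lift _ _ H N (hhom H L^o I) (hhom H L^o (htensor H N I))
    (fun n f => @Hhom k L H L^o (htensor H N I) _ (KL n f)).
- split=> [n|f]; apply: klinear_hhom => a.
    by apply: klinear_tpr; apply: klinear_eval; apply: klinear_id.
  by apply: klinear_tpl; klin.
- apply: hhomP => a; rewrite hhomZ /csum hhom_sumE -/(csum _ _) /=.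
  transitivity (csum (fun u v => csum (fun p q =>
      tp H (u *: n) (p *: f (antipode H q *: a))) v) b).
    apply: eq_bigr => uv _; rewrite -[LHS]/(tp H _ ((uv.2 *: f) a)) hhomZ.
    by rewrite (klinear_sum ((tp_klinear2 H N I).1 _)).
  rewrite -(@csumA _ _ H _ (fun u p q => tp H (u *: n)
    (p *: f (antipode H q *: a)))); last first.
    split=> [u p|u q|p q]; [|by apply: klinear_tpr; klin|by apply: klinear_tpl; klin].
    by apply: klinear_tpr; apply: klinear_scale;
      apply: klinear_comp (hfun_klinear f) _; klin.
  by apply: eq_bigr => wq _; rewrite htensor_scale_tp.
have [m [e [c [cL eE]]]] := finite_coordinates.
have dL i (x : I) : klinear (fun a : L^o => (c i a)%:A *: x).
  apply: klinear_scalel; apply: klinear_alg => a u v.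
  by rewrite -[a *: u]/(a%:A *: (u : L^o)) regular_algZ cL.
(* d i x is the map of rank one a |-> c_i(a) x *)
pose d i x : hhom H L^o I := @Hhom k L H L^o I _ (dL i x).
have /choice[h hP] i : exists h : htensor H N I -> htensor H N (hhom H L^o I),
    klinear h /\ forall n x, h (tp H n x) = tp H n (d i x).
  have [|h] := klinear_map H (@klinear_id k L N) (_ : klinear (d i)).
    by apply: klinear_hhom => a; klin.
  by exists h.
have sumE (f : hhom H L^o I) a : f a = \sum_i (c i a)%:A *: f (e i).
  rewrite {1}(eE a) (klinear_sum (hfun_klinear f)); apply: eq_bigr => i _.
  by rewrite -(klinearZ (hfun_klinear f)) regular_algZ.
have sumE' (f : hhom H L^o (htensor H N I)) a :
    f a = \sum_i (c i a)%:A *: f (e i).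
  rewrite {1}(eE a) (klinear_sum (hfun_klinear f)); apply: eq_bigr => i _.
  by rewrite -(klinearZ (hfun_klinear f)) regular_algZ.
have KK z : \sum_i h i (K z (e i)) = z.
  move: z; apply: (@klinear_ext_tp _ _ H _ _ _ (fun z => \sum_i h i (K z (e i)))
    (fun z => z)) => [||n f]; [|exact: klinear_id|].
    apply: klinear_big => i; apply: klinear_comp (hP i).1 _.
    by apply: klinear_eval; apply: klinear_linear.
  under eq_bigr => i _ do rewrite KE (hP i).2.
  rewrite -(klinear_sum ((tp_klinear2 H N (hhom H L^o I)).1 n)); congr tp.
  by apply: hhomP => a; rewrite hhom_sumE [RHS]sumE.
exists K; split=> [z z' zz'|g]; first by rewrite -[z]KK zz' KK.
exists (\sum_i h i (g (e i))); apply: hhomP => a.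
rewrite linear_sum hhom_sumE [RHS]sumE'; apply: eq_bigr => i _.
move: (g (e i)); apply: (@klinear_ext_tp _ _ H _ _ _ (fun y => K (h i y) a)
  (fun y => (c i a)%:A *: y)) => [||n x]; [| by klin |].
  apply: klinear_eval; apply: klinear_comp (klinear_linear K) (hP i).1.
by rewrite (hP i).2 KE /= (klinearZ ((tp_klinear2 H N I).1 n)).
Qed.

Lemma tensor_injective_of_retract N I (J : lmodType L)
    (i : {linear I -> J}) (r : {linear J -> I}) :
  cancel i r -> injective_module (htensor H N J) ->
  injective_module (htensor H N I).
Proof.
move=> iK; apply: (retract_injective (i := htensor_map H (linear_id N) i)
  (r := htensor_map H (linear_id N) r)).
by apply: (linear_ext_tp (f := htensor_map H (linear_id N) r \o
  htensor_map H (linear_id N) i) (g := idfun)) => n x /=;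
  rewrite !htensor_map_tp iK.
Qed.

Lemma counit_action M : exists p : {linear htensor H L^o M -> M},
  forall a m, p (tp H a m) = (counit H a : k)%:A *: m.
Proof.
apply: linear_lift => [|b a m]; last rewrite scaler_algC.
  split=> [a|m]; first by klin.
  exact/klinear_scalel/klinear_counit.
have <- : csum (fun u v => (counit H u : k)%:A *: (v *: m)) b = b *: m.
  by apply: (@csum_counitl _ _ H M (fun b => b *: m)); klin.
rewrite -csum_scaler; apply: eq_bigr => uv _.
rewrite -[uv.1 *: _]/(uv.1 * a) counitM mulrC.
by rewrite [RHS]scalerA -scalerAl mul1r; congr (_ *: _); rewrite scalerA.
Qed.

(** I is a retract of Hom_k(L, I), and tensoring commutes with Hom_k(L, -)
    because L has finite dimension. *)
Lemma tensor_injective N I :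
  injective_module I -> injective_module (htensor H N I).
Proof.
move=> injI; have [p pE] := counit_action I.
have [|r rK] := injI _ _ (curry cocomH p) (linear_id I).
  move=> x y /(congr1 (fun h : hhom H L^o I => h 1)).
  by rewrite /= !pE counit1 !scale1r.
apply: (tensor_injective_of_retract (i := curry cocomH p) (r := r)) => //.
have [K [K_inj K_surj]] := tensor_hhom N I.
have [K' KK' _] := linear_inverse K_inj K_surj.
apply: retract_injective KK' _.
exact/hhom_projective_injective/regular_projective.
Qed.

Lemma tensor_projectivel N P :
  projective_module P -> projective_module (htensor H P N).
Proof.
move=> projP; have [s _ [t [sK _]]] := tensor_comm P N.
apply: (retract_projective (i := s) (r := t)) => //; exact: tensor_projective.
Qed.

Lemma tensor_injectivel N I :
  injective_module I -> injective_module (htensor H I N).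
Proof.
move=> injI; have [s _ [t [sK _]]] := tensor_comm I N.
apply: (retract_injective (i := s) (r := t)) => //; exact: tensor_injective.
Qed.

Fact counit_linear : linear (fun a : L^o => counit H a : trivial_module H).
Proof.
move=> a u v; rewrite -[_ *: u]/(a * u) linearD -[_ *: _]/(counit H a * _).
by rewrite [in LHS]counitM.
Qed.
Definition counit_map : {linear L^o -> trivial_module H} :=
  HB.pack (fun a : L^o => counit H a : trivial_module H)
    (GRing.isLinear.Build L L^o (trivial_module H) _ _ counit_linear).

(** The projection onto the augmentation ideal along the line through 1. *)
Lemma augmentation_projection : exists2 pi : L^o -> ker_of counit_map,
  klinear pi & (forall a, ker_in _ (pi a) = a - (counit H a)%:A) /\
               (forall z, pi (ker_in _ z) = z).
Proof.
have /choice[pi piE] (a : L^o) : exists z : ker_of counit_map,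
    ker_in _ z = a - (counit H a)%:A.
  apply/ker_inP.
  rewrite -[LHS]/(counit H (a - (counit H a)%:A)) linearB linearZ /= counit1.
  by rewrite -[_ *: 1]/(_ * 1) mulr1 subrr.
exists pi; last first.
  split=> // z; apply: ker_in_inj; rewrite piE.
  have /eqP : counit_map (ker_in _ z) = 0 by apply/ker_inP; exists z.
  by rewrite -[counit_map _]/(counit H _) => /eqP ->; rewrite scale0r subr0.
move=> c u v; apply: ker_in_inj; rewrite linearP !piE klinear_counit opprD addrACA.
by rewrite -scalerBr.
Qed.

(** The kernel of the surjection L (x) M -> M, which sends a (x) m to
    epsilon(a) m, is injective because it is Ker(epsilon) (x) M; so M is a
    direct summand of the projective module L (x) M. *)
Lemma injective_projective M : injective_module M -> projective_module M.
Proof.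
move=> injM; have [p pE] := counit_action M.
have [pi piL [piE piK]] := augmentation_projection.
pose i := htensor_map H (ker_in counit_map) (linear_id M).
have [h hL hE] := klinear_map H piL (@klinear_id k L M).
have hK : cancel i h.
  apply: (@klinear_ext_tp _ _ H _ _ _ (fun z => h (i z)) (fun z => z));
    [exact: klinear_comp hL (klinear_linear _) | exact: klinear_id|] => z m.
  by rewrite /i /= htensor_map_tp hE piK.
(* the projection h along 1 (x) M identifies Ker p with the image of i *)
have ihE e : i (h e) = e - tp H 1 (p e).
  move: e; apply: (@klinear_ext_tp _ _ H _ _ _ (fun e => i (h e))
      (fun e => e - tp H (1 : L^o) (p e))); [exact: klinear_comp (klinear_linear _) hL | |].
    apply: klinear_add; first exact: klinear_id.
    by apply: klinear_opp; apply: klinear_tpr; apply: klinear_linear.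
  move=> a m; rewrite hE /i /= htensor_map_tp piE pE.
  rewrite (klinearB ((tp_klinear2 H L^o M).2 m)); congr (_ - _).
  by rewrite (klinearZ ((tp_klinear2 H L^o M).1 _)) -(klinearZ ((tp_klinear2 H L^o M).2 _)) regular_algZ.
have [|e||s sK] := @injective_kernel_section L _ _ _ i p (can_inj hK).
- by move=> m; exists (tp H 1 m); rewrite pE counit1 !scale1r.
- split=> [pe|[z <-]]; first by exists (h e); have := ihE e;
    rewrite pe (klinear0 ((tp_klinear2 H L^o M).1 _)) subr0.
  apply: (@linear_ext_tp _ _ H _ _ _ (p \o i) \0) => a m /=.
  rewrite htensor_map_tp pE.
  have : counit_map (ker_in _ a) = 0 by apply/ker_inP; exists a.
  by rewrite -[counit_map _]/(counit H _) => ->; rewrite !scale0r.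
- exact: tensor_injective.
apply: (retract_projective (i := s) (r := p)) => //.
exact/tensor_projectivel/regular_projective.
Qed.

(** Dually, with J = Hom_k(L, k) and Q = Hom_k(Ker(epsilon), k), the module P is
    the kernel of J (x) P -> Q (x) P, and Q (x) P is projective. *)
Lemma projective_injective P : projective_module P -> injective_module P.
Proof.
move=> projP; pose E : lmodType L := trivial_module H.
pose J : lmodType L := hhom H L^o E.
pose Q : lmodType L := hhom H (ker_of counit_map) E.
have [pi piL [piE piK]] := augmentation_projection.
have [c cE] := counit_action E.
(* the counit, as an element of J on which L acts through the counit *)
pose e0 : J := curry cocomH c (1 : k).
have e0E a : e0 a = counit H a :> k.
  rewrite /e0 /= cE -[LHS]/(counit H _ * _) mulr1 linearZ /= counit1.
  exact: mulr1.
have e0Z u : u *: e0 = (counit H u : k)%:A *: e0.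
  by rewrite /e0 -!linearZ -trivial_invariant.
have tJ := tp_klinear2 H J P; have tQ := tp_klinear2 H Q P.
have iL b (x : P) : tp H e0 (b *: x) = b *: tp H e0 x.
  rewrite htensor_scale_tp.
  rewrite -(@csum_counitl _ _ H _ (fun b => tp H e0 (b *: x))); last first.
    by apply: klinear_tpr; klin.
  by apply: eq_bigr => uv _; rewrite e0Z (klinearZ (tJ.2 _)).
have [x|x z z' -> -> //|b x x' z z' -> ->|i iE] :=
    @linear_choice L P (htensor H J P) (fun x z => z = tp H e0 x).
- by exists (tp H e0 x).
- by rewrite (klinearD (tJ.1 e0)) iL.
pose res := @hhom_pre k L H _ _ E (ker_in counit_map).
pose q := htensor_map H res (linear_id P).
pose ext (f : Q) : J := @Hhom k L H _ _ _ (klinear_comp (hfun_klinear f) piL).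
have extL : klinear ext.
  apply: klinear_hhom => a.
  exact: (@klinear_eval _ _ H _ _ _ (fun f : Q => f) (pi a) (@klinear_id k L Q)).
have [h hL hE] := klinear_map H extL (@klinear_id k L P).
have hK : cancel h q.
  apply: (@klinear_ext_tp _ _ H _ _ _ (fun z => q (h z)) (fun z => z));
    [exact: klinear_comp (klinear_linear _) hL | exact: klinear_id|] => f x.
  rewrite hE /q /= htensor_map_tp; congr tp; apply: hhomP => z.
  by rewrite /= piK.
have [v vL vE] : exists2 v : htensor H J P -> P, klinear v &
    forall f x, v (tp H f x) = (f 1 : k)%:A *: x.
  apply: klinear_lift; split=> [f|x]; first by klin.
  apply: klinear_scalel; apply: klinear_trivial.
  exact: (@klinear_eval _ _ H _ _ _ (fun f : J => f) 1 (@klinear_id k L J)).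
(* f - f pi = f(1) e0 for f in J, where pi projects along the line through 1 *)
have ivE z : i (v z) = z - h (q z).
  move: z; apply: (@klinear_ext_tp _ _ H _ _ _ (fun z => i (v z))
      (fun z => z - h (q z))).
  - exact: klinear_comp (klinear_linear i) vL.
  - apply: klinear_add; first exact: klinear_id.
    by apply: klinear_opp; apply: klinear_comp hL (klinear_linear _).
  move=> f x; rewrite vE iE /q /= htensor_map_tp hE.
  rewrite (klinearZ (tJ.1 e0)) -(klinearZ (tJ.2 x)).
  rewrite -(klinearB (tJ.2 x)); congr tp; apply: hhomP => a.
  rewrite hhom_algZ hhomD hhomN -[ext _ a]/(f (ker_in _ (pi a))) piE (klinearB (hfun_klinear f)) opprB.
  rewrite addrC subrK trivial_algZ e0E.
  have -> : (counit H a)%:A = (counit H a)%:A *: (1 : L^o).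
    by rewrite regular_algZ.
  by rewrite (klinearZ (hfun_klinear f)) trivial_algZ mulrC.
have vi x : v (i x) = x by rewrite iE vE e0E counit1 !scale1r.
have [z|z||r rK] := @projective_quotient_retraction L _ _ _ i q (can_inj vi).
- by exists (h z); apply: hK.
- split=> [qz|[x <-]].
    by exists (v z); rewrite ivE (_ : q z = 0) ?(klinear0 hL) ?subr0.
  rewrite iE; apply: etrans (htensor_map_tp H res (linear_id P) e0 x) _.
  rewrite -[RHS](klinear0 (tQ.2 x)); congr tp.
  apply: hhomP => a; rewrite -[LHS]/(e0 (ker_in _ a)) e0E.
  have : counit_map (ker_in _ a) = 0 by apply/ker_inP; exists a.
  by rewrite -[counit_map _]/(counit H _) => ->.
- exact: tensor_projective.
apply: (retract_injective (i := i) (r := r)) => //; apply: tensor_injectivel.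
exact/hhom_projective_injective/regular_projective.
Qed.

(** Direct sums preserve projectives, and these are the injectives. *)
Lemma dsum_injective (J : choiceType) (M : J -> lmodType L) :
  (forall j, injective_module (M j)) -> injective_module (dsum M).
Proof.
move=> injM; apply: projective_injective => A B p f p_surj.
have gE j : exists g : {linear M j -> A},
    forall m, p (g m) = f (dsum_in m).
  exact: (injective_projective (injM j) (f \o @dsum_in _ _ M j) p_surj).
exists (dsum_lift (fun j => sval (cid (gE j)))); elim/dsum_ind => [|x y IHx IHy|j m].
- by rewrite !linear0.
- by rewrite !linearD IHx IHy.
- by rewrite /= dsum_lift_in (svalP (cid (gE j))).
Qed.
End ProjectiveInjective.

(** * Null-homotopic maps *)

Section IntChoice.
Variables (D : int -> Type) (R : forall n, D n -> D (n + 1) -> Prop).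

Definition icast n n' (e : n = n') (x : D n) : D n' := ecast i (D i) e x.

Lemma icast_id n (e : n = n) x : icast e x = x.
Proof. by rewrite (eq_irrelevance e erefl). Qed.

Lemma icast_trans n n' n'' (e : n = n') (e' : n' = n'') x :
  icast e' (icast e x) = icast (etrans e e') x.
Proof. by case: n'' / e'; case: n' / e. Qed.

Lemma icast_rel n n' (e : n = n') (e' : n + 1 = n' + 1) x y :
  R x y -> R (icast e x) (icast e' y).
Proof. by move: e'; case: n' / e => e'; rewrite !icast_id. Qed.

(** Dependent choice in both directions from a starting point: this builds the
    homotopies between unbounded complexes degree by degree. *)
Lemma int_dependent_choice m (x0 : D m) :
  (forall n (x : D n), m <= n -> exists y, R x y) ->
  (forall n (y : D (n + 1)), n < m -> exists x, R x y) ->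
  exists d : forall n, D n, forall n, R (d n) (d (n + 1)).
Proof.
move=> up down.
have e0 : m = m + 0%:Z by rewrite addr0.
have f0 : m = m - 0%:Z by rewrite subr0.
have eS (j : nat) : m + j%:Z + 1 = m + j.+1%:Z by lia.
have fS (j : nat) : m - j%:Z = m - j.+1%:Z + 1 by lia.
have upE (j : nat) (x : D (m + j%:Z)) : exists y, R x y by apply: up; lia.
have downE (j : nat) (x : D (m - j%:Z)) :
    exists y : D (m - j.+1%:Z), R y (icast (fS j) x) by apply: down; lia.
pose rt := nat_rect (fun j : nat => D (m + j%:Z)) (icast e0 x0)
  (fun j x => icast (eS j) (sval (cid (upE j x)))).
pose lf := nat_rect (fun j : nat => D (m - j%:Z)) (icast f0 x0)
  (fun j x => sval (cid (downE j x))).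
have rtR j n (e : m + j%:Z = n) (e' : m + j.+1%:Z = n + 1) :
    R (icast e (rt j)) (icast e' (rt j.+1)).
  have Rrt := svalP (cid (upE j (rt j))); rewrite /= icast_trans.
  exact: (icast_rel e (etrans (eS j) e') Rrt).
have lfR j n (e : m - j.+1%:Z = n) (e' : m - j%:Z = n + 1) :
    R (icast e (lf j.+1)) (icast e' (lf j)).
  have Rlf : R (lf j.+1) (icast (fS j) (lf j)) := svalP (cid (downE j (lf j))).
  have := icast_rel e (etrans (esym (fS j)) e') Rlf; rewrite icast_trans.
  by rewrite (eq_irrelevance (etrans _ _) e').
have eR n : m <= n -> m + `|n - m|%N%:Z = n by lia.
have eL n : ~~ (m <= n) -> m - `|m - n|%N%:Z = n by lia.
have dec n : {m <= n} + {~~ (m <= n)} by case: (boolP (m <= n)) => h; [left | right].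
pose d n : D n := match dec n with
  | left h => icast (eR n h) (rt _)
  | right h => icast (eL n h) (lf _)
  end.
have dR j n (e : m + j%:Z = n) : d n = icast e (rt j).
  case: n / e; rewrite /d; case: (dec _) => h; last by lia.
  move: (eR _ h); have -> : absz (m + j%:Z - m)%R = j by lia.
  by move=> e; congr icast; apply: eq_irrelevance.
have dL j n (e : m - j%:Z = n) : d n = icast e (lf j).
  case: n / e; rewrite /d; case: (dec _) => h.
    have j0 : j = 0%N by lia.
    subst j; move: (eR _ h); have -> : absz (m - 0%:Z - m)%R = 0%N by lia.
    by move=> e; rewrite /= !icast_trans; congr icast; apply: eq_irrelevance.
  move: (eL _ h); have -> : absz (m - (m - j%:Z))%R = j by lia.
  by move=> e; congr icast; apply: eq_irrelevance.
exists d => n; have [mn|nm] := boolP (m <= n).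
  have e : m + `|n - m|%N%:Z = n by lia.
  have e' : m + `|n - m|%N.+1%:Z = n + 1 by lia.
  by rewrite (dR _ _ e) (dR _ _ e'); apply: rtR.
have [j e] : exists j : nat, m - j.+1%:Z = n.
  by exists `|m - n|%N.-1; lia.
have e' : m - j%:Z = n + 1 by lia.
by rewrite (dL _ _ e) (dL _ _ e'); apply: lfR.
Qed.
End IntChoice.

Section SuccFamily.
Variables (P : int -> Type) (G : forall n, P (n + 1)).

Lemma succ_family : exists g : forall n, P n, forall n, g (n + 1) = G n.
Proof.
exists (fun n => ecast i (P i) (subrK 1 n) (G (n - 1))) => n.
move: (subrK _ _) => /=; have: n + 1 - 1 = n by rewrite addrK.
by move: (n + 1 - 1) => n' E; case: n / E => e; rewrite (eq_irrelevance e erefl).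
Qed.
End SuccFamily.

Lemma int_succ_ind (P : int -> Prop) : (forall n, P (n + 1)) -> forall n, P n.
Proof. by move=> PS n; rewrite -[n](subrK 1). Qed.

Section Homotopy.
Variable R : pzRingType.
Implicit Types A B W X Y Z : complex R.

Definition nullhomotopic X Y (f : chain_map X Y) : Prop :=
  exists h : forall n : int, {linear X (n + 1) -> Y n},
  forall n x, f (n + 1) x = cd Y n (h n x) + h (n + 1) (cd X (n + 1) x).

Definition vanish X Y : Prop := forall f : chain_map X Y, nullhomotopic f.

Fact chain_sub_subproof X Y (f g : chain_map X Y) n x :
  (f (n + 1) \- g (n + 1)) (cd X n x) = cd Y n ((f n \- g n) x).
Proof. by rewrite /= !cmapd linearB. Qed.

Definition chain_sub X Y (f g : chain_map X Y) : chain_map X Y :=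
  @ChainMap R X Y (fun n => f n \- g n) (@chain_sub_subproof X Y f g).

Lemma homotopic_sub X Y (f g : chain_map X Y) :
  homotopic f g <-> nullhomotopic (chain_sub f g).
Proof. by []. Qed.

Lemma nullhomotopic_eq X Y (f g : chain_map X Y) :
  (forall n, f n =1 g n) -> nullhomotopic f -> nullhomotopic g.
Proof. by move=> fg [h hP]; exists h => n x; rewrite -fg hP. Qed.

Lemma nullhomotopic_comp X Y Z (f : chain_map Y Z) (g : chain_map X Y) :
  nullhomotopic f -> nullhomotopic (chain_comp f g).
Proof.
move=> [h hP]; exists (fun n => h n \o g (n + 1)) => n x.
by rewrite /= hP cmapd.
Qed.

Lemma nullhomotopic_homotopic X Y (f g : chain_map X Y) :
  homotopic f g -> nullhomotopic g -> nullhomotopic f.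
Proof.
move=> [h hP] [h' hP']; exists (fun n => h n \+ h' n) => n x /=.
by rewrite linearD addrACA -hP -hP' subrK.
Qed.

(** ** Null homotopies by recursion on the degree *)

Section Recursion.
Variables (X Y : complex R) (f : chain_map X Y).

(** The equation of a null homotopy in degree n + 1. *)
Definition htpy_at n (h0 : {linear X (n + 1) -> Y n})
    (h1 : {linear X (n + 1 + 1) -> Y (n + 1)}) : Prop :=
  forall x, f (n + 1) x = cd Y n (h0 x) + h1 (cd X (n + 1) x).

(** The equation in degree n + 1 involves two consecutive components, so the
    recursion runs on overlapping pairs of components. *)
Lemma nullhomotopic_rec m :
  (exists h0 h1, @htpy_at m h0 h1) ->
  (forall n h0 h1, m <= n -> @htpy_at n h0 h1 ->
     exists h2, @htpy_at (n + 1) h1 h2) ->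
  (forall n h1 h2, n < m -> @htpy_at (n + 1) h1 h2 ->
     exists h0, @htpy_at n h0 h1) ->
  nullhomotopic f.
Proof.
move=> [h0 [h1 hm]] up down.
pose D n := {h : {linear X (n + 1) -> Y n} *
  {linear X (n + 1 + 1) -> Y (n + 1)} | htpy_at h.1 h.2}.
pose rel n (x : D n) (y : D (n + 1)) := (sval x).2 = (sval y).1.
have [||d dP] := @int_dependent_choice D rel m (exist _ (h0, h1) hm).
- move=> n [[h h'] hP] mn; have [h2 h2P] := up n h h' mn hP.
  by exists (exist _ (h', h2) h2P).
- move=> n [[h h'] hP] mn; have [h2 h2P] := down n h h' mn hP.
  by exists (exist _ (h2, h) h2P).
exists (fun n => (sval (d n)).1) => n x.
by have := svalP (d n) x; rewrite dP.
Qed.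

(** The map f - d h1 vanishes on the boundaries, which are the kernel of d, so it
    factors through d. *)
Lemma htpy_up n h0 h1 : injective_module (Y (n + 1 + 1)) ->
  (forall x : X (n + 1 + 1), cd X _ x = 0 -> exists y, cd X (n + 1) y = x) ->
  @htpy_at n h0 h1 -> exists h2, @htpy_at (n + 1) h1 h2.
Proof.
move=> injY exX hP.
have [|h2 h2P] := injective_factor (d := cd X (n + 1 + 1))
  (f := f (n + 1 + 1) \- (cd Y (n + 1) \o h1)) injY.
  move=> x /exX[y <-] /=; rewrite cmapd.
  by rewrite hP linearD cdd add0r subrr.
by exists h2 => x; rewrite h2P /= [RHS]addrC subrK.
Qed.

(** The map f - h1 d takes its values in the cycles, which are the boundaries. *)
Lemma htpy_down n h1 h2 : projective_module (X (n + 1)) ->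
  (forall y : Y (n + 1), cd Y _ y = 0 -> exists z, cd Y n z = y) ->
  @htpy_at (n + 1) h1 h2 -> exists h0, @htpy_at n h0 h1.
Proof.
move=> projX exY hP.
have [|h0 h0P] := projective_factor (d := cd Y n)
  (f := f (n + 1) \- (h1 \o cd X (n + 1))) projX.
  move=> x; apply: exY; rewrite /= linearB -cmapd hP cdd linear0 addr0.
  exact: subrr.
by exists h0 => x; rewrite h0P /= subrK.
Qed.
End Recursion.

Lemma vanish_bounded_below X Y N : (forall n, n < N -> forall x : X n, x = 0) ->
  acyclic X -> termwise_injective Y -> vanish X Y.
Proof.
move=> X0 acX injY f; apply: (@nullhomotopic_rec _ _ f (N - 2)).
- exists \0, \0 => x; rewrite (X0 _ _ x) ?linear0 /= ?linear0 ?addr0 //; lia.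
- by move=> n h0 h1 _; apply: htpy_up; [apply: injY | apply: acX].
move=> n h1 h2 nN _; exists \0 => x.
rewrite (X0 _ _ x) ?linear0 ?addr0 //; lia.
Qed.

Lemma vanish_bounded_above X Y N : (forall n, N < n -> forall x : X n, x = 0) ->
  (forall n, projective_module (X n)) -> acyclic Y -> vanish X Y.
Proof.
move=> X0 projX acY f; apply: (@nullhomotopic_rec _ _ f N).
- exists \0, \0 => x; rewrite (X0 _ _ x) ?linear0 /= ?linear0 ?addr0 //; lia.
- move=> n h0 h1 nN _; exists \0 => x.
  rewrite (X0 _ _ x) ?linear0 ?addr0 //; lia.
by move=> n h1 h2 _; apply: htpy_down; [apply: projX | apply: acY].
Qed.
End Homotopy.

(** * Maps that become bijective on homotopy classes *)

(** Rewriting with commutativity in a homotopy equation would also match the sums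
    that are degrees, whence these cancellation rules. *)
Lemma add_oppr_eq0 (V : zmodType) (x y : V) : - x + y = 0 -> y = x.
Proof. by move/eqP; rewrite addrC subr_eq0 => /eqP. Qed.

Lemma addr_cancel_mid (V : zmodType) (x y z : V) : x + (y + z) - y = x + z.
Proof. by rewrite -addrA [y + z]addrC addrK. Qed.

Section Orthogonality.
Variable R : pzRingType.
Implicit Types A B C W X Y Z : complex R.
Implicit Types M N : lmodType R.

(** Bijectivity of Hom(f, Z) in the homotopy category, where equality of maps is
    the relation [homotopic].  The adjunctions amount to this property for their
    units. *)
Definition orth A B (f : chain_map A B) Z : Prop :=
  (forall g g' : chain_map B Z,
     homotopic (chain_comp g f) (chain_comp g' f) -> homotopic g g') /\
  (forall h : chain_map A Z, exists g, homotopic (chain_comp g f) h).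

Lemma homotopic_compl A B C (f f' : chain_map B C) (g : chain_map A B) :
  homotopic f f' -> homotopic (chain_comp f g) (chain_comp f' g).
Proof. by move=> ff'; apply: homotopic_comp => //; apply: homotopic_refl. Qed.

Lemma homotopic_compr A B C (f : chain_map B C) (g g' : chain_map A B) :
  homotopic g g' -> homotopic (chain_comp f g) (chain_comp f g').
Proof. by move=> gg'; apply: homotopic_comp => //; apply: homotopic_refl. Qed.

Lemma orth_homotopic A B (f f' : chain_map A B) Z :
  homotopic f f' -> orth f Z -> orth f' Z.
Proof.
move=> ff' [f_inj f_surj]; split=> [g g' gg'|h].
  apply: f_inj; apply: homotopic_trans (homotopic_compr g ff') _.
  apply: homotopic_trans gg' _; apply: homotopic_compr; exact: homotopic_sym.
have [g gh] := f_surj h; exists g; apply: homotopic_trans gh.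
by apply: homotopic_compr; apply: homotopic_sym.
Qed.

Lemma orth_comp A B C (g : chain_map B C) (f : chain_map A B) Z :
  orth f Z -> orth g Z -> orth (chain_comp g f) Z.
Proof.
move=> [f_inj f_surj] [g_inj g_surj]; split=> [u u' uu'|h].
  exact/g_inj/f_inj.
have [v vh] := f_surj h; have [u uv] := g_surj v; exists u.
exact: homotopic_trans (homotopic_compl f uv) vh.
Qed.

Lemma orth_cancell A B C (g : chain_map B C) (f : chain_map A B) Z :
  orth g Z -> orth (chain_comp g f) Z -> orth f Z.
Proof.
move=> [g_inj g_surj] [gf_inj gf_surj]; split=> [u u' uu'|h].
  have [v vu] := g_surj u; have [v' v'u'] := g_surj u'.
  apply: homotopic_trans (homotopic_sym vu) _.
  apply: (homotopic_trans _ v'u'); apply: homotopic_compl; apply: gf_inj.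
  apply: homotopic_trans (homotopic_compl f vu) _.
  apply: homotopic_trans uu' _.
  exact: homotopic_sym (homotopic_compl f v'u').
by have [v vh] := gf_surj h; exists (chain_comp v g).
Qed.

Lemma orth_iso A B (f : chain_map A B) Z :
  is_iso (f : @mor (homotopy_category R) A B) -> orth f Z.
Proof.
move=> [f' [f'f ff']]; split=> [u u' uu'|h].
  apply: homotopic_trans (homotopic_sym (comp_idr (u : @mor (homotopy_category R) _ _))) _.
  apply: homotopic_trans (comp_idr (u' : @mor (homotopy_category R) _ _)).
  apply: homotopic_trans (homotopic_compr u (homotopic_sym ff')) _.
  apply: homotopic_trans (homotopic_compr u' ff').
  exact: (homotopic_compl f' uu').
exists (chain_comp h f'); apply: homotopic_trans (homotopic_compr h f'f) _.
exact: (comp_idr (h : @mor (homotopy_category R) _ _)).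
Qed.

Lemma vanish_iso X X' Z (f : chain_map X X') :
  is_iso (f : @mor (homotopy_category R) X X') -> vanish X Z -> vanish X' Z.
Proof.
move=> [f' [f'f ff']] vanX g.
apply: (@nullhomotopic_homotopic _ _ _ _ (chain_comp (chain_comp g f) f')).
  apply: homotopic_sym; apply: homotopic_trans (homotopic_compr g ff') _.
  exact: eq_homotopic.
exact/nullhomotopic_comp/vanX.
Qed.

Lemma shift_homotopic X Y (f g : chain_map X Y) :
  homotopic f g -> homotopic (shift_map f) (shift_map g).
Proof.
move=> [h hP]; exists (fun n => \- h (n + 1)) => n x /=.
by rewrite hP !linearN !opprK.
Qed.

Lemma shift_iso X Y (f : chain_map X Y) :
  is_iso (f : @mor (homotopy_category R) X Y) ->
  is_iso (shift_map f : @mor (homotopy_category R) (shift X) (shift Y)).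
Proof.
move=> [g [/shift_homotopic gf /shift_homotopic fg]]; exists (shift_map g).
split; [apply: homotopic_trans (homotopic_trans gf _) |
        apply: homotopic_trans (homotopic_trans fg _)]; exact: eq_homotopic.
Qed.

Lemma shift_acyclic X : acyclic X -> acyclic (shift X).
Proof.
move=> acX n x /= /eqP; rewrite oppr_eq0 => /eqP/acX[y <-].
by exists (- y); rewrite /= linearN opprK.
Qed.

Lemma shift_injective X : termwise_injective X -> termwise_injective (shift X).
Proof. by move=> injX n; apply: injX. Qed.

(** ** Mapping cones *)

Section Cone.
Variables (A B : complex R) (f : chain_map A B).

Section Lift.
Variables (Z : complex R) (e : chain_map B Z).
Variable s : forall n : int, {linear A (n + 1) -> Z n}.
Hypothesis es : forall n (a : A (n + 1)),
  e (n + 1) (f (n + 1) a) = cd Z n (s n a) + s (n + 1) (cd A (n + 1) a).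

Definition cone_lift_component n : {linear cone f n -> Z n} :=
  (s n \o fst) \+ (e n \o snd).

Fact cone_lift_subproof n (z : cone f n) :
  cone_lift_component (n + 1) (cd (cone f) n z) =
  cd Z n (cone_lift_component n z).
Proof.
case: z => a b; rewrite /= !linearD linearN es cmapd.
by rewrite addrA; congr (_ + _); rewrite [LHS]addrC addrK.
Qed.

Definition cone_lift : chain_map (cone f) Z :=
  @ChainMap R (cone f) Z cone_lift_component cone_lift_subproof.
End Lift.

(** A map B -> Z with a null homotopy of its restriction to A extends to the cone,
    and a map A -> Z gives a map from the cone to the shift of Z; null homotopies
    of these two yield injectivity and surjectivity. *)
Lemma orth_of_cone Z : vanish (cone f) Z -> vanish (cone f) (shift Z) ->
  orth f Z.
Proof.
move=> vZ vSZ; split=> [g g' [s sP]|h].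
  apply/homotopic_sub.
  apply: nullhomotopic_eq (nullhomotopic_comp (cone_in f)
    (vZ (@cone_lift _ (chain_sub g g') s sP))) => n b.
  by rewrite /= linear0 add0r.
have [H HP] := vSZ (chain_comp (shift_map h) (cone_out f)).
(* the components of H have degrees n + 1, hence the reindexing *)
have [g gE] := @succ_family (fun n => {linear B n -> Z n})
  (fun n => H n \o cone_in f (n + 1)).
have [s sE] := @succ_family (fun n => {linear A (n + 1) -> Z n})
  (fun n => H n \o @pair_map _ _ _ _ (linear_id (A (n + 1 + 1))) \0).
have gP n b : g (n + 1) (cd B n b) = cd Z n (g n b).
  move: n b; apply: int_succ_ind => n b.
  have := HP n (0, b); rewrite !gE /= linear0 => /esym/add_oppr_eq0 <-.
  by congr (H _ _); apply: cone_in_subproof.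
exists (@ChainMap R B Z g gP), s; apply: int_succ_ind => n a.
have dE : cd (cone f) (n + 1) (a, 0) =
    cone_in f _ (f _ a) - (cd A _ a, 0) :> (_ * _)%type.
  by congr pair; rewrite /= ?linear0 ?subr0 ?addr0 ?sub0r.
have := HP n (a, 0); rewrite dE linearB /= => ->.
rewrite !gE !sE /= opprD opprK opprB [LHS]addrCA; congr (_ + _).
by rewrite [LHS]addrC subrK.
Qed.

(** A map from the cone that is null homotopic on B differs by a homotopy from a
    map that factors through the shift of A. *)
Lemma orth_cone_in Z : vanish A Z -> vanish (shift A) Z ->
  orth (cone_in f) Z.
Proof.
move=> vA vSA; split=> [g g' [s sP]|h]; last first.
  have [s sP] := vA (chain_comp h f); exists (@cone_lift _ h s sP).
  by apply: eq_homotopic => n b; rewrite /= linear0 add0r.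
pose e := chain_sub g g'.
have {}sP n b : e (n + 1) (0, b) = cd Z n (s n b) + s (n + 1) (cd B (n + 1) b).
  exact: sP.
pose inl n : {linear A (n + 1) -> cone f n} := @pair_map _ _ _ _ (linear_id _) \0.
pose psi n : {linear A (n + 1) -> Z n} := (e n \o inl n) \- (s n \o f (n + 1)).
have inE n a b : (a, b) = inl n a + (0, b) :> cone f n.
  by congr pair; rewrite /= ?addr0 ?add0r.
have psiP n a : psi (n + 1) (cd (shift A) n a) = cd Z n (psi n a).
  rewrite /psi -[LHS]/(e (n + 1) (inl _ (- cd A (n + 1) a)) -
    s (n + 1) (f _ (- cd A (n + 1) a))).
  rewrite -[RHS]/(cd Z n (e n (inl n a) - s n (f (n + 1) a))).
  rewrite linearB -cmapd.
  have -> : cd (cone f) n (inl n a) = inl _ (- cd A (n + 1) a) + (0, f _ a).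
    by congr pair; rewrite /= ?addr0 ?add0r ?linear0 ?addr0.
  rewrite [in RHS]linearD sP !linearN opprK cmapd.
  exact/esym/addr_cancel_mid.
have [t tP] := vSA (@ChainMap R (shift A) Z psi psiP).
apply/homotopic_sub; rewrite -/e.
exists (fun n => (t n \o fst) \+ (s n \o snd)) => n [a b].
rewrite inE linearD sP.
have := tP n a; rewrite -[LHS]/(e (n + 1) (inl _ a) - s (n + 1) (f _ a)).
move=> /eqP; rewrite subr_eq => /eqP ->.
rewrite -inE -[RHS]/(cd Z n (t n a + s n b) +
  (t (n + 1) (cd (shift A) (n + 1) a) + s (n + 1) (f _ a + cd B _ b))).
by rewrite !linearD [LHS](AC (3*2) ((1*4)*(2*(3*5)))).
Qed.
End Cone.

Lemma quasi_isomorphism_comp X Y Z (g : chain_map Y Z) (f : chain_map X Y) :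
  quasi_isomorphism f -> quasi_isomorphism g ->
  quasi_isomorphism (chain_comp g f).
Proof.
move=> qf qg n; have [f_inj f_surj] := qf n; have [g_inj g_surj] := qg n.
split=> [x dx gfx|z dz].
  apply: f_inj => //; apply: g_inj => //.
  by rewrite -cmapd dx linear0.
have [y [z' [dy ->]]] := g_surj z dz; have [x [y' [dx ->]]] := f_surj y dy.
exists x, (g n y' + z'); split=> //.
by rewrite /= !linearD cmapd addrA.
Qed.

(** The long exact cohomology sequence of the cone. *)
Lemma cone_acyclic X Y (f : chain_map X Y) :
  quasi_isomorphism f -> acyclic (cone f).
Proof.
move=> qf n [x y] [/eqP + dxy]; rewrite oppr_eq0 => /eqP dx.
have [|x' x'E] := (qf (n + 1)).1 x dx.
  by exists (- y); rewrite linearN; apply/eqP; rewrite eq_sym -addr_eq0 dxy.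
have [|x2 [y' [dx2 yE]]] := (qf n).2 (f _ x' + y).
  by rewrite linearD -cmapd x'E.
exists (x2 - x', y'); congr pair; rewrite /=.
  by rewrite linearB dx2 sub0r opprK x'E.
by rewrite linearB addrAC -yE addrC addKr.
Qed.

(** * Complexes concentrated in degree zero *)

Lemma can_eq0 (M : lmodType R) n (x : can_obj M n) : n != 0 -> x = 0.
Proof. by case: n x => [[|n]|n] //= x _; apply/matrixP => i []. Qed.

Section Cycles.
Variable Y : complex R.

Definition cycle_component n : {linear can_obj (Z0_module Y) n -> Y n} :=
  match n with
  | Posz 0 => (val : {linear Z0_module Y -> Y 0})
  | _ => \0
  end.

Fact cycle_subproof n (x : can_complex (Z0_module Y) n) :
  cycle_component (n + 1) (cd (can_complex (Z0_module Y)) n x) =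
  cd Y n (cycle_component n x).
Proof.
rewrite linear0; case: n x => [[|n]|n] x /=; rewrite ?linear0 //.
exact/esym/Z0P.
Qed.

Definition cycle_in : chain_map (can_complex (Z0_module Y)) Y :=
  @ChainMap R (can_complex (Z0_module Y)) Y cycle_component cycle_subproof.
End Cycles.

Section CanCycle.
Variable M : lmodType R.

Fact can_cycle_subproof (m : M) : m \in @cycle_pred R (can_complex M).
Proof. by rewrite inE /=. Qed.

Definition can_cycle (m : M) : Z0_obj (can_complex M) :=
  Sub (m : can_complex M 0) (can_cycle_subproof m).

Fact can_cycle_linear : linear can_cycle.
Proof. by move=> a x y; apply: val_inj. Qed.
HB.instance Definition _ := GRing.isLinear.Build R M (Z0_obj (can_complex M)) _
  can_cycle can_cycle_linear.

Definition can_cycle_map : {linear M -> Z0_module (can_complex M)} := can_cycle.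

Definition cycle_of Y (a : chain_map (can_complex M) Y) :
  {linear M -> Z0_module Y} := linear_comp (Z0_linear a) can_cycle_map.
End CanCycle.

Lemma cycle_ofE M Y (a : chain_map (can_complex M) Y) m :
  val (cycle_of a m) = a 0 m.
Proof. by []. Qed.

Lemma cycle_of_in M Y (u : {linear M -> Z0_module Y}) :
  cycle_of (chain_comp (cycle_in Y) (can_map u)) =1 u.
Proof. by move=> m; apply: val_inj. Qed.

Lemma cycle_of_homotopic M Y (a b : chain_map (can_complex M) Y) :
  termwise_injective Y -> homotopic a b ->
  stably_equal (cycle_of a) (cycle_of b).
Proof.
move=> injY /(Z0_heq injY) ab; apply: stably_equal_comp ab _.
exact: stably_equal_heq.
Qed.

Section SelfInjective.
Hypothesis injproj : forall M : lmodType R, injective_module M -> projective_module M.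

(** A map M -> Z^0 Y that factors through an injective, hence projective,
    module lifts to Y^(-1). *)
Lemma homotopic_of_cycle M Y (a b : chain_map (can_complex M) Y) :
  acyclic Y -> stably_equal (cycle_of a) (cycle_of b) -> homotopic a b.
Proof.
move=> acY [I [u [v [injI uv]]]].
have projI : projective_module I := injproj injI.
have [|g gP] := projI _ _ (@Z0_boundary R Y : {linear Y (-1) -> Z0_module Y}) v.
  move=> z; have [y yE] := acY (-1) (val z) (Z0P z); exists y.
  exact: val_inj.
exists (fun n => match n return {linear can_obj M (n + 1) -> Y n} with
  | Negz 0 => g \o u | _ => \0 end) => n x.
have -> : cd (can_complex M) (n + 1) x = 0 by [].
rewrite linear0 addr0.
case: n x => [n|[|n]] x.
- have -> : x = 0 by apply: (@can_eq0 M); lia.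
  by rewrite !linear0 ?subrr ?addr0.
- have /(congr1 val) := uv x; rewrite -gP /= => <-.
  by [].
have -> : x = 0 by apply: (@can_eq0 M); lia.
by rewrite !linear0 ?subrr ?addr0.
Qed.

(** The cone is exact except in degree -1, where the kernel of its differential
    consists of the pairs (- d y, y) with y in Y^(-1).  On this kernel, a copy of
    a projective module, a map to [Z] lifts along the differential of [Z].  This
    starts the homotopy in degree -1; it is continued upwards by injectivity and
    downwards by projectivity. *)
Lemma vanish_cone_cycle_in Y Z : acyclic Y -> termwise_injective Y ->
  acyclic Z -> termwise_injective Z -> vanish (cone (cycle_in Y)) Z.
Proof.
move=> acY injY acZ injZ f.
apply: (@nullhomotopic_rec _ _ _ f (Negz 1)).
- pose bd : {linear Y (Negz 0) -> Z0_module Y} := @Z0_boundary R Y.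
  (* Negz 1 + 1 and Negz 0 + 1 compute to -1 and 0, so that no cast is needed *)
  pose ker : {linear Y (Negz 0) -> cone (cycle_in Y) (Negz 1 + 1)} :=
    @pair_map R _ _ _ (\- bd) (linear_id (Y (Negz 0))).
  have dker y : cd (cone (cycle_in Y)) (Negz 1 + 1) (ker y) = 0.
    congr pair; rewrite /=; first by rewrite oppr0.
    exact: addNr.
  have kerP x : cd (cone (cycle_in Y)) (Negz 1 + 1) x = 0 -> x = ker x.2.
    case: x => z y [_ dzy]; congr pair; apply: val_inj => /=.
    by apply/eqP; rewrite -addr_eq0; apply/eqP.
  have [|g gP] := projective_factor (d := cd Z (Negz 1))
    (f := f (Negz 1 + 1) \o ker) (injproj (injY _)).
    move=> y; apply: acZ; apply: etrans (esym (cmapd f (ker y))) _.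
    by rewrite dker linear0.
  pose h0 : {linear cone (cycle_in Y) (Negz 1 + 1) -> Z (Negz 1)} := g \o snd.
  have [|h1 h1P] := injective_factor (d := cd (cone (cycle_in Y)) (Negz 1 + 1))
    (f := f (Negz 1 + 1) \- (cd Z (Negz 1) \o h0)) (injZ _).
    by move=> x /kerP xE; rewrite /h0 /= gP /= -xE subrr.
  by exists h0, h1 => x; rewrite h1P /= [RHS]addrC subrK.
- move=> n h0 h1 mn; apply: htpy_up; first exact: injZ.
  move=> [a y] [_]; rewrite (@can_eq0 _ _ a) ?linear0 ?add0r; last by lia.
  move=> /acY[y' y'E]; exists (0, y').
  by congr pair; rewrite /= ?linear0 ?oppr0 ?add0r.
move=> n h1 h2 mn; apply: htpy_down; last exact: acZ.
apply: (retract_projective (N := Y (n + 1))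
  (i := (snd : {linear cone (cycle_in Y) (n + 1) -> Y (n + 1)}))
  (r := cone_in (cycle_in Y) (n + 1))).
  move=> [a y]; congr pair; apply/esym/can_eq0; lia.
exact/injproj/injY.
Qed.

Lemma orth_cycle_in Y Z : acyclic Y -> termwise_injective Y ->
  acyclic Z -> termwise_injective Z -> orth (cycle_in Y) Z.
Proof.
move=> acY injY acZ injZ; apply: orth_of_cone; apply: vanish_cone_cycle_in => //.
  exact: shift_acyclic.
exact: shift_injective.
Qed.
End SelfInjective.

End Orthogonality.

(** * The complex of maps between two complexes *)

Section ModuleProduct.
Variables (R : pzRingType) (I : Type) (M : I -> lmodType R).

Definition mprod : Type := forall i, M i.
HB.instance Definition _ := gen_eqMixin mprod.
HB.instance Definition _ := gen_choiceMixin mprod.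

Lemma mprodP (x y : mprod) : (forall i, x i = y i) -> x = y.
Proof. exact: functional_extensionality_dep. Qed.

Definition mprod0 : mprod := fun i => 0.
Definition mprod_opp (x : mprod) : mprod := fun i => - x i.
Definition mprod_add (x y : mprod) : mprod := fun i => x i + y i.
Definition mprod_scale a (x : mprod) : mprod := fun i => a *: x i.

Fact mprod_addA : associative mprod_add.
Proof. by move=> x y z; apply: mprodP => i; apply: addrA. Qed.
Fact mprod_addC : commutative mprod_add.
Proof. by move=> x y; apply: mprodP => i; apply: addrC. Qed.
Fact mprod_add0 : left_id mprod0 mprod_add.
Proof. by move=> x; apply: mprodP => i; apply: add0r. Qed.
Fact mprod_addN : left_inverse mprod0 mprod_opp mprod_add.
Proof. by move=> x; apply: mprodP => i; apply: addNr. Qed.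
HB.instance Definition _ := GRing.isZmodule.Build mprod
  mprod_addA mprod_addC mprod_add0 mprod_addN.

Fact mprod_scaleA a b x : mprod_scale a (mprod_scale b x) = mprod_scale (a * b) x.
Proof. by apply: mprodP => i; apply: scalerA. Qed.
Fact mprod_scale1 : left_id 1 mprod_scale.
Proof. by move=> x; apply: mprodP => i; apply: scale1r. Qed.
Fact mprod_scaleDr : right_distributive mprod_scale +%R.
Proof. by move=> a x y; apply: mprodP => i; apply: scalerDr. Qed.
Fact mprod_scaleDl x : {morph mprod_scale^~ x : a b / a + b}.
Proof. by move=> a b; apply: mprodP => i; apply: scalerDl. Qed.
HB.instance Definition _ := GRing.Zmodule_isLmodule.Build R mprod
  mprod_scaleA mprod_scale1 mprod_scaleDr mprod_scaleDl.

Definition mproj i (x : mprod) : M i := x i.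
Fact mproj_linear i : linear (mproj i). Proof. by []. Qed.
HB.instance Definition _ i :=
  GRing.isLinear.Build R mprod (M i) _ (mproj i) (@mproj_linear i).

Section Tuple.
Variables (N : lmodType R) (f : forall i, {linear N -> M i}).
Definition mtuple (x : N) : mprod := fun i => f i x.
Fact mtuple_linear : linear mtuple.
Proof. by move=> a x y; apply: mprodP => i; apply: linearP. Qed.
HB.instance Definition _ :=
  GRing.isLinear.Build R N mprod _ mtuple mtuple_linear.
End Tuple.

Lemma mprod_injective : (forall i, injective_module (M i)) ->
  injective_module mprod.
Proof.
move=> injM A B j f j_inj.
have gE i : exists g : {linear B -> M i}, forall a, g (j a) = mproj i (f a).
  by have [g gP] := injM i _ _ j (@mproj i \o f) j_inj; exists g.
exists (mtuple (fun i => sval (cid (gE i)))) => a.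
by apply: mprodP => i; apply: (svalP (cid (gE i))).
Qed.
End ModuleProduct.

Lemma sign_sqr (p : int) : (-1) ^ p * (-1) ^ p = 1 :> int.
Proof. by rewrite -exprzMl ?unitrN1 // mulrNN mulr1 exp1rz. Qed.

Lemma mulrz_sign_sqr (V : zmodType) (x : V) (p : int) :
  x *~ (-1) ^ p *~ (-1) ^ p = x.
Proof. by rewrite -mulrzA sign_sqr mulr1z. Qed.

Section InternalHom.
Variables (k : fieldType) (L : falgType k) (H : hopf_algebra L).
Implicit Types T X Y : complex L.

(** Maps of degree [n] send degree p to degree r with p + n = r; recording r
    with a proof avoids transports along associativity. *)
Definition hdegree (n : int) : Type := {pr : int * int | pr.1 + n == pr.2}.

Definition ihom_obj X Y (n : int) : lmodType L :=
  mprod (fun i : hdegree n => hhom H (X (val i).1) (Y (val i).2)).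

Definition icomp X Y n p r (e : p + n == r) (phi : ihom_obj X Y n) :
  hhom H (X p) (Y r) := phi (exist _ (p, r) e).

Fact icomp_linear X Y n p r (e : p + n == r) : linear (@icomp X Y n p r e).
Proof. by []. Qed.
HB.instance Definition _ X Y n p r (e : p + n == r) :=
  GRing.isLinear.Build L (ihom_obj X Y n) (hhom H (X p) (Y r)) _
    (@icomp X Y n p r e) (@icomp_linear X Y n p r e).

Lemma icomp_irr X Y n (phi : ihom_obj X Y n) p r (e e' : p + n == r) :
  icomp e phi = icomp e' phi.
Proof. by rewrite (bool_irrelevance e e'). Qed.

(** The differential indexed by its target. *)
Definition cd_to Y (r : int) : {linear Y (r - 1) -> Y r} :=
  ecast i {linear Y (r - 1) -> Y i} (subrK 1 r) (cd Y (r - 1)).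

Fact ihom_target_subproof n (i : hdegree (n + 1)) :
  (val i).1 + n == (val i).2 - 1.
Proof. by rewrite -(eqP (valP i)) addrA addrK. Qed.

Fact ihom_source_subproof n (i : hdegree (n + 1)) :
  (val i).1 + 1 + n == (val i).2.
Proof. by rewrite -(eqP (valP i)) -addrA [1 + n]addrC. Qed.

Definition ihom_commutator X Y n (i : hdegree (n + 1)) :
    {linear ihom_obj X Y n -> hhom H (X (val i).1) (Y (val i).2)} :=
  (hhom_post (cd_to Y (val i).2) \o @icomp X Y n _ _ (ihom_target_subproof i)) \-
  (hhom_pre (cd X (val i).1) \o @icomp X Y n _ _ (ihom_source_subproof i)).

(** (d phi) x = (-1)^p (d (phi x) - phi (d x)) for x of degree p. *)
Definition ihom_diff_component X Y n (i : hdegree (n + 1))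
    (phi : ihom_obj X Y n) : hhom H (X (val i).1) (Y (val i).2) :=
  ihom_commutator X Y i phi *~ (-1) ^ (val i).1.

Fact ihom_diff_component_linear X Y n i :
  linear (@ihom_diff_component X Y n i).
Proof.
move=> a x y; rewrite /ihom_diff_component linearP mulrzDl.
by rewrite scalerMzr.
Qed.
HB.instance Definition _ X Y n i := GRing.isLinear.Build L (ihom_obj X Y n)
  (hhom H (X (val i).1) (Y (val i).2)) _ (@ihom_diff_component X Y n i)
  (@ihom_diff_component_linear X Y n i).

Definition ihom_diff X Y n : {linear ihom_obj X Y n -> ihom_obj X Y (n + 1)} :=
  mtuple (fun i => @ihom_diff_component X Y n i).

Lemma hhomMz M N (f : hhom H M N) (m : int) x : (f *~ m) x = f x *~ m.
Proof.
have hhomMn j : (f *+ j) x = f x *+ j.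
  by elim: j => [//|j IH]; rewrite !mulrS hhomD IH.
by case: m => m; rewrite ?NegzE ?mulrNz -?pmulrn ?hhomN hhomMn.
Qed.

Lemma ihom_diffE X Y n (phi : ihom_obj X Y n) p r
    (e : p + (n + 1) == r + 1) (e1 : p + n == r) (e2 : p + 1 + n == r + 1) x :
  icomp e (ihom_diff X Y n phi) x =
  (cd Y r (icomp e1 phi x) - icomp e2 phi (cd X p x)) *~ (-1) ^ p.
Proof.
rewrite [LHS]hhomMz hhomD hhomN /=; congr ((_ - _) *~ _); last first.
  by congr (hfun _ _); apply: icomp_irr.
move: (ihom_target_subproof _) => /=; rewrite /cd_to; move: (subrK _ _) => /=.
have: r + 1 - 1 = r by rewrite addrK.
move: (r + 1 - 1) => r' E; case: r / E e e1 e2 => _ e1 _ E e3.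
by rewrite (eq_irrelevance E erefl) (icomp_irr _ e3 e1).
Qed.
Lemma ihomP X Y n (phi psi : ihom_obj X Y (n + 1)) :
  (forall p r (e : p + (n + 1) == r + 1) x, icomp e phi x = icomp e psi x) ->
  phi = psi.
Proof.
move=> E; apply: mprodP => -[[p r] e]; apply: hhomP => x; move: e x => /=.
by move: r; apply: int_succ_ind => r e x; apply: (E p r e x).
Qed.

Fact ihom_diff_sqr X Y n (phi : ihom_obj X Y n) :
  ihom_diff X Y (n + 1) (ihom_diff X Y n phi) = 0.
Proof.
apply: ihomP => p; apply: int_succ_ind => r e x.
have e1 : p + (n + 1) == r + 1 by rewrite -(inj_eq (addIr 1)) -addrA.
have e2 : p + 1 + (n + 1) == r + 1 + 1.
  by rewrite -(eqP e1) addrAC.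
have e3 : p + n == r by rewrite -(inj_eq (addIr 1)) -addrA.
have e4 : p + 1 + n == r + 1 by rewrite addrAC (eqP e3).
have e5 : p + 1 + 1 + n == r + 1 + 1 by rewrite addrAC (eqP e4).
rewrite (ihom_diffE _ e e1 e2) (ihom_diffE _ e1 e3 e4) (ihom_diffE _ e2 e4 e5).
rewrite cdd klinear0; last exact: hfun_klinear.
rewrite subr0 raddfMz /= linearB cdd sub0r signS mulrNz opprK mulNrz addNr.
exact: mul0rz.
Qed.

Definition ihom X Y : complex L :=
  @Complex L (ihom_obj X Y) (ihom_diff X Y) (@ihom_diff_sqr X Y).

Lemma ihom_termwise_injective X Y : cocommutative H ->
  termwise_injective Y -> termwise_injective (ihom X Y).
Proof.
by move=> cocomH injY n; apply: mprod_injective => i; apply: hhom_injective.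
Qed.

(** An acyclic complex is contractible over the field k.  With chosen
    pseudoinverses t of the differentials, t (1 - t d) is a contraction. *)
Lemma klinear_contraction Y : acyclic Y ->
  exists2 s : forall n, Y (n + 1) -> Y n, forall n, klinear (s n) &
    forall n y, y = cd Y n (s n y) + s (n + 1) (cd Y (n + 1) y).
Proof.
move=> acY; have tE n := klinear_pseudoinverse (klinear_linear (cd Y n)).
pose t n := s2val (cid2 (tE n)).
have tL n : klinear (t n) := s2valP (cid2 (tE n)).
have tP n x : cd Y n (t n (cd Y n x)) = cd Y n x := s2valP' (cid2 (tE n)) x.
exists (fun n y => t n (y - t (n + 1) (cd Y (n + 1) y))) => [n|n y].
  apply: klinear_comp (tL n) _; apply: klinear_add; first exact: klinear_id.
  apply: klinear_opp; apply: klinear_comp (tL _) _; exact: klinear_linear.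
rewrite cdd (klinear0 (tL _)) subr0.
have [|z zE] := acY n (y - t (n + 1) (cd Y (n + 1) y)).
  by rewrite linearB tP subrr.
by rewrite -zE tP zE subrK.
Qed.

Lemma ihom_acyclic X Y : acyclic Y -> acyclic (ihom X Y).
Proof.
move=> /klinear_contraction[s sL sE] n psi dpsi.
have hL (i : hdegree n) (e : (val i).1 + (n + 1) == (val i).2 + 1) :
    klinear (fun x => s (val i).2 (icomp e psi x) *~ (-1) ^ (val i).1).
  by apply: klinear_Mz; apply: klinear_comp (sL _) (hfun_klinear _).
have eS (i : hdegree n) : (val i).1 + (n + 1) == (val i).2 + 1.
  by rewrite addrA (eqP (valP i)).
pose phi : ihom_obj X Y n := fun i => @Hhom k L H _ _ _ (hL i (eS i)).
have phiE p r (e1 : p + n == r) (e : p + (n + 1) == r + 1) x :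
    icomp e1 phi x = s r (icomp e psi x) *~ (-1) ^ p.
  by rewrite /icomp /phi /=; congr (s _ (hfun _ _) *~ _); apply: icomp_irr.
exists phi; apply: ihomP => p r e x.
have e1 : p + n == r by rewrite -(inj_eq (addIr 1)) -addrA.
have e2 : p + 1 + n == r + 1 by rewrite addrAC (eqP e1).
have e3 : p + 1 + (n + 1) == r + 1 + 1 by rewrite addrA (eqP e2).
have e4 : p + (n + 1 + 1) == r + 1 + 1 by rewrite addrA (eqP e).
have := congr1 (fun f => icomp e4 f x) dpsi.
rewrite [LHS](ihom_diffE _ e4 e e3) => /(congr1 (fun y => y *~ (-1) ^ p)).
rewrite mulrz_sign_sqr [icomp _ 0]/(0 : hhom _ _ _) mul0rz => /eqP.
rewrite subr_eq0 => /eqP dpsix.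
rewrite (ihom_diffE _ e e1 e2) (phiE _ _ e1 e) (phiE _ _ e2 e3) -dpsix.
rewrite raddfMz signS mulrNz opprK -mulrzDl mulrz_sign_sqr.
exact/esym/sE.
Qed.
End InternalHom.

(** ** Maps out of a tensor product of complexes *)

Lemma addr_subl (V : zmodType) (x y : V) : x + y - x = y.
Proof. by rewrite addrC addKr. Qed.

Lemma linear_mulrz (R : pzRingType) (M N : lmodType R) (f : {linear M -> N})
  (m : int) x : f (x *~ m) = f x *~ m.
Proof. exact: raddfMz. Qed.

Definition mulz_map (R : pzRingType) (N : lmodType R) (m : int) (x : N) : N :=
  x *~ m.
Fact mulz_map_linear (R : pzRingType) (N : lmodType R) m :
  linear (@mulz_map R N m).
Proof. by move=> a x y; rewrite /mulz_map mulrzDl scalerMzr. Qed.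
HB.instance Definition _ (R : pzRingType) (N : lmodType R) m :=
  GRing.isLinear.Build R N N _ (@mulz_map R N m) (@mulz_map_linear R N m).

Section ComplexAdjunction.
Variables (k : fieldType) (L : falgType k) (H : hopf_algebra L).
Hypothesis cocomH : cocommutative H.
Implicit Types T X Y Z : complex L.

(** The generator x (x) t in degree n, with a proof that the degrees add up to n
    in place of a transport. *)
Definition tgen X T n p q (e : p + q == n) (x : X p) (t : T q) :
  tensor_complex H X T n := @tensor_gen k L H X T n (exist _ (p, q) e) x t.

Lemma tgen_irr X T n p q (e e' : p + q == n) (x : X p) (t : T q) :
  tgen e x t = tgen e' x t.
Proof. exact: tensor_gen_irr. Qed.

Lemma cd_tgen X T n p q (e : p + q == n) (e1 : p + 1 + q == n + 1)
    (e2 : p + (q + 1) == n + 1) (x : X p) (t : T q) :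
  cd (tensor_complex H X T) n (tgen e x t) =
  tgen e1 (cd X p x) t + tgen e2 x (cd T q t) *~ (-1) ^ p.
Proof.
rewrite [LHS]tensor_diff_gen.
by congr (_ + _ *~ _); apply: tensor_gen_irr.
Qed.

Lemma tensor_ext X T n (P : lmodType L)
    (f g : {linear tensor_complex H X T n -> P}) :
  (forall p q (e : p + q == n) x t, f (tgen e x t) = g (tgen e x t)) -> f =1 g.
Proof.
by move=> fg; apply: tensor_obj_ext => -[[p q] e] x t; apply: fg.
Qed.

Definition tsummand X T n p q (e : p + q == n) (z : htensor H (X p) (T q)) :
    tensor_complex H X T n :=
  @dsum_in _ _ (@tensor_summand k L H X T n) (exist _ (p, q) e) z.

Fact tsummand_linear X T n p q (e : p + q == n) : linear (@tsummand X T n p q e).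
Proof. by move=> a x y; apply: (dsum_in_linear (M := @tensor_summand k L H X T n)). Qed.
HB.instance Definition _ X T n p q (e : p + q == n) :=
  GRing.isLinear.Build L (htensor H (X p) (T q)) (tensor_complex H X T n) _
    (@tsummand X T n p q e) (@tsummand_linear X T n p q e).

Section Hat.
Variables X T Y : complex L.

Section FromMaps.
Variable (F : forall n, {linear tensor_complex H X T n -> Y n}).

Definition hat_component n : {linear T n -> ihom H X Y n} :=
  mtuple (fun i : hdegree n =>
    curry cocomH (linear_comp (F (val i).2) (@tsummand X T _ (val i).1 n (valP i)))).

Lemma hat_componentE n p r (e : p + n == r) t x :
  icomp e (hat_component n t) x = F r (tgen e x t).
Proof. by rewrite /icomp /= /tgen /tensor_gen; congr (F _ _); apply: tgen_irr. Qed.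
End FromMaps.

Fact hat_subproof (F : chain_map (tensor_complex H X T) Y) n t :
  hat_component F (n + 1) (cd T n t) = cd (ihom H X Y) n (hat_component F n t).
Proof.
apply: ihomP => p r e x.
have e1 : p + n == r by rewrite -(inj_eq (addIr 1)) -addrA.
have e2 : p + 1 + n == r + 1 by rewrite addrAC (eqP e1).
rewrite (ihom_diffE _ e e1 e2) !hat_componentE -cmapd (cd_tgen e1 e2 e).
by rewrite linearD addr_subl raddfMz mulrz_sign_sqr.
Qed.

(** The map T -> Hom_k(X, Y) that corresponds to X (x) T -> Y under the
    tensor-hom adjunction. *)
Definition hat (F : chain_map (tensor_complex H X T) Y) :
    chain_map T (ihom H X Y) :=
  @ChainMap L T (ihom H X Y) (hat_component F) (hat_subproof F).

Lemma hatE F n p r (e : p + n == r) t x :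
  icomp e (hat F n t) x = F r (tgen e x t).
Proof. exact: hat_componentE. Qed.

(** A family of maps T^q -> Hom_k(X^p, P) with p + q = n is a map out of the
    direct sum of the X^p (x) T^q. *)
Lemma uncurry_family n (P : lmodType L)
    (G : forall p q, p + q == n -> {linear T q -> hhom H (X p) P}) :
  exists F : {linear tensor_complex H X T n -> P},
  forall p q (e : p + q == n) x t, F (tgen e x t) = G p q e t x.
Proof.
pose U (i : bidegree n) := cid (uncurry cocomH (G _ _ (valP i))).
exists (@dsum_lift _ _ (@tensor_summand k L H X T n) _ (fun i => sval (U i))).
move=> p q e x t; rewrite [LHS]dsum_lift_in.
apply: etrans (svalP (U _) _ _) _ => /=.
by move: (valP _) => /= e'; rewrite (bool_irrelevance e' e).
Qed.

Lemma ihom_ext n (phi psi : ihom H X Y n) :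
  (forall p r (e : p + n == r) x, icomp e phi x = icomp e psi x) -> phi = psi.
Proof.
by move=> E; apply: mprodP => -[[p r] e]; apply: hhomP => x; apply: E.
Qed.

Lemma hat_surjective (G : chain_map T (ihom H X Y)) :
  exists F, forall n, hat F n =1 G n.
Proof.
pose F n := cid (uncurry_family (fun p q (e : p + q == n) =>
  linear_comp (@icomp k L H X Y q p n e) (G q))).
have FE n p q (e : p + q == n) x t : sval (F n) (tgen e x t) = icomp e (G q t) x.
  exact: (svalP (F n)).
have Fd n x : sval (F (n + 1)) (cd (tensor_complex H X T) n x) =
    cd Y n (sval (F n) x).
  move: x; apply: (tensor_ext
    (f := sval (F (n + 1)) \o cd (tensor_complex H X T) n)
    (g := cd Y n \o sval (F n))) => p q e x t /=.
  have e1 : p + 1 + q == n + 1 by rewrite addrAC (eqP e).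
  have e2 : p + (q + 1) == n + 1 by rewrite addrA (eqP e).
  rewrite (cd_tgen e e1 e2) linearD linear_mulrz (FE _ _ _ e1) (FE _ _ _ e2) (FE _ _ _ e) cmapd (ihom_diffE _ e2 e e1).
  by rewrite mulrz_sign_sqr [LHS]addrC subrK.
exists (@ChainMap L (tensor_complex H X T) Y (fun n => sval (F n)) Fd) => n t.
by apply: ihom_ext => p r e x; rewrite hatE FE.
Qed.

Lemma hat_sub (F F' : chain_map (tensor_complex H X T) Y) n :
  hat (chain_sub F F') n =1 chain_sub (hat F) (hat F') n.
Proof.
move=> t; apply: ihom_ext => p r e x; rewrite hatE.
by rewrite -[RHS]/(icomp e (hat F n t) x - icomp e (hat F' n t) x) !hatE.
Qed.

(** A homotopy h on X (x) T corresponds to t |-> (x |-> (-1)^p h (x (x) t)), for x of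
    degree p. *)
Lemma hat_nullhomotopic (F : chain_map (tensor_complex H X T) Y) :
  nullhomotopic F <-> nullhomotopic (hat F).
Proof.
split=> [[h hP]|[K KP]].
  have eS n (i : hdegree n) : (val i).1 + (n + 1) == (val i).2 + 1.
    by rewrite addrA (eqP (valP i)).
  pose g n : {linear T (n + 1) -> ihom H X Y n} := mtuple (fun i : hdegree n =>
    linear_comp (@mulz_map L _ ((-1) ^ (val i).1))
      (curry cocomH (linear_comp (h (val i).2)
         (@tsummand X T _ (val i).1 (n + 1) (eS n i))))).
  have gE n p r (e : p + n == r) (e' : p + (n + 1) == r + 1) t x :
      icomp e (g n t) x = h r (tgen e' x t) *~ (-1) ^ p.
    rewrite [LHS]hhomMz; congr (_ *~ _).
    by rewrite -[LHS]/(h r (tgen _ x t)); congr (h r _); apply: tgen_irr.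
  exists g => n t; apply: ihomP => p r e x.
  have e1 : p + n == r by rewrite -(inj_eq (addIr 1)) -addrA.
  have e2 : p + 1 + n == r + 1 by rewrite addrAC (eqP e1).
  have e3 : p + 1 + (n + 1) == r + 1 + 1 by rewrite addrA (eqP e2).
  have e4 : p + (n + 1 + 1) == r + 1 + 1 by rewrite addrA (eqP e).
  rewrite hatE hP -[RHS]/(icomp e (cd (ihom H X Y) n (g n t)) x +
    icomp e (g (n + 1) (cd T (n + 1) t)) x).
  rewrite (ihom_diffE _ e e1 e2) (gE _ _ _ e1 e) (gE _ _ _ e2 e3) (gE _ _ _ e e4).
  rewrite (cd_tgen e e3 e4) linearD (linear_mulrz (h _)) (linear_mulrz (cd Y r)).
  rewrite signS mulrNz opprK.
  by rewrite mulrzDl !mulrz_sign_sqr addrA.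
have eK (n p r : int) (e : p + (n + 1) == r + 1) : p + n == r.
  by rewrite -(inj_eq (addIr 1)) -addrA.
have [G GE] := @succ_family (fun q => forall p r, p + q == r + 1 ->
    {linear T q -> hhom H (X p) (Y r)})
  (fun n p r (e : p + (n + 1) == r + 1) => linear_comp (mulz_map ((-1) ^ p))
    (linear_comp (@icomp k L H X Y n p r (eK n p r e)) (K n))).
pose h n := cid (uncurry_family (fun p q (e : p + q == n + 1) => G q p n e)).
have hE n p q (e : p + (q + 1) == n + 1) (e1 : p + q == n) x t :
    sval (h n) (tgen e x t) = icomp e1 (K q t) x *~ (-1) ^ p.
  apply: etrans (svalP (h n) _ _ e _ _) _; rewrite GE.
  by rewrite [LHS]hhomMz; congr (hfun _ _ *~ _); apply: icomp_irr.
exists (fun n => sval (h n)) => n z.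
move: z; apply: (tensor_ext (f := F (n + 1))
  (g := (cd Y n \o sval (h n)) \+
        (sval (h (n + 1)) \o cd (tensor_complex H X T) (n + 1)))) => p.
apply: int_succ_ind => q e x t; rewrite /=.
have e1 := eK _ _ _ e.
have e2 : p + 1 + q == n + 1 by rewrite addrAC (eqP e1).
have e3 : p + 1 + (q + 1) == n + 1 + 1 by rewrite addrA (eqP e2).
have e4 : p + (q + 1 + 1) == n + 1 + 1 by rewrite addrA (eqP e).
rewrite (hE _ _ _ e e1) (cd_tgen e e3 e4) linearD (linear_mulrz (sval _)).
rewrite (hE _ _ _ e3 e2) (hE _ _ _ e4 e) mulrz_sign_sqr signS mulrNz.
have := congr1 (fun f => icomp e f x) (KP q t); rewrite [LHS]hatE => ->.
rewrite -[LHS]/(icomp e (cd (ihom H X Y) q (K q t)) x +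
    icomp e (K (q + 1) (cd T (q + 1) t)) x).
by rewrite (ihom_diffE _ e e1 e2) mulrzBl (linear_mulrz (cd Y n)) addrA.
Qed.

Lemma hat_homotopic (F F' : chain_map (tensor_complex H X T) Y) :
  homotopic F F' <-> homotopic (hat F) (hat F').
Proof.
split=> [/homotopic_sub/hat_nullhomotopic FF'|/homotopic_sub FF'].
  by apply/homotopic_sub; apply: (nullhomotopic_eq _ FF'); apply: hat_sub.
apply/homotopic_sub/hat_nullhomotopic; apply: (nullhomotopic_eq _ FF') => n t.
by apply/esym; apply: hat_sub.
Qed.
End Hat.

(** ** Tensoring with a map *)

Section TensorMapLeft.
Variables (X T T' : complex L) (f : chain_map T T').

(** The map 1 (x) f corresponds to T -> T' -> Hom_k(X, X (x) T'). *)
Lemma tensor_map_left : exists F : chain_map (tensor_complex H X T)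
    (tensor_complex H X T'),
  forall n p q (e : p + q == n) x t, F n (tgen e x t) = tgen e x (f q t).
Proof.
have [F FE] := hat_surjective
  (chain_comp (hat (chain_id (tensor_complex H X T'))) f).
exists F => n p q e x t; rewrite -hatE FE.
exact: etrans (hatE _ _ _ _) _.
Qed.

(** The adjunction identifies Hom(1 (x) f, Y) with Hom(f, Hom_k(X, Y)). *)
Lemma orth_tensor (F : chain_map (tensor_complex H X T) (tensor_complex H X T'))
    Y : (forall n p q (e : p + q == n) x t, F n (tgen e x t) = tgen e x (f q t)) ->
  orth f (ihom H X Y) -> orth F Y.
Proof.
move=> FE [f_inj f_surj].
have hatF (g : chain_map (tensor_complex H X T') Y) :
    homotopic (hat (chain_comp g F)) (chain_comp (hat g) f).
  apply: eq_homotopic => n t; apply: ihom_ext => p r e x.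
  rewrite hatE [LHS]/= FE; exact/esym/hatE.
split=> [g g' /hat_homotopic gg'|h].
  apply/hat_homotopic/f_inj; apply: homotopic_trans (hatF g').
  exact: homotopic_trans (homotopic_sym (hatF g)) gg'.
have [u uf] := f_surj (hat h); have [g gu] := hat_surjective u.
exists g; apply/hat_homotopic; apply: homotopic_trans (hatF g) _.
by apply: homotopic_trans uf; apply: homotopic_compl; apply: eq_homotopic.
Qed.
End TensorMapLeft.

End ComplexAdjunction.

(** ** Acyclicity of tensor products *)

Section TensorAcyclic.
Variables (k : fieldType) (L : falgType k) (H : hopf_algebra L).
Implicit Types T X Y Z : complex L.

Lemma tensor_complex_ind X T n (Q : tensor_complex H X T n -> Prop) :
  Q 0 -> (forall w w', Q w -> Q w' -> Q (w + w')) ->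
  (forall p q (e : p + q == n) x t, Q (tgen H e x t)) -> forall w, Q w.
Proof.
move=> Q0 QD Qt; apply: dsum_ind => // -[[p q] e] m.
elim/htensor_ind: m => [|z z' Qz Qz'|x t]; last exact: Qt.
  by rewrite linear0.
by rewrite linearD; apply: QD.
Qed.

Lemma dsumMz (R : pzRingType) (I : choiceType) (M : I -> lmodType R)
  (x : dsum M) (m : int) i : (x *~ m) i = x i *~ m.
Proof.
have dsumMn j : (x *+ j) i = x i *+ j.
  by elim: j => [//|j IH]; rewrite !mulrS dsum_valD IH.
by case: m => m; rewrite ?NegzE ?mulrNz -?pmulrn -?dsumMn.
Qed.

Section Contraction.
Variables (X T : complex L) (s : forall n, T (n + 1) -> T n).
Hypothesis sL : forall n, klinear (@s n).

Fact tensor_contraction_subproof p q :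
  exists2 h : htensor H (X p) (T (q + 1)) -> htensor H (X p) (T q),
    klinear h & forall x t, h (tp H x t) = tp H x (s t).
Proof. exact (klinear_map H (@klinear_id k L (X p)) (@sL q)). Qed.

Definition contraction_summand p q := s2val (cid2 (tensor_contraction_subproof p q)).

Let hL p q : klinear (@contraction_summand p q) :=
  s2valP (cid2 (tensor_contraction_subproof p q)).
Let hE p q x t : @contraction_summand p q (tp H x t) = tp H x (s t) :=
  s2valP' (cid2 (tensor_contraction_subproof p q)) x t.

Fact decr_right_subproof n (i : bidegree (n + 1)) :
  (val i).1 + ((val i).2 - 1) == n.
Proof. by rewrite addrA (eqP (valP i)) addrK. Qed.
Definition decr_right n (i : bidegree (n + 1)) : bidegree n :=
  exist _ ((val i).1, (val i).2 - 1) (decr_right_subproof i).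

Lemma incr_rightK n : cancel (@incr_right n) (@decr_right n).
Proof. by move=> [[p q] e]; apply: val_inj; rewrite /= addrK. Qed.

(** The contraction x (x) t |-> (-1)^p x (x) s t, given by its components. *)
Definition tensor_contraction_val n (w : tensor_complex H X T (n + 1))
    (i : bidegree n) : tensor_summand H X T i :=
  contraction_summand (w (incr_right i)) *~ (-1) ^ (val i).1.

Fact tensor_contraction_fin n (w : tensor_complex H X T (n + 1)) :
  exists r : seq (bidegree n),
    forall i, i \notin r -> tensor_contraction_val w i = 0.
Proof.
have [r wr] := dsum_fin w; exists (map (@decr_right n) r) => i ir.
have wi : w (incr_right i) = 0.
  by apply: wr; apply: contra ir => ir; rewrite -[i]incr_rightK map_f.
by rewrite /tensor_contraction_val wi (klinear0 (@hL _ _)) mul0rz.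
Qed.

Definition tensor_contraction n (w : tensor_complex H X T (n + 1)) :
  tensor_complex H X T n := Dsum (tensor_contraction_fin w).

Lemma tensor_contractionD n (w w' : tensor_complex H X T (n + 1)) :
  tensor_contraction (w + w') = tensor_contraction w + tensor_contraction w'.
Proof.
apply: dsumP => i; rewrite dsum_valD /= /tensor_contraction_val dsum_valD.
by rewrite (klinearD (@hL _ _)) mulrzDl.
Qed.

Lemma tensor_contractionMz n (w : tensor_complex H X T (n + 1)) m :
  tensor_contraction (w *~ m) = tensor_contraction w *~ m.
Proof.
apply: dsumP => i; rewrite dsumMz.
rewrite -[LHS]/(tensor_contraction_val _ i) -[in RHS]/(tensor_contraction_val _ i).
by rewrite /tensor_contraction_val dsumMz (klinearMz (@hL _ _)) -!mulrzA mulrC.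
Qed.

Lemma tensor_contraction_gen n p q (e : p + (q + 1) == n + 1)
    (e1 : p + q == n) x t :
  tensor_contraction (tgen H e x t) = tgen H e1 x (s t) *~ (-1) ^ p.
Proof.
apply: dsumP => j; rewrite dsumMz.
rewrite -[LHS]/(tensor_contraction_val _ j) /tensor_contraction_val.
pose i : bidegree n := exist _ (p, q) e1.
have -> : tgen H e x t = @tensor_gen k L H X T (n + 1) (incr_right i) x t.
  exact: tensor_gen_irr.
rewrite -[tgen H e1 x _]/(@tensor_gen k L H X T n i x (s t)) /tensor_gen /=.
have [<-|ij] := eqVneq i j; first by rewrite !dfwith_in; congr (_ *~ _); apply: hE.
rewrite !dfwith_out ?(klinear0 (@hL _ _)) ?mul0rz //.
by apply: contra ij => /eqP/(can_inj (@incr_rightK n)) ->.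
Qed.
End Contraction.

(** Over the field k the complex [T] is contractible, hence so is the tensor
    product. *)
Lemma tensor_acyclic X T : acyclic T -> acyclic (tensor_complex H X T).
Proof.
move=> /klinear_contraction[s sL sE] n w dw.
have c0 m : tensor_contraction sL (0 : tensor_complex H X T (m + 1)) = 0.
  by apply: (addrI (tensor_contraction sL 0)); rewrite -tensor_contractionD !addr0.
suff E v : v = cd _ n (tensor_contraction sL v) +
    tensor_contraction sL (cd (tensor_complex H X T) (n + 1) v).
  by exists (tensor_contraction sL w); rewrite [RHS]E dw c0 addr0.
elim/tensor_complex_ind: v => [|v v' Ev Ev'|p q].
- by rewrite linear0 !c0 linear0 addr0.
- by rewrite linearD !tensor_contractionD linearD addrACA -Ev -Ev'.
move: q; apply: int_succ_ind => q e x t.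
have e1 : p + q == n by rewrite -(inj_eq (addIr 1)) -addrA.
have e2 : p + 1 + q == n + 1 by rewrite addrAC (eqP e1).
have e3 : p + 1 + (q + 1) == n + 1 + 1 by rewrite addrA (eqP e2).
have e4 : p + (q + 1 + 1) == n + 1 + 1 by rewrite addrA (eqP e).
rewrite (tensor_contraction_gen _ e e1) (linear_mulrz (cd _ n)).
rewrite (cd_tgen H e1 e2 e) (cd_tgen H e e3 e4) tensor_contractionD
  tensor_contractionMz.
rewrite (tensor_contraction_gen _ e3 e2) (tensor_contraction_gen _ e4 e).
rewrite mulrzDl !mulrz_sign_sqr signS mulrNz addrACA subrr add0r.
by rewrite /tgen -tensor_genDr -sE.
Qed.

(** ** Tensoring with an invariant cycle *)

Section TensorUnit.
Variables (T : complex L) (y : T 0).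
Hypothesis yinv : forall b : L, b *: y = (counit H b : k)%:A *: y.
Hypothesis dy : cd T 0 y = 0.

(** The map x |-> x (x) y is L-linear because b (x (x) y) is the sum of the
    b_1 x (x) epsilon(b_2) y. *)
Lemma tensor_unit X : exists u : chain_map X (tensor_complex H X T),
  forall n (e : n + 0 == n) x, u n x = tgen H e x y.
Proof.
have uL n (e : n + 0 == n) : linear (fun x : X n => tgen H e x y).
  move=> b x x'; rewrite /tgen tensor_genDl -!/(tgen _ _ _ _); congr (_ + _).
  rewrite -[RHS]/(b *: tsummand e (tp H x y)) -linearZ htensor_scale_tp.
  congr (tsummand e _); apply/esym.
  rewrite -[RHS](@csum_counitr _ _ H _ (fun b => tp H (b *: x) y)); last first.
    by apply: klinear_tpl; klin.
  apply: eq_bigr => uv _; rewrite yinv.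
  exact: (klinearZ ((tp_klinear2 H (X n) (T 0)).1 _)).
have e0 (n : int) : n + 0 == n by rewrite addr0.
pose u n : {linear X n -> tensor_complex H X T n} :=
  HB.pack (fun x : X n => tgen H (e0 n) x y)
    (GRing.isLinear.Build L (X n) (tensor_complex H X T n) _ _ (uL n (e0 n))).
have ud n x : u (n + 1) (cd X n x) = cd (tensor_complex H X T) n (u n x).
  have e2 : n + (0 + 1) == n + 1 by rewrite add0r.
  rewrite (cd_tgen H (e0 n) (e0 (n + 1)) e2) dy.
  by rewrite [tgen H e2 x 0]tensor_gen0r mul0rz addr0.
exists (@ChainMap L X (tensor_complex H X T) u ud) => n e x.
exact: tgen_irr.
Qed.

Lemma tensor_unit_natural X X' (u : chain_map X (tensor_complex H X T))
    (u' : chain_map X' (tensor_complex H X' T)) (a : chain_map X X') :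
  (forall n (e : n + 0 == n) x, u n x = tgen H e x y) ->
  (forall n (e : n + 0 == n) x, u' n x = tgen H e x y) ->
  homotopic (chain_comp u' a) (chain_comp (tensor_map_right H T a) u).
Proof.
move=> uE u'E; apply: eq_homotopic => n x.
have e0 : n + 0 == n by rewrite addr0.
by rewrite /= (u'E _ e0) (uE _ e0) [RHS]tensor_cmap_gen.
Qed.
End TensorUnit.

Lemma iso_of_bijective X Y (f : chain_map X Y) :
  (forall n, injective (f n)) -> (forall n y, exists x, f n x = y) ->
  is_iso (f : @mor (homotopy_category L) X Y).
Proof.
move=> f_inj f_surj.
have gE n := linear_inverse (@f_inj n) (f_surj n).
pose g n := s2val (cid2 (gE n)).
have fK n : cancel (f n) (g n) := s2valP (cid2 (gE n)).
have gK n : cancel (g n) (f n) := s2valP' (cid2 (gE n)).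
have gd n y : g (n + 1) (cd Y n y) = cd X n (g n y).
  by apply: f_inj; rewrite gK cmapd gK.
by exists (@ChainMap L Y X g gd); split; apply: eq_homotopic => n x;
  [apply: fK | apply: gK].
Qed.

Lemma tsummand_inj X T n p q (e : p + q == n) :
  injective (@tsummand k L H X T n p q e).
Proof.
move=> z z' /(congr1 (fun w : tensor_complex H X T n =>
  (w : dsum _) (exist _ (p, q) e))).
by rewrite /tsummand /= !dfwith_in.
Qed.

Definition trivial_one : can_complex (trivial_module H) 0 := (1 : k).

(** The inverse of x |-> x (x) 1 sends x (x) t to t x. *)
Lemma tensor_trivial_iso X
    (u : chain_map X (tensor_complex H X (can_complex (trivial_module H)))) :
  (forall n (e : n + 0 == n) x,
     u n x = tgen H e x trivial_one) ->
  is_iso (u : @mor (homotopy_category L) _ _).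
Proof.
move=> uE; apply: iso_of_bijective => [n|n w].
  have e0 : n + 0 == n by rewrite addr0.
  have [f fL fE] : exists2 f : htensor H (X n) (trivial_module H) -> X n,
      klinear f & forall x t, f (tp H x t) = (t : k)%:A *: x.
    apply: klinear_lift; split=> [x|t]; last by klin.
    exact/klinear_scalel/klinear_trivial/klinear_id.
  move=> x x'; rewrite !(uE n e0) => /(@tsummand_inj _ _ _ _ _ e0)/(congr1 f).
  by rewrite !fE !scale1r.
elim/tensor_complex_ind: w => [|w w' [x <-] [x' <-]|p q e x t].
- by exists 0; rewrite linear0.
- by exists (x + x'); rewrite linearD.
have [q0|q0] := eqVneq q 0; last first.
  by exists 0; rewrite linear0 [t](can_eq0 t q0) [RHS]tensor_gen0r.
move: q q0 e t => _ -> e t; have pn : p = n by rewrite -(eqP e) addr0.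
move: pn e; case: n / => e; exists ((t : k)%:A *: x); rewrite (uE _ e).
congr (tsummand e _).
have tK := tp_klinear2 H (X p) (trivial_module H).
apply: etrans (klinearZ (tK.2 (1 : k)) t x) _.
apply: etrans (esym (klinearZ (tK.1 x) t (1 : k))) _; congr tp.
apply: etrans (@trivial_algZ k L H t (1 : k)) _; exact: mulr1.
Qed.
End TensorAcyclic.

(** * Adjunctions and equivalences from universal arrows *)

Section Units.
Variables (C D : category) (F : functor C D) (G : functor D C).
Variable u : forall X : C, mor X (G (F X)).
Hypothesis u_natural : forall (X X' : C) (a : mor X' X),
  u X \oc a ~= fmap G (fmap F a) \oc u X'.
Hypothesis u_inj : forall (X : C) (Y : D) (f g : mor (F X) Y),
  fmap G f \oc u X ~= fmap G g \oc u X -> f ~= g.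
Hypothesis u_surj : forall (X : C) (Y : D) (h : mor X (G Y)),
  exists f : mor (F X) Y, fmap G f \oc u X ~= h.

Let compl (X Y Z : C) (f f' : mor Y Z) (g : mor X Y) :
  f ~= f' -> f \oc g ~= f' \oc g.
Proof. by move=> ff'; apply: comp_heq => //; apply: heq_refl. Qed.
Let compr (X Y Z : C) (f : mor Y Z) (g g' : mor X Y) :
  g ~= g' -> f \oc g ~= f \oc g'.
Proof. by move=> gg'; apply: comp_heq => //; apply: heq_refl. Qed.

Lemma left_adjoint_of_units : left_adjoint F G.
Proof.
exists (fun X Y f => fmap G f \oc u X); split.
- move=> X Y f g; split; first exact: u_inj.
  by move=> fg; apply: compl; apply: fmap_heq.
- exact: u_surj.
- move=> X X' Y a f; apply: heq_trans (compl _ (fmap_comp G _ _)) _.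
  apply: heq_trans (heq_sym (Defs.compA _ _ _)) _.
  apply: heq_trans (compr _ (heq_sym (u_natural a))) _.
  exact: Defs.compA.
move=> X Y Y' v f; apply: heq_trans (compl _ (fmap_comp G _ _)) _.
exact: heq_sym (Defs.compA _ _ _).
Qed.

Hypothesis G_faithful : forall (Y Y' : D) (f g : mor Y Y'),
  fmap G f ~= fmap G g -> f ~= g.
Hypothesis G_full : forall (Y Y' : D) (h : mor (G Y) (G Y')),
  exists f, fmap G f ~= h.
Hypothesis G_surj : forall X : C, exists (Y : D) (a : mor X (G Y)), is_iso a.

Let counit_spec Y := cid (u_surj (idm (G Y))).
Let e Y : mor (F (G Y)) Y := sval (counit_spec Y).
Let eu Y : fmap G (e Y) \oc u (G Y) ~= idm (G Y) := svalP (counit_spec Y).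

Let e_inverse Y : exists s : mor Y (F (G Y)),
  [/\ fmap G s ~= u (G Y), e Y \oc s ~= idm Y & s \oc e Y ~= idm _].
Proof.
have [s sE] := G_full (u (G Y)).
exists s; split=> //.
  apply: G_faithful; apply: heq_trans (fmap_comp _ _ _) _.
  apply: heq_trans (compr _ sE) _; apply: heq_trans (eu Y) _.
  exact: heq_sym (fmap_id _ _).
apply: u_inj; apply: heq_trans (compl _ (fmap_comp G _ _)) _.
apply: heq_trans (heq_sym (Defs.compA _ _ _)) _.
apply: heq_trans (compr _ (eu Y)) _.
apply: heq_trans (comp_idr _) _; apply: heq_trans sE _.
apply: heq_trans (heq_sym (comp_idl _)) _.
by apply: compl; apply: heq_sym; apply: fmap_id.
Qed.

(** Every object is isomorphic to some G Y, and at G Y the inverse of the unit is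
    the image under G of the counit. *)
Lemma u_iso X : is_iso (u X).
Proof.
have [Y [a [b [ba ab]]]] := G_surj X.
have [s [sE es se]] := e_inverse Y.
have ue : u (G Y) \oc fmap G (e Y) ~= idm _.
  apply: heq_trans (compl _ (heq_sym sE)) _.
  apply: heq_trans (heq_sym (fmap_comp _ _ _)) _.
  by apply: heq_trans (fmap_heq _ se) (fmap_id _ _).
(* u X is conjugate to u (G Y) along the isomorphism a *)
exists (b \oc fmap G (e Y) \oc fmap G (fmap F a)); split.
  apply: heq_trans (heq_sym (Defs.compA _ _ _)) _.
  apply: heq_trans (compr _ (heq_sym (u_natural a))) _.
  apply: heq_trans (heq_sym (Defs.compA _ _ _)) _.
  apply: heq_trans (compr _ (Defs.compA _ _ _)) _.
  apply: heq_trans (compr _ (compl _ (eu Y))) _.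
  by apply: heq_trans (compr _ (comp_idl _)) ba.
have Fab : fmap G (fmap F b) \oc fmap G (fmap F a) ~= idm _.
  apply: heq_trans (heq_sym (fmap_comp _ _ _)) _.
  apply: heq_trans (fmap_heq _ (heq_sym (fmap_comp _ _ _))) _.
  apply: heq_trans (fmap_heq _ (fmap_heq _ ba)) _.
  by apply: heq_trans (fmap_heq _ (fmap_id _ _)) (fmap_id _ _).
apply: heq_trans (Defs.compA _ _ _) _.
apply: heq_trans (compl _ (Defs.compA _ _ _)) _.
apply: heq_trans (compl _ (compl _ (u_natural b))) _.
apply: heq_trans (compl _ (heq_sym (Defs.compA _ _ _))) _.
apply: heq_trans (compl _ (compr _ ue)) _.
by apply: heq_trans (compl _ (comp_idr _)) Fab.
Qed.

Lemma e_natural (Y Y' : D) (f : mor Y Y') :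
  e Y' \oc fmap F (fmap G f) ~= f \oc e Y.
Proof.
apply: u_inj; apply: heq_trans (compl _ (fmap_comp G _ _)) _.
apply: heq_trans (heq_sym (Defs.compA _ _ _)) _.
apply: heq_trans (compr _ (heq_sym (u_natural _))) _.
apply: heq_trans (Defs.compA _ _ _) _; apply: heq_trans (compl _ (eu _)) _.
apply: heq_trans (comp_idl _) _; apply: heq_sym.
apply: heq_trans (compl _ (fmap_comp G _ _)) _.
apply: heq_trans (heq_sym (Defs.compA _ _ _)) _.
by apply: heq_trans (compr _ (eu _)) (comp_idr _).
Qed.

(** The counit is an isomorphism because G is fully faithful, hence so is the
    unit at the objects G Y, hence everywhere. *)
Lemma equivalence_of_units : equivalence_with_quasi_inverse F G.
Proof.
split; last first.
  exists e; split=> [Y|Y Y' f]; last exact: e_natural.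
  by have [s [_ es se]] := e_inverse Y; exists s.
pose uI X := cid (u_iso X).
exists (fun X => sval (uI X)); split=> [X|X X' f].
  by exists (u X); have [vu uv] := svalP (uI X).
have [vu uv] := svalP (uI X); have [v'u' u'v'] := svalP (uI X').
(* conjugate the naturality of u by its inverses *)
apply: heq_trans (heq_sym (comp_idr _)) _.
apply: heq_trans (compr _ (heq_sym uv)) _.
apply: heq_trans (Defs.compA _ _ _) _; apply: compl.
apply: heq_trans (heq_sym (Defs.compA _ _ _)) _.
apply: heq_trans (compr _ (heq_sym (u_natural f))) _.
apply: heq_trans (Defs.compA _ _ _) _.
by apply: heq_trans (compl _ v'u') (comp_idl _).
Qed.
End Units.

(** * Resolutions of the trivial module *)

Section Resolutions.
Variable R : pzRingType.
Implicit Types X Y Z : complex R.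

(** The cone of a resolution is acyclic and bounded below, so it has no maps to
    complexes of injectives up to homotopy. *)
Lemma orth_resolution (M : lmodType R) I (eta : chain_map (can_complex M) I) Z :
  injective_resolution eta -> termwise_injective Z -> orth eta Z.
Proof.
move=> [injI I0 qeta] injZ; have cone0 n (z : cone eta n) : n < -1 -> z = 0.
  case: z => x y n1; congr pair; first by apply: can_eq0; lia.
  by apply: I0; lia.
have vZ Z' : termwise_injective Z' -> vanish (cone eta) Z'.
  apply: (@vanish_bounded_below _ _ _ (-1)) => [n n1 z|]; first exact: cone0.
  exact: cone_acyclic.
by apply: orth_of_cone; apply: vZ => //; apply: shift_injective.
Qed.

(** A bounded above complex of projectives has no maps to an acyclic complex up to
    homotopy. *)
Lemma orth_tate (M : lmodType R) P I T (eps : chain_map P (can_complex M))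
    (u : chain_map P I) (v : chain_map I T) (w : chain_map T (shift P)) Z :
  projective_resolution eps -> exact_triangle u v w -> acyclic Z -> orth v Z.
Proof.
move=> [projP P0 _] [X' [Y' [f [a [b [c [[aI bI cI] [_ cv _]]]]]]]] acZ.
have vP : vanish P Z by apply: (@vanish_bounded_above _ _ _ 0).
have vSP : vanish (shift P) Z.
  apply: (@vanish_bounded_above _ _ _ (-1)) => [n n1 x|n|//]; last exact: projP.
  by apply: P0; lia.
apply: (@orth_cancell _ _ _ _ c v); first exact: orth_iso.
apply: (@orth_homotopic _ _ _ (chain_comp (cone_in f) b)).
  exact: homotopic_sym.
apply: orth_comp; first exact: orth_iso.
apply: orth_cone_in; first exact: vanish_iso aI vP.
exact: vanish_iso (shift_iso aI) vSP.
Qed.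
End Resolutions.

Section UnitOf.
Variables (k : fieldType) (L : falgType k) (H : hopf_algebra L).
Implicit Types X Y Z : complex L.
Implicit Types M : lmodType L.

Section Unit.
Variables (T : complex L) (f : chain_map (can_complex (trivial_module H)) T).

Let y : T 0 := f 0 (trivial_one H).

Fact unit_of_invariant b : b *: y = (counit H b : k)%:A *: y.
Proof. by rewrite -!linearZ; congr (f 0 _); apply: trivial_invariant. Qed.

Fact unit_of_cycle : cd T 0 y = 0.
Proof. by rewrite -cmapd linear0. Qed.

(** The unit sends x to x (x) f(1). *)
Definition unit_of X : chain_map X (tensor_complex H X T) :=
  sval (cid (tensor_unit unit_of_invariant unit_of_cycle X)).

Lemma unit_ofE X n (e : n + 0 == n) x : unit_of X n x = tgen H e x y.
Proof. exact: (svalP (cid (tensor_unit unit_of_invariant unit_of_cycle X))). Qed.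

Lemma unit_of_natural X X' (a : chain_map X X') :
  homotopic (chain_comp (unit_of X') a)
    (chain_comp (tensor_map_right H T a) (unit_of X)).
Proof. by apply: tensor_unit_natural; apply: unit_ofE. Qed.
End Unit.

(** The unit of X is 1 (x) f : X (x) k -> X (x) T, up to the isomorphism between X
    and X (x) k. *)
Lemma orth_unit_of T (f : chain_map (can_complex (trivial_module H)) T) X Y :
  cocommutative H -> orth f (ihom H X Y) -> orth (unit_of f X) Y.
Proof.
move=> cocomH orthf.
have [F FE] := tensor_map_left cocomH X f.
pose rho := unit_of (chain_id (can_complex (trivial_module H))) X.
apply: (@orth_homotopic _ _ _ (chain_comp F rho)).
  apply: eq_homotopic => n x; have e : n + 0 == n by rewrite addr0.
  by rewrite /= !(unit_ofE _ e) FE.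
apply: orth_comp; last exact: orth_tensor FE orthf.
by apply: orth_iso; apply: tensor_trivial_iso => n e x; apply: unit_ofE.
Qed.

(** ** Complete resolutions *)

Section CompleteResolution.
Hypothesis cocomH : cocommutative H.
Variables (I : complex L) (eta : chain_map (can_complex (trivial_module H)) I).
Variables (P : complex L) (eps : chain_map P (can_complex (trivial_module H))).
Hypothesis eta_resolution : injective_resolution eta.
Hypothesis eps_resolution : projective_resolution eps.

Let C := cone (chain_comp eta eps).
Let c : chain_map (can_complex (trivial_module H)) C :=
  chain_comp (cone_in (chain_comp eta eps)) eta.
Let c0 : C 0 := c 0 (trivial_one H).

Lemma complete_acyclic : acyclic C.
Proof.
apply: cone_acyclic; apply: quasi_isomorphism_comp.
  by case: eps_resolution => _ _.
by case: eta_resolution => _ _.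
Qed.

(** The terms of the projective resolution are injective, too. *)
Lemma complete_injective : termwise_injective C.
Proof.
move=> n; case: eta_resolution eps_resolution => injI _ _ [projP _ _].
apply: injective_module_prod => //; exact: projective_injective.
Qed.

(** The cycles of degree 0 form the line through [c0]. *)
Lemma complete_cycles : exists2 r : C 0 -> trivial_module H, klinear r &
  r c0 = (1 : k) /\ forall z, cd C 0 z = 0 -> z = (r z : k)%:A *: c0.
Proof.
case: eta_resolution eps_resolution => injI I0 qeta [projP P0 _].
have c_inj : injective (c 0).
  move=> x x' /(congr1 snd)/= exx'; apply/eqP; rewrite -subr_eq0; apply/eqP.
  have [||y <-] := (qeta (-1)).1 (x - x') => //.
  by exists 0; rewrite linear0 linearB; apply/esym/eqP; rewrite subr_eq0; apply/eqP.
have [r rL rK] := klinear_retraction (klinear_linear (c 0)) c_inj.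
exists r => //; split=> [|[x y] [_ dxy]]; first exact: rK.
have x0 : x = 0 by apply: P0.
have [|y0 [y1 [_ yE]]] := (qeta (-1)).2 y.
  by move: dxy; rewrite /= x0 !linear0 add0r.
have y10 : y1 = 0 by apply: I0.
have -> : (x, y) = c 0 y0.
  by congr pair => //; rewrite yE y10 linear0 addr0.
rewrite rK -linearZ; congr (c 0 _).
apply/esym; apply: etrans (@trivial_algZ k L H y0 (1 : k)) _; exact: mulr1.
Qed.

(** Only the summand M (x) T^n of the n-th term is non-zero. *)
Lemma tensor_can_repr M T n (e : 0 + n == n)
    (w : tensor_complex H (can_complex M) T n) :
  exists z : htensor H M (T n), w = tsummand e (z : htensor H (can_complex M 0) (T n)).
Proof.
elim/tensor_complex_ind: w => [|w w' [z ->] [z' ->]|p q e' x t].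
- by exists 0; rewrite linear0.
- by exists (z + z'); rewrite linearD.
have [p0|p0] := eqVneq p 0; last first.
  by exists 0; rewrite linear0 [x](can_eq0 x p0) [LHS]tensor_gen0l.
move: p p0 e' x => _ -> e' x; have qn : q = n by rewrite -(eqP e') add0r.
move: e e'; case: n / qn => e e'.
by exists (tp H (x : M) t); apply: tgen_irr.
Qed.

(** The complex M (x) C has the cycles M (x) Z^0 C = M (x) k, because tensoring over
    a field is exact. *)
Lemma stable_object_of_cycles M : exists Y : complex L,
  [/\ acyclic Y, termwise_injective Y & exists2 f : {linear M -> Z0_module Y},
      injective f & forall z, exists m, f m = z].
Proof.
exists (tensor_complex H (can_complex M) C); split.
- exact/tensor_acyclic/complete_acyclic.
- move=> n; apply: dsum_injective => // i.
  by apply: tensor_injective => //; apply: complete_injective.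
have [r rL [rc0 rP]] := complete_cycles.
have e0 : 0 + 0 == 0 :> int by [].
have tC := tp_klinear2 H M (C 0).
exists (cycle_of (unit_of c (can_complex M))) => [m m'|z].
  move=> /(congr1 val); rewrite !cycle_ofE !(unit_ofE c e0) => /tsummand_inj.
  have [V VL VE] : exists2 V : htensor H M (C 0) -> M,
      klinear V & forall m z, V (tp H m z) = (r z : k)%:A *: m.
    apply: klinear_lift; split=> [n|z]; last by klin.
    by apply: klinear_scalel; apply: klinear_trivial.
  by move=> /(congr1 V); rewrite !VE rc0 !scale1r.
have [w wE] := tensor_can_repr e0 (val z).
have dw : htensor_map H (linear_id M) (cd C 0) w = 0.
  have e1 : 0 + (0 + 1) == 0 + 1 :> int by [].
  apply: (@tsummand_inj _ _ H (can_complex M) C _ _ _ e1).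
  rewrite linear0 -[RHS](Z0P z) wE.
  pose f1 : {linear htensor H M (C 0) -> tensor_complex H (can_complex M) C (0 + 1)} :=
    linear_comp (@tsummand _ _ H (can_complex M) C _ _ _ e1)
      (htensor_map H (linear_id M) (cd C 0)).
  pose f2 : {linear htensor H M (C 0) -> tensor_complex H (can_complex M) C (0 + 1)} :=
    linear_comp (cd (tensor_complex H (can_complex M) C) 0)
      (@tsummand _ _ H (can_complex M) C _ _ _ e0).
  suff f12 : f1 =1 f2 by apply: f12.
  apply: linear_ext_tp => m x.
  have e2 : 0 + 1 + 0 == 0 + 1 :> int by [].
  transitivity (@tgen _ _ H (can_complex M) C _ _ _ e1 m (cd C 0 x)).
    by rewrite /f1 /= htensor_map_tp.
  apply/esym; apply: etrans (cd_tgen H e0 e2 e1 _ _) _.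
  by rewrite [tgen H e2 _ _]tensor_gen0l [LHS]add0r [LHS]mulr1z.
have [t tL tP] := klinear_pseudoinverse (klinear_linear (cd C 0)).
have [g gL gE] := klinear_map H (@klinear_id k L M) tL.
have prL : klinear (fun x => x - t (cd C 0 x)).
  apply: klinear_add; first exact: klinear_id.
  apply: klinear_opp; apply: klinear_comp tL (klinear_linear _).
have [V VL VE] : exists2 V : htensor H M (C 0) -> M, klinear V &
    forall m x, V (tp H m x) = (r (x - t (cd C 0 x)) : k)%:A *: m.
  apply: klinear_lift; split=> [n|x]; last by klin.
  by apply: klinear_scalel; apply: klinear_trivial; apply: klinear_comp rL prL.
(* x - t d x is a cycle, so it is its value under r times c0 *)
have wV : tp H (V w) c0 = w.
  rewrite -[RHS]subr0 -(klinear0 gL) -dw.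
  move: w {wE dw}; apply: (@klinear_ext_tp _ _ H _ _ _ (fun w => tp H (V w) c0)
    (fun w => w - g (htensor_map H (linear_id M) (cd C 0) w))).
  - exact: klinear_tpl.
  - apply: klinear_add; first exact: klinear_id.
    by apply: klinear_opp; apply: klinear_comp gL (klinear_linear _).
  move=> m x; rewrite VE htensor_map_tp gE -(klinearB (tC.1 m)).
  rewrite (klinearZ (tC.2 c0)) -(klinearZ (tC.1 m)) -rP //.
  by rewrite linearB tP subrr.
exists (V w); apply: val_inj; rewrite cycle_ofE (unit_ofE c e0) wE.
by rewrite -[in RHS]wV.
Qed.
End CompleteResolution.
End UnitOf.

(** * The stable category *)

Lemma stably_equal_cycle_comp (R : pzRingType) (M : lmodType R)
    (X X' Y : complex R) (u : chain_map (can_complex M) X)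
    (u' : chain_map (can_complex M) X') (g : chain_map X Y)
    (g' : chain_map X' Y) :
  stably_equal (cycle_of (chain_comp g u)) (cycle_of (chain_comp g' u')) <->
  stably_equal (linear_comp (Z0_linear g) (cycle_of u))
    (linear_comp (Z0_linear g') (cycle_of u')).
Proof.
have E (Z : complex R) (e : chain_map Z Y) (c : chain_map (can_complex M) Z) :
    cycle_of (chain_comp e c) =1 linear_comp (Z0_linear e) (cycle_of c).
  by move=> m; apply: val_inj.
split=> [|] [I [a [b [injI ab]]]]; exists I, a, b; split=> // m.
  by rewrite -!E ab.
by rewrite !E ab.
Qed.

Section StableUnit.
Variables (k : fieldType) (L : falgType k) (H : hopf_algebra L).
Hypothesis cocomH : cocommutative H.
Variables (T : complex L) (f : chain_map (can_complex (trivial_module H)) T).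
Hypothesis orthf : forall Y, acyclic Y -> termwise_injective Y -> orth f Y.
Implicit Types X Y Z : complex L.
Implicit Types M N : lmodType L.

Lemma orth_unit_acyclic X Y :
  acyclic Y -> termwise_injective Y -> orth (unit_of f X) Y.
Proof.
move=> acY injY; apply: orth_unit_of => //; apply: orthf.
  exact: ihom_acyclic.
exact: ihom_termwise_injective.
Qed.

(** The map M -> Z^0 (M (x) T) that the unit of the adjunction induces. *)
Definition stable_unit M : {linear M -> Z0_module (tensor_complex H (can_complex M) T)} :=
  cycle_of (unit_of f (can_complex M)).

Lemma stable_unit_natural M N (a : {linear M -> N}) :
  stably_equal (linear_comp (stable_unit N) a)
    (linear_comp (Z0_linear (tensor_map_right H T (can_map a))) (stable_unit M)).
Proof.
apply: stably_equal_heq => m; apply: val_inj.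
rewrite -[RHS]/(tensor_map_right H T (can_map a) 0 (unit_of f (can_complex M) 0 m)).
rewrite -[LHS]/(unit_of f (can_complex N) 0 (a m)).
have e : 0 + 0 == 0 :> int by [].
by rewrite !(unit_ofE _ e) [RHS]tensor_cmap_gen.
Qed.

Lemma orth_stable_unit M Y (g g' : chain_map (tensor_complex H (can_complex M) T) Y) :
  acyclic Y -> termwise_injective Y ->
  stably_equal (linear_comp (Z0_linear g) (stable_unit M))
    (linear_comp (Z0_linear g') (stable_unit M)) -> homotopic g g'.
Proof.
move=> acY injY gg'; apply: (orth_unit_acyclic (can_complex M) acY injY).1.
apply: (homotopic_of_cycle (injective_projective cocomH) acY).
exact/stably_equal_cycle_comp.
Qed.

(** By naturality the two maps agree up to homotopy after composition with the
    unit, and the unit can be cancelled. *)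
Lemma stably_equal_homotopic M N (a b : {linear M -> N}) :
  acyclic (tensor_complex H (can_complex N) T) ->
  termwise_injective (tensor_complex H (can_complex N) T) ->
  stably_equal a b ->
  homotopic (tensor_map_right H T (can_map a)) (tensor_map_right H T (can_map b)).
Proof.
move=> acN injN ab; apply: orth_stable_unit => //.
apply: stably_equal_trans (stably_equal_sym (stable_unit_natural a)) _.
apply: stably_equal_trans (stable_unit_natural b).
by apply: stably_equal_comp ab; apply: stably_equal_heq.
Qed.
End StableUnit.

Theorem theorem8p2 (k : fieldType) (L : falgType k) (H : hopf_algebra L)
  (H_cocommutative : cocommutative H)
  (ik : KInj L)
  (eta : chain_map (can_complex (trivial_module H)) (sval ik))
  (ik_resolution : injective_resolution eta)
  (pk : complex L)
  (eps : chain_map pk (can_complex (trivial_module H)))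
  (pk_resolution : projective_resolution eps)
  (tk : S_category L)
  (v : chain_map (sval ik) (sval (sval tk)))
  (w : chain_map (sval (sval tk)) (shift pk))
  (tk_triangle : exact_triangle (chain_comp eta eps) v w) :
  (exists FI : forall X : homotopy_category L,
       termwise_injective (tensor_functor H (sval ik) X),
     left_adjoint (to_KInj FI) (KInj_inclusion L)) /\
  (exists (FI : forall X : KInj L, termwise_injective
         (comp_functor (tensor_functor H (sval (sval tk)))
            (KInj_inclusion L) X))
      (FA : forall X : KInj L, acyclic (sval (to_KInj FI X))),
     left_adjoint (to_S FA) (S_inclusion L)) /\
  (exists (FI : forall M : module_category L, termwise_injective
         (comp_functor (tensor_functor H (sval (sval tk))) (can_functor L) M))
      (FA : forall M : module_category L, acyclic (sval (to_KInj FI M)))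
      (FS : forall (M N : module_category L) (f g : mor M N),
         crel (stable_congruence L) f g ->
         fmap (to_S FA) f ~= fmap (to_S FA) g),
     equivalence_with_quasi_inverse (induced_functor FS) (Z0 L)).
Proof.
have injX (X T : complex L) : termwise_injective T ->
    termwise_injective (tensor_complex H X T).
  by move=> injT n; apply: dsum_injective => // i; apply: tensor_injective.
pose K := sval (sval tk).
have injK : termwise_injective K := svalP (sval tk).
have acK : acyclic K := svalP tk.
pose f := chain_comp v eta.
have orth_eta Y : termwise_injective Y -> orth eta Y.
  exact: orth_resolution ik_resolution.
have orth_f Y : acyclic Y -> termwise_injective Y -> orth f Y.
  move=> acY injY; apply: orth_comp; first exact: orth_eta.
  exact: orth_tate pk_resolution tk_triangle acY.
split; [|split].
- have FI (X : homotopy_category L) :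
      termwise_injective (tensor_functor H (sval ik) X).
    exact/injX/(svalP ik).
  exists FI; apply: (@left_adjoint_of_units _ _ (to_KInj FI) (KInj_inclusion L)
    (fun X => unit_of eta X)) => [X X' a|X Y g g'|X Y h].
  + exact: unit_of_natural.
  + have orthY : orth (unit_of eta X) (sval Y).
      apply: orth_unit_of => //; apply: orth_eta; apply: ihom_termwise_injective => //.
      exact: svalP Y.
    exact: orthY.1.
  have orthY : orth (unit_of eta X) (sval Y).
    apply: orth_unit_of => //; apply: orth_eta; apply: ihom_termwise_injective => //.
    exact: svalP Y.
  exact: orthY.2.
- have FI (X : KInj L) : termwise_injective
      (comp_functor (tensor_functor H K) (KInj_inclusion L) X) by apply: injX.
  have FA (X : KInj L) : acyclic (sval (to_KInj FI X)) by apply: tensor_acyclic.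
  exists FI, FA; apply: (@left_adjoint_of_units _ _ (to_S FA) (S_inclusion L)
    (fun X => unit_of f (sval X))) => [X X' a|X Y g g'|X Y h].
  + exact: unit_of_natural.
  + exact: (orth_unit_acyclic H_cocommutative orth_f (sval X) (svalP Y) (svalP (sval Y))).1.
  exact: (orth_unit_acyclic H_cocommutative orth_f (sval X) (svalP Y) (svalP (sval Y))).2.
have FI (M : module_category L) : termwise_injective
    (comp_functor (tensor_functor H K) (can_functor L) M) by apply: injX.
have FA (M : module_category L) : acyclic (sval (to_KInj FI M)).
  exact: tensor_acyclic.
have FS (M N : module_category L) (a b : mor M N) :
    crel (stable_congruence L) a b -> fmap (to_S FA) a ~= fmap (to_S FA) b.
  apply: (stably_equal_homotopic H_cocommutative orth_f); first exact: FA.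
  exact: FI.
exists FI, FA, FS.
have injproj := injective_projective H_cocommutative.
apply: (@equivalence_of_units _ _ (induced_functor FS) (Z0 L)
  (fun M => stable_unit f M)) => [M N a|M Y g g'|M Y h|Y Y' g g'|Y Y' h|M].
- exact: stable_unit_natural.
- move=> gg'; apply: (orth_stable_unit H_cocommutative orth_f (M := M)) gg'.
    exact: (svalP Y).
  exact: (svalP (sval Y)).
- have [g gh] := (orth_unit_acyclic H_cocommutative orth_f (can_complex M)
    (svalP Y) (svalP (sval Y))).2 (chain_comp (cycle_in _) (can_map h)).
  exists g; apply: stably_equal_trans (stably_equal_heq (@cycle_of_in _ _ _ h)).
  apply: stably_equal_trans (cycle_of_homotopic (svalP (sval Y)) gh).
  by apply: stably_equal_heq => m; apply: val_inj.
- move=> gg'; have orthY := orth_cycle_in injproj (svalP Y) (svalP (sval Y))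
    (svalP Y') (svalP (sval Y')).
  apply: orthY.1; apply: (homotopic_of_cycle injproj (svalP Y')).
  apply/stably_equal_cycle_comp; apply: stably_equal_comp gg' _.
  exact: stably_equal_heq.
- have [g gh] := (orth_cycle_in injproj (svalP Y) (svalP (sval Y))
    (svalP Y') (svalP (sval Y'))).2 (chain_comp (cycle_in _) (can_map h)).
  exists g; apply: stably_equal_trans (stably_equal_heq (@cycle_of_in _ _ _ h)).
  apply: stably_equal_trans (cycle_of_homotopic (svalP (sval Y')) gh).
  by apply: stably_equal_heq => m; apply: val_inj.
have [Y [acY injY [a a_inj a_surj]]] :=
  stable_object_of_cycles H_cocommutative ik_resolution pk_resolution M.
have [b ab ba] := linear_inverse a_inj a_surj.
exists (exist _ (exist _ Y injY : KInj L) acY : S_category L), a, b.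
by split; apply: stably_equal_heq.
Qed.
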